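(* Let $d\in\mathbb{N}$, $\epsilon>0$ and $k\in\{1,\dots,d-1\}$. There exists a constant $C$ depending only on $d,k,\epsilon$ such that for all $\mathcal{H}\in\bar{\mathbb{Q}}\cap[1,\infty)$: (i) if $K$ denotes the normal closure of $\mathbb{Q}(\mathcal{H}^d)$ and $l\in\mathbb{N}$ divides $\gcd(k,d)$, then $|\{\alpha\in A(k,d,\mathcal{H}): [K(\alpha):K]=l\}|\le C\mathcal{H}^{d(l-1)+\epsilon}$; (ii) $|A(k,d,\mathcal{H})|\le C\mathcal{H}^{d(\gcd(k,d)-1)+\epsilon}$; (iii) $|\{\alpha\in A(k,d,\mathcal{H}): \text{the Galois group of the normal closure of }\mathbb{Q}(\alpha)\text{ acts primitively on the set of conjugates of }\alpha\}|\le C\mathcal{H}^{\epsilon}$. In particular, if $\gcd(k,d)=1$, then the limit $a(k,d)$ exists and equals $0$.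
   Context: $\bar{\mathbb{Q}}$ is the algebraic closure of $\mathbb{Q}$ in $\mathbb{C}$. For algebraic $\alpha$ of degree $d$, with $a_0>0$ the leading coefficient of a minimal polynomial of $\alpha$ in $\mathbb{Z}[t]$ and conjugates $\alpha_1,\dots,\alpha_d$, $H(\alpha)=\big(a_0\prod_i\max\{1,|\alpha_i|\}\big)^{1/d}$ (absolute multiplicative Weil height). $A(k,d,\mathcal{H})=\{\alpha\in\mathbb{C}: [\mathbb{Q}(\alpha):\mathbb{Q}]=d,\ H(\alpha)=\mathcal{H},$ precisely $k$ conjugates of $\alpha$ in the open unit disk$\}$; $A(k,d)=\bigcup_{\mathcal{H}\ge1}A(k,d,\mathcal{H})$; $B(k,d)=\{H(\alpha):\alpha\in A(k,d)\}$; $a(k,d)=\lim_{\mathcal{H}\in B(k,d),\mathcal{H}\to\infty}\log|A(k,d,\mathcal{H})|/\log\mathcal{H}$ when it exists. *)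

(* Defs.v *)
From Stdlib Require Import Reals.
From mathcomp Require Import all_boot all_order all_algebra.
From mathcomp Require Import complex.
From mathcomp Require Import Rstruct.

Set Implicit Arguments.
Unset Strict Implicit.
Unset Printing Implicit Defensive.

Import Order.TTheory GRing.Theory Num.Theory.
Local Open Scope ring_scope.

Notation RR := Rdefinitions.R.
Notation CC := (RR[i]).

Definition absC (z : CC) : RR := complex.Re `|z|.

Definition intC (p : {poly int}) : {poly CC} := map_poly (fun z : int => z%:~R) p.

Definition algebraic (z : CC) : Prop :=
  exists p : {poly rat}, p != 0 /\ root (map_poly (fun q : rat => ratr q) p) z.

Definition Zminpoly (alpha : CC) (p : {poly int}) : Prop :=
  [/\ p != 0, 0 < lead_coef p, zcontents p = 1, root (intC p) alpha
    & forall q : {poly int}, q != 0 -> root (intC q) alpha -> leq (size p) (size q)].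

Definition conjugate (alpha beta : CC) : Prop :=
  exists p, Zminpoly alpha p /\ root (intC p) beta.

Definition root_list (p : {poly int}) (s : seq CC) : Prop :=
  uniq s /\ forall z, z \in s <-> root (intC p) z.

(* absolute multiplicative Weil height computed from the minimal polynomial
   p (degree d = size p - 1, leading coefficient a_0) and its roots s:
   (a_0 * prod_i max(1,|alpha_i|))^(1/d) *)
Definition heightW (p : {poly int}) (s : seq CC) : RR :=
  Rpower ((lead_coef p)%:~R * \prod_(z <- s) Num.max 1 (absC z))
         (((size p).-1)%:R)^-1.

Definition in_A (k d : nat) (H : RR) (alpha : CC) : Prop :=
  exists (p : {poly int}) (s : seq CC),
    [/\ Zminpoly alpha p, root_list p s, size p = d.+1,
        count (fun z => absC z < 1) s = k & heightW p s = H].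

Definition in_B (k d : nat) (H : RR) : Prop := exists alpha, in_A k d H alpha.

(* |{z | P z}| <= b  (in particular the set is finite) *)
Definition card_le (P : CC -> Prop) (b : RR) : Prop :=
  forall s : seq CC, uniq s -> (forall z, z \in s -> P z) -> (size s)%:R <= b.

Definition is_subfield (F : CC -> Prop) : Prop :=
  [/\ F 1, (forall x y, F x -> F y -> F (x - y)),
      (forall x y, F x -> F y -> F (x * y)) & (forall x, F x -> F x^-1)].

Definition subfield_gen (S : CC -> Prop) : CC -> Prop :=
  fun z => forall F, is_subfield F -> (forall x, S x -> F x) -> F z.

Definition normal_closure (gamma : CC) : CC -> Prop :=
  subfield_gen (conjugate gamma).

(* [K(alpha):K] = n, i.e. the minimal polynomial of alpha over the subfield K
   has degree n *)
Definition ext_degree (K : CC -> Prop) (alpha : CC) (n : nat) : Prop :=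
  (exists p : {poly CC}, [/\ p != 0, forall i, K p`_i, root p alpha & size p = n.+1])
  /\ forall q : {poly CC}, q != 0 -> (forall i, K q`_i) -> root q alpha ->
       leq n.+1 (size q).

(* sigma (restricted to L) is a field automorphism of the subfield L;
   these form Gal(L/Q) *)
Definition is_aut (L : CC -> Prop) (sigma : CC -> CC) : Prop :=
  (forall x, L x -> L (sigma x)) /\
  [/\ forall x y, L x -> L y -> sigma (x + y) = sigma x + sigma y,
      forall x y, L x -> L y -> sigma (x * y) = sigma x * sigma y,
      sigma 1 = 1,
      forall x y, L x -> L y -> sigma x = sigma y -> x = y
    & forall y, L y -> exists x, L x /\ sigma x = y].

(* The Galois group of the normal closure L of Q(alpha) acts primitively on
   the set of conjugates of alpha: transitively, and with only trivial blocks
   (a block B satisfies sigma(B) = B or sigma(B) /\ B = empty for all sigma). *)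
Definition gal_primitive (alpha : CC) : Prop :=
  let L := normal_closure alpha in
  (forall x y, conjugate alpha x -> conjugate alpha y ->
     exists sigma, is_aut L sigma /\ sigma x = y) /\
  (forall B : CC -> Prop,
     (forall x, B x -> conjugate alpha x) ->
     (forall sigma, is_aut L sigma ->
        (forall x, B x -> B (sigma x)) \/ (forall x, B x -> ~ B (sigma x))) ->
     (forall x y, B x -> B y -> x = y) \/ (forall x, conjugate alpha x -> B x)).

Definition a_lim_zero (k d : nat) : Prop :=
  forall e : RR, 0 < e -> exists M : RR, forall H : RR, in_B k d H -> M <= H ->
    exists s : seq CC, [/\ uniq s, (forall z, z \in s <-> in_A k d H z)
                         & `| ln (size s)%:R / ln H | < e].

(* Main.v *)
From Pilot Require Import Defs.
From HB Require Import structures.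
From Stdlib Require Import Reals.
From mathcomp Require Import all_boot all_order all_algebra.
From mathcomp Require Import all_fingroup all_field.
From mathcomp Require Import complex.
From mathcomp Require Import boolp classical_sets.
From mathcomp Require Import Rstruct.
From mathcomp Require Import ring lra zify.
Import Pilot.Defs.
Import Order.TTheory GRing.Theory Num.Theory.
Local Open Scope ring_scope.

Set Implicit Arguments.
Unset Strict Implicit.
Unset Printing Implicit Defensive.

(** Write [gamma = H^d].  For [alpha] in [A(k,d,H)] with leading coefficient [a] one has
    [gamma = ± a * prod_(|z| >= 1) z] over the conjugates [z] of [alpha], so a Galois
    automorphism fixing [gamma] permutes the conjugates of modulus at least [1]: their
    product strictly dominates that of any other set of as many conjugates.  Hence the orbits of [N = Gal(E/K)] on the
    conjugates, all of size [l = [K(alpha):K]], lie inside or outside the open unit disk,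
    and [l] divides both [k] and [d].

    To count the [alpha] with given [l], let [F] be the minimal polynomial of [alpha] over
    [K]; the polynomial of [alpha] is [a] times the product of the [m = d/l] conjugates
    [F_A] of [F].  Let [n] be the norm of [gamma].  Only the primes dividing [n] occur in
    the Mahler-type contents and in the constant terms of the [F_A], with exponents
    bounded through [n], so by the divisor bound there are [O(H^eps)] possible systems of
    valuations.  The constant term of [F] is determined up to a unit all of whose
    conjugates have prescribed size, which leaves [O(H^eps)] values.  Each of the
    remaining [l - 1] coefficients [c] is located in a grid with [O(H^l)] cells for each
    of its [m] conjugates; if [c] and [c'] lie in the same cell and have the same
    contents, then [a * N(c - c')] is an integer smaller than [1], whence [c = c'].  This
    gives [O(H^(l*m*(l-1) + eps)) = O(H^(d*(l-1) + eps))] polynomials [F]. *)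

(** * Valuation rings above a prime *)

(** The coefficients of [F] already lie in the fixed field of [N * Stab(alpha)], whose degree over
    the rationals is the number [m] of blocks, while [K] may have much larger degree. Norms from
    this smaller field have only [m] factors, whence the exponent [l*m*(l-1)]. The field varies with
    [alpha], but it belongs to a group containing [N], and the index of [N] is at most [d^d], free
    of [H].

    Ideal theory is avoided: above each prime one valuation ring is chosen arbitrarily, and the
    other places are reached by letting coset representatives act. Its value group stays unknown; a
    Newton polygon argument puts the valuations of the conjugates of [alpha] in [(1/d!) Z], so that
    integers can code them.

    The constant term is cheaper than the other coefficients: two candidates with the same codes
    differ by a unit factor, so the integer to be killed is the norm of [C/C' - 1], and a grid of
    bounded size per block gives enough relative precision. For the other coefficients [a] has to
    clear denominators, and the cells must shrink like [H^-l] relative to the Mahler measure of the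
    block. *)

(* The reduction step of the classical proof that a subring which is maximal among those
   not containing [p^-1] is a valuation ring: the degree of a relation [1 = c * q(x)] is
   lowered with the help of a relation [1 = c * r(x^-1)]. *)
Lemma inv_combination (F : fieldType) (x c : F) (n m : nat) (a b : nat -> F) :
  (0 < n)%N -> (m <= n)%N -> x != 0 ->
  \sum_(i < n.+1) c * a i * x ^+ i = 1 ->
  \sum_(j < m.+1) c * b j * x^-1 ^+ j = 1 ->
  \sum_(i < n) c * ((if i == 0%N :> nat then b 0%N else 0) + (1 - c * b 0%N) * a i
     + a n * (c * (if (n - i <= m)%N then b (n - i)%N else 0))) * x ^+ i = 1.
Proof.
case: n => // n _ le_mn nz_x.
rewrite big_ord_recr /= => Da; rewrite big_ord_recl /= expr0 mulr1 => Db.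
have Db' : \sum_(i < n.+1) (c * (if (n.+1 - i <= m)%N then b (n.+1 - i)%N else 0)) * x ^+ i
    = x ^+ n.+1 * (1 - c * b 0%N).
  have -> : 1 - c * b 0%N = \sum_(i < m) c * b (bump 0 i) * x^-1 ^+ bump 0 i.
    by rewrite -Db addrC addKr.
  rewrite (reindex_inj rev_ord_inj) /= mulr_sumr.
  rewrite (big_ord_widen_cond n.+1 xpredT (fun i => x ^+ n.+1 *
      (c * b (bump 0 i) * x^-1 ^+ bump 0 i))) //= [RHS]big_mkcond /=.
  apply: eq_bigr => i _; rewrite subKn // subSS.
  case: ifP => _; last by rewrite mulr0 mul0r.
  have lein : (i <= n)%N by rewrite -ltnS.
  have -> : x ^+ n.+1 = x ^+ (n - i) * x ^+ i.+1 by rewrite -exprD addnS subnK.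
  rewrite /bump add1n exprVn [_ * _^-1]mulrC mulrA -[_ * _ * _^-1]mulrA.
  by rewrite divff ?expf_neq0 // mulr1 mulrC.
transitivity (\sum_(i < n.+1) ((if i == 0%N :> nat then c * b 0%N else 0) +
   ((1 - c * b 0%N) * (c * a i * x ^+ i) +
    c * a n.+1 * (c * (if (n.+1 - i <= m)%N then b (n.+1 - i)%N else 0) * x ^+ i)))).
  by apply: eq_bigr => i _; case: eqP => [-> | _]; rewrite ?expr0 /=; ring.
rewrite !big_split /= -!mulr_sumr Db' big_ord_recl /= big1 ?addr0 //.
by move: Da => /(canRL (addrK _)) ->; ring.
Qed.

Definition valuation_ring (F : fieldType) (p : nat) (V : {pred F}) :=
  [/\ subring_closed V, p%:R^-1 \notin V
    & forall x, x != 0 -> x \in V \/ x^-1 \in V].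

Lemma valuation_ring_exists (F : fieldType) (ell : nat) :
  ell%:R != 0 :> F -> (forall z : int, z%:~R != ell%:R^-1 :> F) ->
  exists V : {pred F}, valuation_ring ell V.
Proof.
move=> nz_p0 p_notin0; have [p [Dp nz_p p_notin]] : exists q : F,
  [/\ q = ell%:R, q != 0 & forall z : int, z%:~R != q^-1] by exists ell%:R.
pose subr (A : set F) := [/\ A 1, forall x y, A x -> A y -> A (x - y),
  forall x y, A x -> A y -> A (x * y) & ~ A p^-1].
have [A [PA maxA]] : exists A : set F, (A = set0 \/ subr A) /\
    forall B, (A `<` B)%classic -> ~ (B = set0 \/ subr B).
  apply: Zorn_bigcup => C sub_C tot_C.
  have [[X CX /not_orP [nX0 _]] | noC] :=
      pselect (exists2 X, C X & ~ (X = set0 \/ False)); last first.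
    left; apply/seteqP; split=> // x [X CX Xx]; case: noC; exists X => //.
    by case=> // X0; rewrite X0 in Xx.
  have subX Y y : C Y -> Y y -> subr Y.
    by move=> CY Yy; case: (sub_C _ CY) => // Y0; rewrite Y0 in Yy.
  have [x Xx] : exists x, X x by apply/set0P/eqP.
  have two x1 y1 : (\bigcup_(Y in C) Y)%classic x1 -> (\bigcup_(Y in C) Y)%classic y1 ->
     exists Y, [/\ C Y, Y x1 & Y y1].
    move=> [Y1 CY1 Yx] [Y2 CY2 Yy].
    by have [s|s] := tot_C _ _ CY1 CY2; [exists Y2 | exists Y1]; split=> //; apply: s.
  right; split.
  - by exists X => //; case: (subX _ _ CX Xx).
  - move=> x1 y1 Ux Uy; have [Y [CY Yx Yy]] := two _ _ Ux Uy.
    by exists Y => //; case: (subX _ _ CY Yx) => _ sY _ _; apply: sY.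
  - move=> x1 y1 Ux Uy; have [Y [CY Yx Yy]] := two _ _ Ux Uy.
    by exists Y => //; case: (subX _ _ CY Yx) => _ _ sY _; apply: sY.
  - by case=> Y CY Yp; case: (subX _ _ CY Yp).
have{PA} [A1 AB AM Ap] : subr A.
  case: PA => // A0; exfalso; apply: (maxA [set z | exists i : int, z = i%:~R])%classic.
    by rewrite A0; split=> // /(_ 1) h; apply: h; exists 1.
  right; split; first by exists 1.
  - by move=> _ _ [i ->] [j ->]; exists (i - j); rewrite rmorphB.
  - by move=> _ _ [i ->] [j ->]; exists (i * j); rewrite rmorphM.
  - by case=> i /eqP; rewrite eq_sym (negPf (p_notin i)).
have A0 : A 0 by rewrite -(subrr 1); apply: AB.
have AN x : A x -> A (- x) by move=> Ax; rewrite -sub0r; apply: AB.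
have AD x y : A x -> A y -> A (x + y) by move=> Ax Ay; rewrite -[y]opprK; apply/AB/AN.
have An (n : nat) : A n%:R by elim: n => // n IHn; rewrite -natr1; apply: AD.
have Asum (I : Type) (r : seq I) (P : pred I) f : (forall i, P i -> A (f i)) -> A (\sum_(i <- r | P i) f i).
  by move=> Af; elim/big_ind: _.
(* The ring generated by [A] and [x] is strictly larger than [A], so by maximality it contains
   [p^-1]; multiplying that expression by [p] gives the relation. *)
have Adj x : ~ A x -> exists n (a : nat -> F), (forall i, A (a i)) /\ \sum_(i < n.+1) p * a i * x ^+ i = 1.
  move=> nAx.
  pose polA (q : {poly F}) := forall i, A q`_i.
  pose B : set F := [set z | exists2 q, polA q & z = q.[x]]%classic.
  have AsubB : (A `<` B)%classic.
    split=> [z Az | BA].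
      by exists z%:P; rewrite ?hornerC // => i; rewrite coefC; case: eqP.
    by apply/nAx/BA; exists 'X; rewrite ?hornerX // => i; rewrite coefX; case: eqP.
  have Bp : B p^-1.
    apply: contrapT => Bp; apply: (maxA _ AsubB); right; split=> //.
    - by case: AsubB => + _; apply.
    - move=> _ _ [q Aq ->] [r Ar ->]; exists (q - r); last by rewrite !hornerE.
      by move=> i; rewrite coefB; apply: AB.
    - move=> _ _ [q Aq ->] [r Ar ->]; exists (q * r); last by rewrite !hornerE.
      by move=> i; rewrite coefM; apply: Asum => j _; apply: AM.
  have [q Aq Dq] := Bp; exists (size q), (fun i => q`_i); split=> //.
  rewrite big_ord_recr /= nth_default // mulr0 mul0r addr0.
  rewrite -(mulfV nz_p) Dq horner_coef mulr_sumr.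
  by apply: eq_bigr => i _; rewrite mulrA.
pose Pn x n := exists a : nat -> F, (forall i, A (a i)) /\ \sum_(i < n.+1) p * a i * x ^+ i = 1.
have Pn_gt0 x n : Pn x n -> (0 < n)%N.
  case: n => // -[a [Aa]]; rewrite big_ord1 expr0 mulr1 => pa1; case: Ap.
  by rewrite -[p^-1]mulr1 -pa1 mulKf.
have Ap1 : A p by rewrite Dp.
have step x n m : x != 0 -> (m <= n)%N -> Pn x n -> Pn x^-1 m -> Pn x n.-1.
  move=> nzx le_mn Pa Pb; have n_gt0 := Pn_gt0 _ _ Pa.
  have [[a [Aa Da]] [b [Ab Db]]] := (Pa, Pb).
  pose e i := (if i == 0%N then b 0%N else 0) + (1 - p * b 0%N) * a i
       + a n * (p * (if (n - i <= m)%N then b (n - i)%N else 0)).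
  exists e; split; last by rewrite prednK //; exact: (inv_combination n_gt0 le_mn nzx Da Db).
  move=> i; rewrite /e; apply: (AD); first apply: (AD).
  - by case: eqP.
  - by apply: (AM) => //; apply: AB => //; apply: AM.
  - by apply: (AM) => //; apply: (AM) => //; case: ifP.
(* Descent on the sum of the two degrees: the larger one is lowered each time, and degree 0 is
   impossible since it would put [p^-1] into [A]. *)
have noPn N x n m : x != 0 -> (n + m <= N)%N -> Pn x n -> Pn x^-1 m -> False.
  elim: N x n m => [|N IH] x n m nzx le_N Px Py.
    by move: (Pn_gt0 _ _ Px) le_N; case: n {Px}.
  have [n_gt0 m_gt0] := (Pn_gt0 _ _ Px, Pn_gt0 _ _ Py).
  have [le_mn|lt_nm] := leqP m n.
    apply: (IH x n.-1 m) => //; first by rewrite -ltnS -addSn prednK.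
    exact: step Px Py.
  apply: (IH x n m.-1) => //; first by rewrite -ltnS -addnS prednK.
  by apply: step (ltnW lt_nm) Py _; rewrite ?invr_eq0 ?invrK.
exists ((fun x => `[< A x >]) : {pred F}); split.
- split; rewrite ?unfold_in; first exact/asboolP.
  + by move=> x y; rewrite !unfold_in => /asboolP Ax /asboolP Ay; apply/asboolP/AB.
  + by move=> x y; rewrite !unfold_in => /asboolP Ax /asboolP Ay; apply/asboolP/AM.
- by rewrite -Dp unfold_in; apply/asboolP.
move=> x nzx; rewrite !unfold_in; apply: contrapT => /not_orP [nAx nAy].
have [n Px] := Adj _ (contra_not (asboolT (P := _)) nAx).
have [m Py] := Adj _ (contra_not (asboolT (P := _)) nAy).
exact: (noPn (n + m)%N x n m).
Qed.
Definition vunit (F : fieldType) (V : {pred F}) (x : F) :=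
  [&& x != 0, x \in V & x^-1 \in V].

Section ValuationRing.

Variables (F : fieldType) (p : nat) (V : {pred F}).
Hypothesis (hV : valuation_ring p V).

Lemma vringB x y : x \in V -> y \in V -> x - y \in V.
Proof. by case: hV => -[_ h _] _ _; exact: h. Qed.

Lemma vringM x y : x \in V -> y \in V -> x * y \in V.
Proof. by case: hV => -[_ _ h] _ _; exact: h. Qed.

Lemma vring1 : 1 \in V.
Proof. by case: hV => -[]. Qed.

Lemma vring0 : 0 \in V.
Proof. by rewrite -(subrr 1) vringB ?vring1. Qed.

Lemma vringN x : x \in V -> - x \in V.
Proof. by move=> Vx; rewrite -sub0r vringB ?vring0. Qed.

Lemma vringD x y : x \in V -> y \in V -> x + y \in V.
Proof. by move=> Vx Vy; rewrite -[y]opprK vringB ?vringN. Qed.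

Lemma vring_nat n : n%:R \in V.
Proof. by elim: n => [|n IH]; rewrite ?vring0 // -natr1 vringD ?vring1. Qed.

Lemma vring_int z : z%:~R \in V.
Proof.
case: z => n; first exact: (vring_nat n).
by rewrite NegzE mulrNz vringN //; exact: (vring_nat n.+1).
Qed.

Lemma vringX x n : x \in V -> x ^+ n \in V.
Proof. by move=> Vx; elim: n => [|n IH]; rewrite ?vring1 // exprS vringM. Qed.

Lemma vring_sum I (r : seq I) (P : pred I) f :
  (forall i, P i -> f i \in V) -> \sum_(i <- r | P i) f i \in V.
Proof. by move=> Vf; elim/big_ind: _ => //; [exact: vring0 | exact: vringD]. Qed.

Lemma vring_prod I (r : seq I) (P : pred I) f :
  (forall i, P i -> f i \in V) -> \prod_(i <- r | P i) f i \in V.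
Proof. by move=> Vf; elim/big_ind: _ => //; [exact: vring1 | exact: vringM]. Qed.

Lemma vring_total x : x \in V \/ x^-1 \in V.
Proof.
by have [->|nzx] := eqVneq x 0; [left; exact: vring0 | case: hV => _ _; apply].
Qed.

Lemma vunit1 : vunit V 1.
Proof. by rewrite /vunit oner_eq0 invr1 vring1. Qed.

Lemma vunitM x y : vunit V x -> vunit V y -> vunit V (x * y).
Proof.
by case/and3P=> nzx Vx Vx' /and3P[nzy Vy Vy']; rewrite /vunit mulf_neq0 // invfM !vringM.
Qed.

Lemma vunitV x : vunit V x^-1 = vunit V x.
Proof. by rewrite /vunit invr_eq0 invrK [X in _ && X]andbC. Qed.

Lemma vunit_div x y : vunit V x -> vunit V y -> vunit V (x / y).
Proof. by move=> Ux Uy; rewrite vunitM ?vunitV. Qed.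

Lemma vunitX x n : vunit V x -> vunit V (x ^+ n).
Proof. by move=> Ux; elim: n => [|n IH]; rewrite ?vunit1 // exprS vunitM. Qed.

Lemma vunitN x : vunit V (- x) = vunit V x.
Proof.
have aux y : vunit V y -> vunit V (- y).
  by case/and3P=> *; rewrite /vunit oppr_eq0 invrN !vringN ?andbT.
by apply/idP/idP => [/aux|]; rewrite ?opprK // => /aux.
Qed.

Lemma vunit_neq0 x : vunit V x -> x != 0. Proof. by case/and3P. Qed.

(** A valuation ring is local: if, say, [x / y] lies in [V], then [y] divides [x + y], hence is a
    unit when [x + y] is one. *)
Lemma vunit_sub x y : x \in V -> y \in V -> vunit V (x + y) -> vunit V x \/ vunit V y.
Proof.
move=> Vx Vy Uxy.
have [x0|nzx] := eqVneq x 0; first by right; rewrite x0 add0r in Uxy.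
have [y0|nzy] := eqVneq y 0; first by left; rewrite y0 addr0 in Uxy.
have aux a b : a != 0 -> b != 0 -> a \in V -> a / b \in V -> b \in V ->
    vunit V (a + b) -> vunit V b.
  move=> nza nzb Va Vab Vb /and3P[nzab _ Vab'].
  rewrite /vunit nzb Vb; have -> : b^-1 = (a / b + 1) * (a + b)^-1 by field; rewrite nzab.
  by rewrite vringM ?vringD ?vring1.
have [|] := vring_total (x / y); first by right; apply: (aux x).
by rewrite invf_div => *; left; apply: (aux y); rewrite // addrC.
Qed.

Lemma vunit_sum_ex (I : eqType) (r : seq I) (P : pred I) f :
  (forall i, P i -> f i \in V) -> vunit V (\sum_(i <- r | P i) f i) ->
  exists i, [/\ i \in r, P i & vunit V (f i)].
Proof.
move=> Vf; elim: r => [|j r IH]; first by rewrite big_nil /vunit eqxx.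
rewrite big_cons; case: ifP => Pj.
  move=> /(vunit_sub (Vf _ Pj) (vring_sum _ Vf)) [U|/IH[i [ri Pi U]]].
    by exists j; rewrite inE eqxx.
  by exists i; rewrite inE ri orbT.
by case/IH=> i [ri Pi U]; exists i; rewrite inE ri orbT.
Qed.

Lemma vring_root x n : (0 < n)%N -> x ^+ n \in V -> x \in V.
Proof.
case: n => // n _ Vxn; have [//|Vx'] := vring_total x.
have [->|nzx] := eqVneq x 0; first exact: vring0.
have -> : x = x ^+ n.+1 * x^-1 ^+ n by rewrite exprS exprVn mulfK ?expf_neq0.
by apply: vringM => //; apply: vringX.
Qed.

Lemma vunit_root x n : (0 < n)%N -> vunit V (x ^+ n) -> vunit V x.
Proof.
move=> n_gt0 /and3P[]; rewrite expf_eq0 n_gt0 /= => nzx /(vring_root n_gt0) Vx.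
by rewrite -exprVn => /(vring_root n_gt0) Vx'; rewrite /vunit nzx Vx.
Qed.

Hypothesis p_prime : prime p.

Lemma prime_neq0 : p%:R != 0 :> F.
Proof.
by apply/eqP => p0; have [_ /negP nV _] := hV; apply: nV; rewrite p0 invr0 vring0.
Qed.

(** Bezout gives [u * n = v * p + 1]. If [p / n] lies in [V], this expresses [n^-1] inside [V]; if
    [n / p] does, it expresses [p^-1] inside [V], which is excluded. *)
Lemma vunit_nat n : ~~ (p %| n)%N -> vunit V n%:R.
Proof.
move=> ndiv; have [_ nVp _] := hV.
have n_gt0 : (0 < n)%N by case: n ndiv; rewrite ?dvdn0.
have [u v Duv _] := egcdnP p n_gt0.
have /eqP g1 : gcdn n p == 1%N.
  by rewrite gcdnC -/(coprime p n) prime_coprime.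
move: Duv; rewrite g1 => /(congr1 (fun k => k%:R : F)); rewrite natrD !natrM => Duv.
have nz_n : n%:R != 0 :> F.
  apply: contra nVp => /eqP n0; move: Duv; rewrite n0 mulr0 => /eqP.
  rewrite eq_sym addrC addr_eq0 => /eqP h.
  have -> : p%:R^-1 = - v%:R :> F.
    apply: (mulIf prime_neq0); rewrite mulVf ?prime_neq0 // mulNr.
    by apply/eqP; rewrite eq_sym -h.
  by rewrite vringN ?vring_nat.
rewrite /vunit nz_n vring_nat /=.
have [Vpn|Vnp] := vring_total (p%:R / n%:R).
  have -> : n%:R^-1 = u%:R - v%:R * (p%:R / n%:R) :> F.
    apply: (mulIf nz_n); rewrite mulVf // mulrBl mulrA mulfVK //.
    by rewrite Duv addrAC subrr add0r.
  by apply: vringB; [exact: vring_nat | apply: vringM => //; exact: vring_nat].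
case/negP: nVp; rewrite invf_div in Vnp.
have -> : p%:R^-1 = u%:R * (n%:R / p%:R) - v%:R :> F.
  apply: (mulIf prime_neq0); rewrite mulVf ?prime_neq0 // mulrBl mulrA mulfVK ?prime_neq0 //.
  by rewrite Duv addrAC subrr add0r.
by apply: vringB; [apply: vringM => // | ]; exact: vring_nat.
Qed.

Lemma vunit_int z : ~~ (p %| `|z|)%N -> vunit V z%:~R.
Proof.
move=> /vunit_nat; rewrite -{2}(mulz_sign_abs z) rmorphM rmorphXn rmorphN1 /=.
by case: (z < 0)%R; rewrite ?expr1 ?expr0 ?mul1r ?mulN1r // vunitN.
Qed.

Lemma vring_prime_exp (e : int) : p%:R ^ e \in V -> 0 <= e.
Proof.
case: e => // n; rewrite NegzE -exprnN -exprVn => /(vring_root (ltn0Sn n)) Vp.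
by case: hV => _ /negP.
Qed.

Lemma vunitMl x y : x \in V -> y \in V -> vunit V (x * y) -> vunit V x.
Proof.
move=> Vx Vy /and3P[]; rewrite mulf_eq0 negb_or => /andP[nzx nzy] _ Vxy.
rewrite /vunit nzx Vx; have -> : x^-1 = y * (x * y)^-1 by rewrite invfM mulrC mulfVK.
by rewrite vringM.
Qed.

(* Up to a unit, [mu x] is the element of absolute value [max 1 |x|]. *)
Definition mu x := if x \in V then 1 else x.

Lemma mu_neq0 x : mu x != 0.
Proof.
rewrite /mu; case: ifP => [_|/negP nVx]; first exact: oner_neq0.
by apply/eqP => x0; apply: nVx; rewrite x0 vring0.
Qed.

Lemma mu_inv x : (mu x)^-1 \in V.
Proof.
by rewrite /mu; case: ifPn => [_|/negPf nVx]; rewrite ?invr1 ?vring1 //;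
  case: (vring_total x); rewrite ?nVx.
Qed.

Lemma div_mu x : x / mu x \in V.
Proof.
rewrite /mu; case: ifPn => [Vx|nVx]; first by rewrite divr1.
by rewrite divff ?vring1 //; apply: contraNneq nVx => ->; exact: vring0.
Qed.

(** Gauss's lemma, one linear factor at a time. If [z] is integral, the factor is [X - z], and the
    coefficient just above the last unit coefficient of the old product is a unit. Otherwise the
    factor is [z^-1 X - 1] with [z^-1] a nonunit, and every unit coefficient remains one. *)
Lemma gauss_primitive (s : seq F) :
  let Q := \prod_(z <- s) ((mu z)^-1 *: ('X - z%:P)) in
  (forall i, Q`_i \in V) /\ exists i, vunit V Q`_i.
Proof.
elim: s => [|z s]; rewrite /=.
  rewrite big_nil; split=> [i|]; first by rewrite coef1; exact: vring_nat.
  by exists 0%N; rewrite coef1 vunit1.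
set Q := \prod_(_ <- _) _ => -[VQ UQ]; rewrite big_cons -/Q.
set L := _ *: _; set w := z / mu z.
have coefLQ i : (L * Q)`_i = (mu z)^-1 * (if i is j.+1 then Q`_j else 0) - w * Q`_i.
  rewrite /L -scalerAl coefZ mulrBl coefB coefXM coefCM /w.
  by case: i => [|j] /=; ring.
split=> [i|].
  rewrite coefLQ; apply: vringB; apply: vringM; rewrite ?mu_inv ?div_mu //.
  by case: i => [|i]; rewrite ?vring0.
have Vw := div_mu z; rewrite -/w in Vw.
have [Vz|nVz] := boolP (z \in V).
  have mu1 : mu z = 1 by rewrite /mu Vz.
  have exU : exists i, vunit V Q`_i by [].
  have bound i : vunit V Q`_i -> (i <= size Q)%N.
    by move=> U; rewrite leqNgt; apply/negP => /ltnW sz; case/and3P: U; rewrite nth_default ?eqxx.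
  case: (ex_maxnP exU bound) => i Ui max_i; exists i.+1.
  have VLQ : (L * Q)`_i.+1 \in V.
    by rewrite coefLQ; apply: vringB; apply: vringM; rewrite ?mu_inv.
  have : vunit V ((L * Q)`_i.+1 + w * Q`_i.+1) by rewrite coefLQ subrK mu1 invr1 mul1r.
  case/(vunit_sub VLQ (vringM Vw (VQ _))) => //.
  by rewrite mulrC => /(vunitMl (VQ _) Vw) /max_i; rewrite ltnn.
have muz : mu z = z by rewrite /mu (negPf nVz).
have w1 : w = 1 by rewrite /w -{1}muz divff ?mu_neq0.
case: UQ => i Ui; exists i.
have Ve : (if i is j.+1 then Q`_j else 0) \in V by case: (i) => [|j]; rewrite ?vring0.
have VLQ : - (L * Q)`_i \in V.
  by apply: vringN; rewrite coefLQ; apply: vringB; apply: vringM; rewrite ?mu_inv.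
have : vunit V (- (L * Q)`_i + (mu z)^-1 * (if i is j.+1 then Q`_j else 0)).
  by rewrite coefLQ w1 mul1r opprB subrK.
case/(vunit_sub VLQ (vringM (mu_inv z) Ve)); first by rewrite vunitN.
move/(vunitMl (mu_inv z) Ve); rewrite vunitV muz => /and3P[_ Vz _].
by rewrite Vz in nVz.
Qed.

Lemma prod_scale_XsubC (R : fieldType) (I : Type) (r : seq I) (c f : I -> R) :
  \prod_(i <- r) (c i *: ('X - (f i)%:P)) =
  (\prod_(i <- r) c i) *: \prod_(i <- r) ('X - (f i)%:P).
Proof.
elim: r => [|i r IH]; first by rewrite !big_nil scale1r.
by rewrite !big_cons IH -scalerAl -scalerAr scalerA.
Qed.

Lemma coef_prod_mu (s : seq F) i :
  (\prod_(z <- s) ('X - z%:P))`_i / \prod_(z <- s) mu z \in V.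
Proof.
have [/(_ i)] := gauss_primitive s; rewrite prod_scale_XsubC coefZ mulrC.
by rewrite -(big_morph _ (@invfM _) (invr1 _)).
Qed.

(** The local part of the height formula. The polynomial is [a * prod mu z] times a product with
    integral coefficients, one of them a unit; as some coefficient of [P] is prime to [p], the
    scalar can neither have positive valuation nor be nonintegral. *)
Lemma content_unit (P : {poly int}) (a : F) (s : seq F) :
  zcontents P = 1 -> map_poly intr P = a *: \prod_(z <- s) ('X - z%:P) ->
  vunit V (a * \prod_(z <- s) mu z).
Proof.
move=> cP DP; have [VQ [i Ui]] := gauss_primitive s.
set b := a * _.
have nzmu : \prod_(z <- s) mu z != 0.
  by rewrite prodf_seq_neq0; apply/allP => z _; rewrite mu_neq0.
have coefP j : (P`_j)%:~R = b * (\prod_(z <- s) ((mu z)^-1 *: ('X - z%:P)))`_j.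
  rewrite -[LHS]coef_map_id0 // DP prod_scale_XsubC !coefZ /b.
  rewrite -(big_morph _ (@invfM _) (invr1 _)) mulrA mulfK //.
set Q := \prod_(z <- s) _ in VQ Ui coefP.
have [j nd] : exists j, ~~ (p %| `|(P`_j)%R|)%N.
  apply: contrapT => /forallNP all_d.
  have : (p%:Z %| zcontents P)%Z.
    rewrite dvdz_contents; apply/polyOverP => j; move: (all_d j) => /negP.
    by rewrite negbK.
  by rewrite cP dvdz1 => /eqP p1; move: p_prime; rewrite -[p]/`|p%:Z|%N p1.
have Uj := vunit_int nd; rewrite coefP in Uj.
have Vb : b \in V.
  rewrite -[b](mulfK (vunit_neq0 Ui)) -coefP.
  by apply: vringM; [exact: vring_int | case/and3P: Ui].
exact: (vunitMl Vb (VQ j)).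
Qed.

(* The valuation of [x] is [a / D], where [p] has valuation [1]. *)
Definition pval D x (a : int) := vunit V (x ^+ D / p%:R ^ a).

Lemma prime_exp_neq0 (a : int) : p%:R ^ a != 0 :> F.
Proof. by rewrite expfz_neq0 ?prime_neq0. Qed.

Lemma pval1 D : pval D 1 0.
Proof. by rewrite /pval expr1n expr0z divr1 vunit1. Qed.

Lemma pvalM D x y a b : pval D x a -> pval D y b -> pval D (x * y) (a + b).
Proof.
rewrite /pval exprMn expfzDr ?prime_neq0 // => Ux Uy.
by rewrite invfM mulrACA vunitM.
Qed.

Lemma pval_prod D (B : nat) (s : seq F) (f : F -> F) :
  (forall z, z \in s -> exists2 a : int, (`|a| <= B)%N & pval D (f z) a) ->
  exists2 a : int, (`|a| <= size s * B)%N & pval D (\prod_(z <- s) f z) a.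
Proof.
elim: s => [_|z s IH hs]; first by exists 0; rewrite // big_nil pval1.
have [a ha pa] := hs z (mem_head _ _).
have [|b hb pb] := IH; first by move=> y sy; apply: hs; rewrite inE sy orbT.
exists (a + b); last by rewrite big_cons pvalM.
by rewrite /= mulSn; lia.
Qed.

Lemma pval_same D x y a : (0 < D)%N -> pval D x a -> pval D y a -> vunit V (x / y).
Proof.
move=> D_gt0 Ux Uy; apply: (vunit_root D_gt0); have := vunit_div Ux Uy.
by rewrite invf_div mulrA mulfVK ?prime_exp_neq0 // expr_div_n.
Qed.

Lemma pval_bound D x a e : x != 0 -> (p ^ e)%:R * x \in V -> (p ^ e)%:R / x \in V ->
  pval D x a -> (`|a| <= e * D)%N.
Proof.
move=> nzx Vx Vx' /and3P[_ U U'].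
have nz := prime_exp_neq0.
have ge1 : 0 <= (e * D)%N%:Z + a.
  apply: vring_prime_exp; rewrite expfzDr ?prime_neq0 //.
  have -> : p%:R ^ (e * D)%N * p%:R ^ a = ((p ^ e)%:R * x) ^+ D * (x ^+ D / p%:R ^ a)^-1.
    rewrite invf_div exprMn -natrX -expnM natrX -[p%:R ^ (e * D)%N]/(p%:R ^+ (e * D)).
    by rewrite [p%:R ^ a / _]mulrC -mulrA mulVKf ?expf_neq0.
  by rewrite vringM // vringX.
have ge2 : 0 <= (e * D)%N%:Z - a.
  apply: vring_prime_exp; rewrite expfzDr ?prime_neq0 // -invr_expz.
  have -> : p%:R ^ (e * D)%N / p%:R ^ a = ((p ^ e)%:R / x) ^+ D * (x ^+ D / p%:R ^ a).
    by rewrite expr_div_n -natrX -expnM natrX mulrA divfK ?expf_neq0.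
  by rewrite vringM // vringX.
lia.
Qed.

Lemma vring_divides (r : seq F) : has (fun x => x != 0) r ->
  exists x, [/\ x \in r, x != 0 & forall y, y \in r -> y / x \in V].
Proof.
elim: r => // y r IH /=.
have [/IH [x [rx nzx xV]] _|/hasPn r0] := boolP (has _ r); last first.
  rewrite orbF => nzy; exists y; rewrite mem_head; split=> // z; rewrite inE => /predU1P[->|/r0].
    by rewrite divff // vring1.
  by rewrite negbK => /eqP ->; rewrite mul0r vring0.
have [Vyx|] := vring_total (y / x).
  exists x; rewrite inE rx orbT; split=> // z; rewrite inE => /predU1P[->|]//; exact: xV.
rewrite invf_div => Vxy; have [y0|nzy] := eqVneq y 0.
  exists x; rewrite inE rx orbT; split=> // z; rewrite inE => /predU1P[->|]; last exact: xV.
  by rewrite y0 mul0r vring0.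
exists y; rewrite mem_head; split=> // z; rewrite inE => /predU1P[->|/xV Vzx].
  by rewrite divff // vring1.
have -> : z / y = (z / x) * (x / y) by rewrite mulrA divfK.
exact: vringM.
Qed.

(* In a vanishing sum two terms have the same minimal valuation. *)
Lemma vring_sum0_assoc n (t : 'I_n -> F) i0 : t i0 != 0 -> \sum_i t i = 0 ->
  exists i j : 'I_n, (j < i)%N /\ vunit V (t i / t j).
Proof.
move=> nz0 sum0.
have [|x [tx nzx divx]] := @vring_divides [seq t i | i : 'I_n].
  by apply/hasP; exists (t i0) => //; apply/fintype.imageP; exists i0.
have [i _ Dx] := fintype.imageP tx; rewrite {}Dx in tx nzx divx.
have : vunit V (\sum_(j | j != i) t j / t i).
  rewrite -mulr_suml; have -> : \sum_(j | j != i) t j = - t i.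
    by move: sum0; rewrite (bigD1 i) //= => /eqP; rewrite addrC addr_eq0 => /eqP.
  by rewrite mulNr divff // vunitN vunit1.
case/vunit_sum_ex=> [j _|j [_ ne_ji U]]; first by apply: divx; apply/fintype.imageP; exists j.
have [lt_ij|lt_ji|] := ltngtP i j; last by move/val_inj => E; rewrite E eqxx in ne_ji.
- by exists j, i.
- by exists i, j; rewrite -invf_div vunitV.
Qed.

Lemma int_prime_part (z : int) : z != 0 ->
  vunit V (z%:~R / p%:R ^+ logn p `|z|).
Proof.
move=> nzz; have z_gt0 : (0 < `|z|)%N by rewrite absz_gt0.
have [m co_pm Dz] := pfactor_coprime p_prime z_gt0.
have Um : vunit V m%:R by apply: vunit_nat; rewrite -prime_coprime.
have -> : z%:~R = (-1) ^+ (z < 0)%R * `|z|%N%:R :> F.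
  by rewrite {1}(intEsign z) rmorphM rmorphXn rmorphN1.
rewrite {1}Dz natrM natrX.
rewrite -mulrA mulfK ?expf_neq0 ?prime_neq0 //.
by case: (z < 0)%R; rewrite ?expr1 ?expr0 ?mul1r ?mulN1r // vunitN.
Qed.

(** Newton polygon argument: in [P(x) = 0] two terms, of degrees [i > j], have the same valuation.
    Hence [i - j] times the valuation of [x] is a difference of valuations of integers, and
    [i - j <= d] divides [d!]. This is why valuations are measured on [d!]-th powers. *)
Lemma pval_exists (P : {poly int}) x (d : nat) : P != 0 -> (size P <= d.+1)%N ->
  root (map_poly intr P) x -> x != 0 -> exists a, pval d`! x a.
Proof.
move=> nzP szP /eqP; rewrite horner_poly => sum0 nzx.
have nzint (z : int) : z != 0 -> z%:~R != 0 :> F.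
  by move/int_prime_part/vunit_neq0; rewrite mulf_eq0 negb_or => /andP[].
have szP_gt0 : (0 < size P)%N by rewrite size_poly_gt0.
have lt_last : ((size P).-1 < size P)%N by rewrite prednK.
have [|i [j [lt_ji U]]] := vring_sum0_assoc (i0 := Ordinal lt_last) _ sum0.
  by rewrite /= mulf_neq0 ?expf_neq0 // nzint // -/(lead_coef P) lead_coef_eq0.
have := vunit_neq0 U; rewrite mulf_eq0 invr_eq0 !mulf_eq0 !negb_or.
case/andP=> /andP[nzi _] /andP[nzj _].
have {}nzi : P`_i != 0 by apply: contraNneq nzi => ->.
have {}nzj : P`_j != 0 by apply: contraNneq nzj => ->.
have Ui := int_prime_part nzi; have Uj := int_prime_part nzj.
set vi := logn p _ in Ui; set vj := logn p _ in Uj.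
pose k := (i - j)%N.
have k_gt0 : (0 < k)%N by rewrite subn_gt0.
have le_kd : (k <= d)%N.
  by apply: leq_trans (leq_subr _ _) _; rewrite -ltnS (leq_trans (ltn_ord i)).
have {Ui Uj}U : vunit V (x ^+ k / p%:R ^ (vj%:Z - vi%:Z)).
  have -> : x ^+ k / p%:R ^ (vj%:Z - vi%:Z) =
     ((P`_i)%:~R * x ^+ i / ((P`_j)%:~R * x ^+ j)) *
     ((P`_j)%:~R / p%:R ^+ vj) / ((P`_i)%:~R / p%:R ^+ vi).
    have -> : x ^+ i = x ^+ k * x ^+ j by rewrite -exprD subnK // ltnW.
    rewrite expfzDr ?prime_neq0 // -invr_expz.
    rewrite -[p%:R ^ vi%:Z]/(p%:R ^+ vi) -[p%:R ^ vj%:Z]/(p%:R ^+ vj).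
    field.
    by rewrite !nzint ?expf_neq0 ?prime_neq0.
  by apply: vunit_div => //; apply: vunitM.
have /dvdnP[c Dc] : (k %| d`!)%N by rewrite dvdn_fact // k_gt0.
exists ((vj%:Z - vi%:Z) * c%:Z).
by rewrite /pval Dc mulnC exprM -exprz_exp -expr_div_n; apply: vunitX.
Qed.

Lemma vring_prime_part x n : (0 < n)%N -> n%:R * x \in V -> (p ^ logn p n)%:R * x \in V.
Proof.
move=> n_gt0; have [m co_pm Dn] := pfactor_coprime p_prime n_gt0.
have Um : vunit V m%:R by apply: vunit_nat; rewrite -prime_coprime.
rewrite {1}Dn natrM -mulrA => Vnx.
rewrite -[_ * x](mulKf (vunit_neq0 Um)); apply: vringM => //.
by case/and3P: Um.
Qed.

End ValuationRing.
(** A prime [p] dividing the denominator would put [p^-1] into [V], by Bezout for the numerator and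
    the denominator. For a rational number one valuation ring above each prime is therefore a
    sufficient test. *)
Lemma int_of_valuation_rings (F : fieldType) (q : rat) :
  (forall p, prime p -> exists V : {pred F},
     valuation_ring p V /\ (numq q)%:~R / (denq q)%:~R \in V) ->
  exists z : int, q = z%:~R.
Proof.
move=> hV; exists (numq q); rewrite -[LHS]divq_num_den.
suffices /eqP -> : denq q == 1 by rewrite divr1.
apply: contrapT => /negP den1.
have [p p_prime p_den] : exists2 p, prime p & (p %| `|denq q|)%N.
  exists (pdiv `|denq q|); last exact: pdiv_dvd.
  apply: pdiv_prime; have := denq_gt0 q; move: den1; lia.
have [V [hVp Vq]] := hV p p_prime.
have [_ /negP nVp _] := hVp; apply: nVp.
have nzd : (denq q)%:~R != 0 :> F.
  apply/eqP => d0.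
  have := int_prime_part hVp p_prime (denq_neq0 q).
  by move/vunit_neq0; rewrite d0 mul0r eqxx.
have /coprimezP[[u v] /= /(congr1 (fun z => z%:~R : F))] : coprimez (numq q) (denq q) by rewrite coprimezE coprime_num_den.
rewrite rmorphD !rmorphM /= => Duv.
have /dvdzP[c Dc] : (p%:Z %| denq q)%Z by [].
have nzp := prime_neq0 hVp.
have -> : p%:R^-1 = c%:~R * (u%:~R * ((numq q)%:~R / (denq q)%:~R) + v%:~R) :> F.
  apply: (mulIf nzd); rewrite -mulrA mulrDl -[_ * _ * (denq q)%:~R]mulrA divfK //.
  by rewrite Duv mulr1 Dc rmorphM /= mulrC mulfK.
apply: (vringM hVp) (vring_int hVp _) _.
by apply: (vringD hVp) (vring_int hVp _); apply: (vringM hVp) (vring_int hVp _) Vq.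
Qed.

(* Pigeonhole principle: if every element of [s] carries for each index [i] a code smaller
   than [B i], and the sublists on which all codes agree have at most [b] elements, then
   [s] has at most [prod_i B i * b] elements. *)
Lemma code_stage (T I : eqType) (r : seq I) (Rel : I -> T -> nat -> Prop)
    (B : I -> nat) (b : nat) (s : seq T) :
  (forall i x, i \in r -> x \in s -> exists2 v, (v < B i)%N & Rel i x v) ->
  (forall s', subseq s' s ->
     (forall i, i \in r -> exists v, forall x, x \in s' -> Rel i x v) ->
     (size s' <= b)%N) ->
  (size s <= \prod_(i <- r) B i * b)%N.
Proof.
elim: r s => [|i r IH] s hB hb.
  by rewrite big_nil mul1n hb.
rewrite big_cons.
have /choice[f hf] x : exists v, x \in s -> (v < B i)%N /\ Rel i x v.
  have [sx|_] := boolP (x \in s); last by exists 0%N.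
  by have [v] := hB i x (mem_head _ _) sx; exists v.
have -> : size s = (\sum_(v < B i) size [seq x <- s | f x == v])%N.
  have : all (fun x => f x < B i)%N s by apply/allP => x /hf[].
  elim: (s) => [|x s' IHs] /=; first by rewrite big1.
  case/andP=> fx /IHs Ds'; rewrite [RHS](bigD1 (Ordinal fx)) //= eqxx /=.
  rewrite Ds' (bigD1 (Ordinal fx)) //= addSn; congr (_ + _).+1.
  by apply: eq_bigr => v; rewrite eq_sym -val_eqE /= => /negPf ->.
rewrite -mulnA -[X in (_ <= X * _)%N](card_ord (B i)) -sum_nat_const.
apply: leq_sum => v _; apply: IH => [j x rj|s' sub hs'].
  by rewrite mem_filter => /andP[_ sx]; apply: hB => //; rewrite inE rj orbT.
apply: hb => [|j]; first exact: subseq_trans sub (filter_subseq _ _).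
rewrite inE => /predU1P[->|/hs'//]; exists v => x /(mem_subseq sub).
by rewrite mem_filter => /andP[/eqP <- /hf[]].
Qed.
Local Notation rpow x a := (Rpower x%R a%R).

(** * Divisor bound *)

Lemma RpowerD (x a b : RR) : rpow x (a + b) = rpow x a * rpow x b.
Proof. exact: Rpower_plus. Qed.

Lemma RpowerA (x a b : RR) : rpow (rpow x a) b = rpow x (a * b).
Proof. exact: Rpower_mult. Qed.

Lemma Rpower_nat (x : RR) n : 0 < x -> rpow x n%:R = x ^+ n.
Proof. by move=> /RltP x_gt0; rewrite -INRE Rpower_pow // RpowE. Qed.

Lemma RpowerMl (x y a : RR) : 0 < x -> 0 < y ->
  rpow (x * y) a = rpow x a * rpow y a.
Proof. by move=> /RltP x0 /RltP y0; rewrite -[LHS]Rpower_mult_distr. Qed.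

Lemma Rpower_gt0 (x a : RR) : 0 < rpow x a.
Proof. by apply/RltP; apply: exp_pos. Qed.

Lemma ler_Rpower (x a b : RR) : 1 <= x -> a <= b -> rpow x a <= rpow x b.
Proof. by move=> /RleP x1 /RleP ab; apply/RleP; apply: Rle_Rpower. Qed.

Lemma ler_Rpowerl (x y a : RR) : 0 <= a -> 0 < x -> x <= y -> rpow x a <= rpow y a.
Proof.
by move=> /RleP a0 /RltP x0 /RleP xy; apply/RleP; apply: Rle_Rpower_l.
Qed.

Lemma Rpower0 (x : RR) : rpow x 0 = 1.
Proof. by rewrite /Rpower Rmult_0_l exp_0. Qed.

Lemma Rpower1 (x : RR) : 0 < x -> rpow x 1 = x.
Proof. by move=> /RltP; exact: Rpower_1. Qed.

Lemma Rpower_base_gt1 (x a : RR) : 1 < x -> 0 < a -> 1 < rpow x a.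
Proof. by move=> /RltP x1 /RltP a0; apply/RltP; rewrite -(Rpower0 x); apply: Rpower_lt. Qed.

Lemma Rpower_prod (I : eqType) (r : seq I) (f : I -> nat) (a : RR) :
  (forall i, i \in r -> (0 < f i)%N) ->
  rpow (\prod_(i <- r) f i)%N%:R a = \prod_(i <- r) rpow (f i)%:R a.
Proof.
elim: r => [_|i r IH h]; first by rewrite !big_nil /Rpower ln_1 Rmult_0_r exp_0.
have hr j : j \in r -> (0 < f j)%N by move=> rj; apply: h; rewrite inE rj orbT.
rewrite !big_cons natrM RpowerMl ?IH // ltr0n ?h ?mem_head //.
by rewrite big_seq; elim/big_ind: _ => // x y x0 y0; rewrite muln_gt0 x0.
Qed.

Lemma polynomial_le_exponential (c b : nat) (eta : RR) : 0 < eta ->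
  exists2 K : RR, 1 <= K &
  forall e : nat, ((c * e + 1) ^ b)%N%:R <= K * rpow 2 (eta * e%:R).
Proof.
move=> eta_gt0.
(* Dividing by [b + 1] instead of [b] covers [b = 0]; the [b]-th power of [r^e] still stays below
   [2^(eta*e)]. The linear factor is compared with [r^e] by Bernoulli's inequality. *)
pose r := rpow 2 (eta / b.+1%:R).
have r_gt1 : 1 < r by apply: Rpower_base_gt1; rewrite ?ltr1n // divr_gt0 ?ltr0n.
have r_gt0 : 0 < r := lt_trans ltr01 r_gt1.
have bern (e : nat) : 1 + (r - 1) * e%:R <= r ^+ e.
  elim: e => [|e IH]; first by rewrite mulr0 addr0.
  rewrite exprSr; have : 0 <= (r - 1) * (r ^+ e - 1).
    by apply: mulr_ge0; rewrite subr_ge0; [exact: ltW | rewrite exprn_ege1 // ltW].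
  rewrite -natr1; nra.
pose L := c%:R / (r - 1) + 1.
have L1 : 1 <= L by rewrite lerDr divr_ge0 // subr_ge0 ltW.
have le_L (e : nat) : (c * e + 1)%N%:R <= L * r ^+ e.
  rewrite natrD natrM /L mulrDl mul1r; apply: lerD; last by rewrite exprn_ege1 // ltW.
  have rd : 0 < r - 1 by rewrite subr_gt0.
  rewrite mulrAC ler_pdivlMr // -mulrA ler_wpM2l // mulrC.
  by apply: le_trans (bern e); rewrite lerDr.
exists (L ^+ b) => [|e]; first by rewrite exprn_ege1.
rewrite natrX; apply: le_trans (_ : (L * r ^+ e) ^+ b <= _).
  by rewrite lerXn2r ?nnegrE // mulr_ge0 ?exprn_ge0 ?ltW // (lt_le_trans ltr01).
rewrite exprMn ler_wpM2l ?exprn_ge0 // ?(le_trans ler01) //.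
rewrite -exprM -Rpower_nat // /r RpowerA ler_Rpower ?ler1n //.
rewrite -mulrA ler_pM2l // natrM mulrCA ler_piMr //.
by rewrite mulrC ler_pdivrMr ?ltr0n // mul1r ler_nat.
Qed.

(** As for the divisor function: [c*e + 1 <= (c+1)^e], so once [p^eta >= (c+1)^b] the factor of [p]
    is at most [p^(e*eta)]. The primes below the threshold [P0] are at most [P0] in number, and each
    costs a constant [K1]. *)
Lemma divisor_bound (c b : nat) (eta : RR) : 0 < eta ->
  exists2 K : RR, 1 <= K & forall n : nat, (0 < n)%N ->
  (\prod_(p <- primes n) (c * logn p n + 1) ^ b)%N%:R <= K * Rpower n%:R eta.
Proof.
move=> eta_gt0.
have [K1 K1_ge1 hK1] := polynomial_le_exponential c b eta_gt0.
pose P0 := (Num.truncn (rpow ((c.+1 ^ b)%N%:R) eta^-1)).+1.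
have K1_gt0 : 0 < K1 := lt_le_trans ltr01 K1_ge1.
exists (K1 ^+ P0) => [|n n_gt0]; first by rewrite exprn_ege1.
pose g (p : nat) := if (p < P0)%N then K1 else 1.
have step p e : prime p -> ((c * e + 1) ^ b)%N%:R <= g p * rpow (p ^ e)%N%:R eta.
  move=> p_pr; have p_gt0 : 0 < p%:R :> RR by rewrite ltr0n prime_gt0.
  rewrite [(p ^ e)%N%:R]natrX -[_ ^+ e]Rpower_nat // RpowerA.
  rewrite /g; case: ifPn => [_|].
    apply: le_trans (hK1 e) _; rewrite ler_pM2l // [e%:R * _]mulrC.
    apply: ler_Rpowerl; rewrite ?mulr_ge0 ?ltr0n ?(ltW eta_gt0) // ler_nat.
    exact: prime_gt1.
  rewrite -leqNgt => le_P0; rewrite mul1r [_ * eta]mulrC.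
  have pe : (c.+1 ^ b)%N%:R <= rpow p%:R eta.
    have c_gt0 : 0 < (c.+1 ^ b)%N%:R :> RR by rewrite ltr0n expn_gt0.
    have DN : (c.+1 ^ b)%N%:R = rpow (rpow (c.+1 ^ b)%N%:R eta^-1) eta.
      by rewrite RpowerA mulVf ?Rpower1 // lt0r_neq0.
    rewrite DN.
    apply: ler_Rpowerl; rewrite ?Rpower_gt0 ?(ltW eta_gt0) //.
    by apply: ltW; apply: lt_le_trans (truncnS_gt _) _; rewrite ler_nat.
  apply: le_trans (_ : ((c.+1 ^ b) ^ e)%N%:R <= _).
    rewrite ler_nat -expnM [(b * e)%N]mulnC expnM.
    have [->|b_gt0] := posnP b; first by rewrite !expn0.
    rewrite leq_exp2r //.
    elim: (e) => [|e' IH]; first by rewrite muln0 expn0.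
    rewrite expnS mulnS.
    have : (0 < c.+1 ^ e')%N by rewrite expn_gt0.
    by move: (c.+1 ^ e')%N IH => X; nia.
  rewrite natrX -RpowerA Rpower_nat ?Rpower_gt0 //.
  by rewrite lerXn2r ?nnegrE // ?ler0n // ltW ?Rpower_gt0.
rewrite natr_prod (le_trans (_ : _ <= \prod_(p <- primes n) (g p * rpow (p ^ logn p n)%N%:R eta))) //.
  rewrite big_seq [X in _ <= X]big_seq; apply: ler_prod => p.
  by rewrite mem_primes => /and3P[p_pr _ _]; rewrite ler0n step.
rewrite big_split /= -Rpower_prod; last first.
  by move=> p; rewrite mem_primes => /and3P[p_pr _ _]; rewrite expn_gt0 prime_gt0.
have Dn : (\prod_(p <- primes n) p ^ logn p n)%N = n.
  by rewrite [RHS]prod_prime_decomp // prime_decompE big_map.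
rewrite Dn ler_pM2r ?Rpower_gt0 //.
have : (count (fun p => p < P0) (primes n) <= P0)%N.
  rewrite -size_filter -[X in (_ <= X)%N](size_iota 0); apply: uniq_leq_size.
    by rewrite filter_uniq ?primes_uniq.
  by move=> p; rewrite mem_filter mem_iota => /andP[].
move/(ler_weXn2l K1_ge1); apply: le_trans.
elim: (primes n) => [|p r IH]; first by rewrite big_nil.
rewrite big_cons /= /g exprD; case: ifP => _; rewrite ?mul1r ?expr1 //.
by rewrite ler_pM2l.
Qed.
(** * Orbits in a Galois extension embedded in the complex numbers *)

Lemma absCE (z : CC) : `|z| = ((absC z)%:C)%C.
Proof. by rewrite /absC normc_def. Qed.

Lemma absCM (x y : CC) : absC (x * y) = absC x * absC y.
Proof. by apply: (fmorph_inj (real_complex RR)); rewrite rmorphM /= -!absCE normrM. Qed.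

Lemma absC_ge0 (x : CC) : 0 <= absC x.
Proof. by have := normr_ge0 x; rewrite absCE (lecR 0). Qed.

Lemma absC1 : absC 1 = 1.
Proof. by rewrite /absC normr1. Qed.

Lemma absC_eq0 (x : CC) : (absC x == 0) = (x == 0).
Proof. by rewrite -[RHS]normr_eq0 absCE -[in RHS](rmorph0 (real_complex RR)) (inj_eq (fmorph_inj (real_complex RR))). Qed.

Lemma absCD (x y : CC) : absC (x + y) <= absC x + absC y.
Proof. by have := ler_normD x y; rewrite !absCE -rmorphD lecR. Qed.

Lemma absCN (x : CC) : absC (- x) = absC x.
Proof. by rewrite /absC normrN. Qed.

Lemma absC_real (x : RR) : absC (x%:C)%C = `|x|.
Proof. by rewrite /absC normc_def /= expr0n /= addr0 sqrtr_sqr. Qed.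

Lemma absC_int (z : int) : absC z%:~R = `|z%:~R|.
Proof. by rewrite -absC_real rmorph_int. Qed.

Lemma absC_conj (z : CC) : absC (z^*)%C = absC z.
Proof. by case: z => a b; rewrite /absC !normc_def /= sqrrN. Qed.

Lemma absC_le_ReIm (z : CC) : absC z <= `|complex.Re z| + `|complex.Im z|.
Proof.
case: z => a b; rewrite [X in absC X]complexE /=.
apply: le_trans (absCD _ _) _; rewrite absCM !absC_real.
have -> : absC 'i%C = 1 by rewrite /absC normc_def /= expr0n /= add0r expr1n sqrtr1.
by rewrite mul1r.
Qed.

Lemma absC_Re (z : CC) : `|complex.Re z| <= absC z.
Proof.
case: z => a b; rewrite /absC normc_def /= -sqrtr_sqr.
by apply: ler_wsqrtr; rewrite lerDl sqr_ge0.
Qed.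

Lemma absC_Im (z : CC) : `|complex.Im z| <= absC z.
Proof.
case: z => a b; rewrite /absC normc_def /= -sqrtr_sqr.
by apply: ler_wsqrtr; rewrite lerDr sqr_ge0.
Qed.

Section GaloisContext.

Variables (E : fieldType) (gT : finGroupType) (act : gT -> {rmorphism E -> E}).
Variables (iota : {rmorphism E -> CC}).
Hypothesis act1 : forall x, act 1%g x = x.
Hypothesis actM : forall g h x, act (g * h)%g x = act h (act g x).
Hypothesis fixed_rat : forall x, (forall g, act g x = x) ->
  exists q : rat, x = (numq q)%:~R / (denq q)%:~R.

Definition nrm x := absC (iota x).

Lemma nrmM x y : nrm (x * y) = nrm x * nrm y.
Proof. by rewrite /nrm rmorphM absCM. Qed.

Lemma nrm_ge0 x : 0 <= nrm x. Proof. exact: absC_ge0. Qed.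

Lemma nrm1 : nrm 1 = 1. Proof. by rewrite /nrm rmorph1 absC1. Qed.

Lemma nrm_eq0 x : (nrm x == 0) = (x == 0).
Proof. by rewrite /nrm absC_eq0 fmorph_eq0. Qed.

Lemma nrm_gt0 x : (0 < nrm x) = (x != 0).
Proof. by rewrite lt_neqAle nrm_ge0 andbT eq_sym nrm_eq0. Qed.

Lemma nrmD x y : nrm (x + y) <= nrm x + nrm y.
Proof. by rewrite /nrm rmorphD absCD. Qed.

Lemma nrmN x : nrm (- x) = nrm x.
Proof. by rewrite /nrm rmorphN absCN. Qed.

Lemma nrm_int (z : int) : nrm z%:~R = `|z%:~R|.
Proof. by rewrite /nrm rmorph_int absC_int. Qed.

Lemma nrm_prod I (r : seq I) (P : pred I) f :
  nrm (\prod_(i <- r | P i) f i) = \prod_(i <- r | P i) nrm (f i).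
Proof. by apply: (big_morph nrm nrmM nrm1). Qed.

Lemma nrmV x : nrm x^-1 = (nrm x)^-1.
Proof.
have [->|nzx] := eqVneq x 0.
  by rewrite invr0; have /eqP -> : nrm 0 == 0; rewrite ?nrm_eq0 // invr0.
have nx : nrm x != 0 by rewrite nrm_eq0.
by apply: (mulfI nx); rewrite -nrmM !divff ?nrm1.
Qed.

Lemma nrm_sign (b : bool) : nrm ((-1) ^+ b) = 1.
Proof. by case: (b); rewrite ?expr1 ?expr0 ?nrmN nrm1. Qed.

Lemma actK g : cancel (act g) (act g^-1%g).
Proof. by move=> x; rewrite -actM mulgV act1. Qed.

Lemma actKV g : cancel (act g^-1%g) (act g).
Proof. by move=> x; rewrite -actM mulVg act1. Qed.

Variables (V : nat -> {pred E}).
Hypothesis hV : forall p, prime p -> valuation_ring p (V p).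

Lemma fixed_int x : (forall g, act g x = x) -> (forall p, prime p -> x \in V p) ->
  exists z : int, x = z%:~R.
Proof.
move=> /fixed_rat[q Dx] Vx; have [|z Dz] := @int_of_valuation_rings E q.
  by move=> p p_pr; exists (V p); rewrite -Dx; split; [exact: hV | exact: Vx].
by exists z; rewrite Dx Dz; rewrite numq_int denq_int divr1.
Qed.

(** The rigidity behind both uniqueness arguments below: such an element is a rational integer of
    absolute value less than 1. *)
Lemma fixed_small_eq0 x : (forall g, act g x = x) -> (forall p, prime p -> x \in V p) ->
  nrm x < 1 -> x = 0.
Proof.
move=> fx Vx; have [z ->] := fixed_int fx Vx.
rewrite nrm_int -intr_norm ltrz1 => z0.
have -> // : z = 0; by lia.
Qed.

Definition cosets (S : {group gT}) := rcosets S [set: gT].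

Lemma act_repr (S : {group gT}) x g : (forall s, s \in S -> act s x = x) ->
  act (repr (S :* g)%g) x = act g x.
Proof.
by move=> fx; have [s Ss] := repr_rcosetP S g; rewrite actM fx.
Qed.

Lemma cosets_mul (S : {group gT}) A g : A \in cosets S -> (A :* g)%g \in cosets S.
Proof. by case/rcosetsP=> h _ ->; rewrite -rcosetM; apply/rcosetsP; exists (h * g)%g. Qed.

Lemma repr_cosets_mul (S : {group gT}) A x g : (forall s, s \in S -> act s x = x) ->
  A \in cosets S -> act (repr (A :* g)%g) x = act g (act (repr A) x).
Proof.
by move=> fx /rcosetsP[h _ ->]; rewrite -rcosetM !act_repr // actM.
Qed.

(* Only meaningful when [S] fixes [x]: the norm to the rationals from the fixed field of [S]. *)
Definition coset_norm (S : {group gT}) (x : E) := \prod_(A in cosets S) act (repr A) x.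

Lemma big_cosets_mul (R : Type) (idx : R) (op : Monoid.com_law idx) (S : {group gT})
    (f : {set gT} -> R) g :
  \big[op/idx]_(A in cosets S) f (A :* g)%g = \big[op/idx]_(A in cosets S) f A.
Proof.
have mulgK : cancel (fun A : {set gT} => A :* g)%g (fun A => A :* g^-1)%g.
  by move=> A; rewrite -rcosetM mulgV rcoset1.
rewrite [RHS](reindex_inj (can_inj mulgK)) /=; apply: eq_bigl => A.
apply/idP/idP => [/cosets_mul -> // | /(cosets_mul g^-1%g)].
by rewrite mulgK.
Qed.

Lemma coset_norm_fixed (S : {group gT}) x : (forall s, s \in S -> act s x = x) ->
  forall g, act g (coset_norm S x) = coset_norm S x.
Proof.
move=> fx g; rewrite /coset_norm rmorph_prod /= -[RHS](@big_cosets_mul _ _ _ S _ g).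
by apply: eq_bigr => A cA; rewrite (repr_cosets_mul g fx cA).
Qed.

Definition orbit_seq (A : {set gT}) (x : E) := undup [seq act g x | g <- enum A].

Lemma orbit_seq_uniq (A : {set gT}) x : uniq (orbit_seq A x). Proof. exact: undup_uniq. Qed.

Lemma orbit_seqP (A : {set gT}) x y : reflect (exists2 g, g \in A & y = act g x) (y \in orbit_seq A x).
Proof.
rewrite mem_undup; apply: (iffP mapP) => -[g Ag ->]; exists g => //.
  by rewrite mem_enum in Ag.
by rewrite mem_enum.
Qed.

Lemma mem_orbit_seq (A : {set gT}) x g : g \in A -> act g x \in orbit_seq A x.
Proof. by move=> Ag; apply/orbit_seqP; exists g. Qed.

Lemma orbit_seq_refl (A : {group gT}) x : x \in orbit_seq A x.
Proof. by apply/orbit_seqP; exists 1%g; rewrite ?group1 ?act1. Qed.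

Lemma map_act_perm g s : (forall x, x \in s -> act g x \in s) -> uniq s ->
  perm_eq (map (act g) s) s.
Proof.
move=> sub Us; have Ugs : uniq (map (act g) s) by rewrite map_inj_uniq //; apply: fmorph_inj.
have sub' : {subset map (act g) s <= s} by move=> _ /mapP[x sx ->]; apply: sub.
have [] := uniq_min_size Ugs sub'; first by rewrite size_map.
by move=> _ Es; apply: uniq_perm.
Qed.

Notation Gorb x := (orbit_seq [set: gT] x).

Lemma Gorb_act x y g : y \in Gorb x -> act g y \in Gorb x.
Proof.
by case/orbit_seqP=> h _ ->; rewrite -actM mem_orbit_seq ?inE.
Qed.

Lemma Gorb_perm x g : perm_eq (map (act g) (Gorb x)) (Gorb x).
Proof. by apply: map_act_perm (orbit_seq_uniq _ _) => y; apply: Gorb_act. Qed.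

Lemma Gorb_trans x y z : y \in Gorb x -> z \in Gorb x -> exists g, z = act g y.
Proof.
case/orbit_seqP=> g _ -> /orbit_seqP[h _ ->].
by exists (g^-1 * h)%g; rewrite actM actK.
Qed.

Variables (N : {group gT}) (gamma : E).
Hypothesis normN : (N <| [set: gT])%g.
Hypothesis fix_gamma : forall g, g \in N -> act g gamma = gamma.

Notation Norb x := (orbit_seq N x).

Lemma mem_conjN g h : (g \in N) = ((h * g * h^-1)%g \in N).
Proof.
have Nh : (h^-1)%g \in 'N(N)%g by have := normal_norm normN; move/fintype.subsetP; apply; rewrite inE.
by rewrite -(memJ_norm g Nh) conjgE invgK mulgA.
Qed.

Lemma Norb_act x g z : z \in Norb x -> act g z \in Norb (act g x).
Proof.
case/orbit_seqP=> h Nh ->; apply/orbit_seqP.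
exists (g^-1 * h * g)%g; last by rewrite !actM actK.
by rewrite -{2}[g]invgK -mem_conjN.
Qed.

Definition stab_set x := [set g | act g x == x].

Lemma stab_group_set x : group_set (stab_set x).
Proof.
apply/group_setP; split=> [|g h]; first by rewrite inE act1.
by rewrite !inE => /eqP gx /eqP hx; rewrite actM gx hx.
Qed.

Canonical stab x := Group (stab_group_set x).

(* The stabilizer of the block [N x] of conjugates of [x]. *)
Definition blockgroup x := (N <*> stab x)%G.

Lemma blockgroupP x g : (g \in blockgroup x) = (act g x \in Norb x).
Proof.
rewrite /= norm_joinEr; last first.
  by apply: fintype.subset_trans (normal_norm normN); exact: finset.subsetT.
apply/mulsgP/orbit_seqP => [[h k Nh]|[h Nh Dg]].
  rewrite inE => /eqP kx ->.
  exists (k^-1 * h * k)%g; first by rewrite -{2}[k]invgK -mem_conjN.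
  by rewrite !actM -{2}kx actK.
have stab_k : (g * h^-1)%g \in stab x by rewrite inE actM Dg actK.
exists ((g * h^-1) * h * (g * h^-1)^-1)%g (g * h^-1)%g => //; first by rewrite -mem_conjN.
by rewrite !mulgKV.
Qed.
Lemma rcoset_reprK (H : {group gT}) g : (H :* repr (H :* g) = H :* g)%g.
Proof. by have [s Hs] := repr_rcosetP H g; rewrite rcosetM rcoset_id. Qed.

Lemma Norb_sub x y : y \in Norb x -> {subset Norb y <= Norb x}.
Proof.
case/orbit_seqP=> h Nh -> z /orbit_seqP[g Ng ->].
by rewrite -actM mem_orbit_seq ?groupM.
Qed.

Lemma Norb_block x g : g \in blockgroup x -> perm_eq (map (act g) (Norb x)) (Norb x).
Proof.
rewrite blockgroupP => gx; apply: map_act_perm (orbit_seq_uniq _ _) => y Oy.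
exact: (Norb_sub gx) (Norb_act g Oy).
Qed.

Notation S x := (blockgroup x).

(** The translates of the [N]-orbit of [x] are blocks, and two automorphisms give the same block
    exactly when they lie in the same coset of the block group. The number of cosets is thus
    [d / l], whatever the degree of [K]. *)
Lemma Gorb_decomp x :
  perm_eq (Gorb x) [seq act (repr A) z | A <- enum (cosets (S x)), z <- Norb x].
Proof.
apply: uniq_perm; first exact: orbit_seq_uniq.
  apply: allpairs_uniq; [exact: enum_uniq | exact: orbit_seq_uniq |].
  move=> _ _ /allpairsP[[A z] /= [cA Oz ->]] /allpairsP[[B y] /= [cB Oy ->]] /=.
  move: cA cB; rewrite !mem_enum => cA cB Eact.
  suff EAB : A = B by move: Eact; rewrite EAB => /fmorph_inj ->.
  have [[g _ DA] [h _ DB]] := (rcosetsP cA, rcosetsP cB).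
  have [[n Nn Dz] [m Nm Dy]] := (orbit_seqP _ _ _ Oz, orbit_seqP _ _ _ Oy).
  have Su : (repr A * (repr B)^-1)%g \in S x.
    have Sn : n \in S x by rewrite /= (fintype.subsetP (joing_subl _ _)).
    by rewrite -(groupMl _ Sn) blockgroupP !actM -Dz Eact actK.
  rewrite DA DB in Su *; rewrite -[LHS]rcoset_reprK -[RHS]rcoset_reprK.
  by apply/rcoset_eqP; rewrite mem_rcoset.
move=> y; apply/orbit_seqP/allpairsP => [[g _ ->]|[[A z] /= [_ /orbit_seqP[h Nh ->] ->]]].
  exists ((S x :* g)%g, act (repr (S x :* g)%g)^-1%g (act g x)).
  rewrite mem_enum /= actKV; split=> //; first by apply/rcosetsP; exists g.
  have [s Ss] := repr_rcosetP (S x) g.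
  by rewrite invMg actM actK -blockgroupP groupV.
by exists (h * repr A)%g; rewrite ?inE ?actM.
Qed.

Lemma big_Gorb (R : Type) (idx : R) (op : Monoid.com_law idx) x (f : E -> R) :
  \big[op/idx]_(z <- Gorb x) f z =
  \big[op/idx]_(A in cosets (S x)) \big[op/idx]_(z <- Norb x) f (act (repr A) z).
Proof. by rewrite (perm_big _ (Gorb_decomp x)) big_allpairs_dep big_enum. Qed.

Lemma size_Gorb x : size (Gorb x) = (#|cosets (S x)| * size (Norb x))%N.
Proof. by rewrite (perm_size (Gorb_decomp x)) size_allpairs -cardE. Qed.

Definition orbpoly x := \prod_(z <- Norb x) ('X - z%:P).

Lemma act_coef_orbpoly x g i :
  act g (orbpoly x)`_i = (\prod_(z <- [seq act g z | z <- Norb x]) ('X - z%:P))`_i.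
Proof.
rewrite -coef_map rmorph_prod big_map; congr (_ : {poly _})`_i.
by apply: eq_bigr => z _; rewrite rmorphB /= map_polyX map_polyC.
Qed.

Lemma orbpoly_fixed x i g : g \in S x -> act g (orbpoly x)`_i = (orbpoly x)`_i.
Proof. by move=> Sg; rewrite act_coef_orbpoly (perm_big _ (Norb_block Sg)). Qed.

Lemma orbpoly0 x g : act g (orbpoly x)`_0 =
  (-1) ^+ size (Norb x) * \prod_(z <- Norb x) act g z.
Proof.
rewrite act_coef_orbpoly big_map -horner_coef0 horner_prod.
elim: (Norb x) => [|z r IH]; first by rewrite !big_nil expr0 mulr1.
by rewrite !big_cons IH !hornerE /= exprS; ring.
Qed.

Definition mahler (r : seq E) := \prod_(z <- r) Num.max 1 (nrm z).

Lemma mahler_ge1 r : 1 <= mahler r.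
Proof.
rewrite /mahler; elim/big_ind: _ => // [x y x1 y1|z _]; last by rewrite le_max lexx.
by rewrite mulr_ege1.
Qed.

(** A factor [X - z] enlarges the coefficients at most by [1 + |z| <= 2 * max 1 |z|]. *)
Lemma coef_mahler_bound (r : seq E) i :
  nrm (\prod_(z <- r) ('X - z%:P))`_i <= 2 ^+ size r * mahler r.
Proof.
elim: r i => [|z r IH] i.
  rewrite /mahler !big_nil coef1 mulr1; case: (i == _); first by rewrite nrm1.
  by have /eqP -> : nrm 0 == 0; rewrite ?nrm_eq0.
rewrite big_cons /mahler big_cons -/(mahler r) mulrBl coefB coefXM coefCM /=.
set p := \prod_(_ <- _) _ in IH *.
apply: le_trans (nrmD _ _) _; rewrite nrmN nrmM exprS.
set M := 2 ^+ size r * mahler r in IH.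
have M0 : 0 <= M by rewrite mulr_ge0 ?exprn_ge0 // (le_trans ler01) ?mahler_ge1.
have -> : 2 * 2 ^+ size r * (Num.max 1 (nrm z) * mahler r) =
  Num.max 1 (nrm z) * M + Num.max 1 (nrm z) * M by rewrite /M; ring.
apply: lerD; last by rewrite ler_pM ?nrm_ge0 // le_max lexx orbT.
case: i => [|i] /=.
  by have /eqP -> : nrm 0 == 0; rewrite ?nrm_eq0 // mulr_ge0 // le_max ler01.
by rewrite (le_trans (IH i)) // ler_peMl // le_max lexx.
Qed.

Lemma prod_lt1_seq (T : eqType) (w : T -> RR) (r : seq T) z :
  (forall y, y \in r -> 0 <= w y <= 1) -> z \in r -> w z < 1 ->
  \prod_(y <- r) w y < 1.
Proof.
move=> hr rz wz; rewrite (big_rem z) //=; apply: le_lt_trans wz.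
have /andP[w0 _] := hr z rz; rewrite ler_piMr //.
suff /andP[] : 0 <= \prod_(y <- rem z r) w y <= 1 by [].
rewrite big_seq; apply: (big_ind (fun v => 0 <= v <= 1)) => [|b c /andP[b0 b1] /andP[c0 c1]|y /mem_rem/hr//].
  by rewrite ler01 lexx.
by rewrite mulr_ge0 // mulr_ile1.
Qed.

(** The elements of [J] with weight at least 1 occur on both sides and cancel. What remains is a
    product of weights below 1 on the left and of weights at least 1 on the right, so the left one
    must be empty. *)
Lemma prod_ge1_maximal (T : eqType) (w : T -> RR) (s J : seq T) :
  uniq s -> uniq J -> {subset J <= s} -> (forall z, 0 <= w z) ->
  \prod_(z <- J) w z = \prod_(z <- s | 1 <= w z) w z ->
  forall z, z \in J -> 1 <= w z.
Proof.
move=> Us UJ sJ w0.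
have permJ : perm_eq J [seq z <- s | z \in J].
  apply: uniq_perm; rewrite ?filter_uniq // => z; rewrite mem_filter.
  by case Jz: (z \in J); rewrite // sJ.
rewrite (bigID (fun z => 1 <= w z)) /= [in RHS](bigID (mem J)) /=.
rewrite [X in X * _](perm_big _ permJ) /= big_filter_cond.
rewrite [X in _ = X * _](eq_bigl (fun z => (z \in J) && (1 <= w z))); last first.
  by move=> z; rewrite andbC.
set X := \prod_(i <- s | _) _; set Z := \prod_(i <- s | _) _.
have ge1 (P : pred T) : (forall z, P z -> 1 <= w z) -> 1 <= \prod_(z <- s | P z) w z.
  move=> hP; elim/big_ind: _ => // x y x1 y1; exact: mulr_ege1.
have X1 : 1 <= X by apply: ge1 => z /andP[].
have Z1 : 1 <= Z by apply: ge1 => z /andP[].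
move/mulfI => /(_ (lt0r_neq0 (lt_le_trans ltr01 X1))) DZ z Jz.
rewrite leNgt; apply/negP => wz; move: Z1; rewrite -DZ -big_filter leNgt => /negP; apply.
apply: (prod_lt1_seq (z := z)) => // [y|]; rewrite mem_filter -ltNge.
  by case/andP=> /ltW -> _; rewrite w0.
by rewrite wz.
Qed.

(* [x] lies in [A(k,d,H)], where [gamma = H^d]; the height condition is replaced by the
   formula for [gamma]. *)
Definition good (d k : nat) (x : E) (a : int) :=
  [/\ exists2 P : {poly int}, zcontents P = 1 &
        map_poly intr P = a%:~R *: \prod_(z <- Gorb x) ('X - z%:P),
      0 < a, size (Gorb x) = d,
      count (fun z => nrm z < 1) (Gorb x) = k &
      exists b : bool, gamma = (-1) ^+ b * a%:~R * \prod_(z <- Gorb x | 1 <= nrm z) z].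

(** * Position of the conjugates relative to the unit circle, and integrality of their products *)

Section Good.

Variables (d k : nat) (x : E) (a : int).
Hypotheses (gx : good d k x a) (k_gt0 : (0 < k)%N) (k_lt_d : (k < d)%N).

Lemma lead_neq0 : a%:~R != 0 :> E.
Proof.
have [_ a_gt0 _ _ _] := gx; rewrite -(fmorph_eq0 iota) rmorph_int intr_eq0.
by rewrite gt_eqF.
Qed.

(* An automorphism fixing [gamma] maps the product of the conjugates of modulus at least
   [1] to itself, and no other equally large set of conjugates has such a large product. *)
Lemma ge1_act g z : g \in N -> z \in Gorb x -> 1 <= nrm z -> 1 <= nrm (act g z).
Proof.
move=> Ng Oz z1; have [_ _ _ _ [b Dgamma]] := gx.
pose I := [seq z <- Gorb x | 1 <= nrm z].
have nz : (-1) ^+ b * a%:~R != 0 :> E by rewrite mulf_neq0 ?signr_eq0 ?lead_neq0.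
have eqP : \prod_(y <- map (act g) I) nrm y = \prod_(y <- Gorb x | 1 <= nrm y) nrm y.
  rewrite -!nrm_prod; congr (nrm _); apply: (mulfI nz).
  rewrite -Dgamma -[RHS](fix_gamma Ng) Dgamma !rmorphM /= rmorph_prod /= rmorph_int.
  by rewrite rmorphXn rmorphN1 big_map big_filter.
apply: (prod_ge1_maximal (orbit_seq_uniq [set: gT] x) _ _ nrm_ge0 eqP).
- by rewrite map_inj_uniq ?filter_uniq ?orbit_seq_uniq //; apply: fmorph_inj.
- move=> _ /mapP[y Iy ->]; apply: Gorb_act.
  by move: Iy; rewrite mem_filter => /andP[].
- by apply: map_f; rewrite mem_filter z1.
Qed.

Lemma ge1_actE g z : g \in N -> z \in Gorb x -> (1 <= nrm (act g z)) = (1 <= nrm z).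
Proof.
move=> Ng Oz; apply/idP/idP; last exact: ge1_act.
rewrite -{2}(actK g z); apply: ge1_act; rewrite ?groupV //; exact: Gorb_act.
Qed.

Lemma ge1_Norb A z : z \in Norb x -> (1 <= nrm (act A z)) = (1 <= nrm (act A x)).
Proof.
move=> /(Norb_act A) /orbit_seqP[h Nh ->]; apply: ge1_actE => //.
by apply: Gorb_act; exact: orbit_seq_refl.
Qed.

Lemma Norb_dvd_d : (size (Norb x) %| d)%N.
Proof. by have [_ _ <- _ _] := gx; rewrite size_Gorb dvdn_mull. Qed.

Lemma Norb_dvd_k : (size (Norb x) %| k)%N.
Proof.
have [_ _ _ <- _] := gx; rewrite -sum1_count big_mkcond big_Gorb /=.
apply: dvdn_sum => A _.
rewrite (eq_big_seq (fun=> if (nrm (act (repr A) x) < 1)%R then 1%N else 0%N)); last first.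
  by move=> z Oz; rewrite /= !ltNge ge1_Norb.
by rewrite big_const_seq count_predT iter_addn_0 dvdn_mull.
Qed.

Lemma Gorb_neq0 z : z \in Gorb x -> z != 0.
Proof.
have [_ _ sz _ _] := gx.
move=> Oz; apply/eqP => z0; have x0 : x = 0.
  have [g ->] := Gorb_trans Oz (orbit_seq_refl [set: gT]%G x).
  by rewrite z0 rmorph0.
have : (size (Gorb x) <= size [:: (0 : E)%R])%N.
  apply: uniq_leq_size (orbit_seq_uniq _ _) _ => y /orbit_seqP[g _ ->].
  by rewrite x0 rmorph0 inE.
by rewrite sz leqNgt (leq_ltn_trans k_gt0 k_lt_d).
Qed.

Lemma exists_small : exists2 z, z \in Gorb x & nrm z < 1.
Proof.
have [_ _ _ ck _] := gx; apply/hasP; by rewrite has_count ck.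
Qed.

Lemma exists_large : exists2 z, z \in Gorb x & 1 <= nrm z.
Proof.
have [_ _ sz ck _] := gx.
have : ~~ all (fun z => nrm z < 1) (Gorb x) by rewrite all_count ck sz ltn_eqF.
by case/allPn=> z Oz; rewrite -leNgt; exists z.
Qed.

Section AtPrime.

Variables (p : nat).
Hypothesis p_pr : prime p.

Let hVp := hV p_pr.

Lemma content_vunit : vunit (V p) (a%:~R * \prod_(z <- Gorb x) mu (V p) z).
Proof. by have [[P cP DP] _ _ _ _] := gx; exact: (content_unit hVp p_pr cP DP). Qed.

(** Since [a] times the product of all [mu z] is a unit, it suffices to compare [f z] with [mu z]
    factor by factor. Taking [z] or 1 for [f z] shows that [a] times any partial product of
    conjugates is integral. *)
Lemma vring_prod_mu (f : E -> E) : (forall z, z \in Gorb x -> f z / mu (V p) z \in V p) ->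
  a%:~R * \prod_(z <- Gorb x) f z \in V p.
Proof.
move=> hf; have -> : \prod_(z <- Gorb x) f z =
    (\prod_(z <- Gorb x) mu (V p) z) * \prod_(z <- Gorb x) (f z / mu (V p) z).
  rewrite -big_split /=; apply: eq_bigr => z _.
  by rewrite mulrC divfK // (mu_neq0 hVp).
rewrite mulrA; apply: (vringM hVp); first by case/and3P: content_vunit.
by rewrite big_seq; apply: (vring_prod hVp).
Qed.

Lemma act_gamma g : exists2 b : bool, True &
  act g gamma = (-1) ^+ b * (a%:~R * \prod_(z <- Gorb x | 1 <= nrm (act g^-1%g z)) z).
Proof.
have [_ _ _ _ [b Dgamma]] := gx; exists b => //.
rewrite Dgamma !rmorphM /= rmorphXn rmorphN1 rmorph_int -mulrA; congr (_ * (_ * _)).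
rewrite rmorph_prod -[RHS](perm_big _ (Gorb_perm x g)) big_map /=.
by apply: eq_bigl => z; rewrite actK.
Qed.

Lemma vring_sign (b : bool) y : y \in V p -> (-1) ^+ b * y \in V p.
Proof. by case: b => Vy; rewrite ?expr0 ?expr1 ?mul1r ?mulN1r // (vringN hVp). Qed.

Lemma vring_act_gamma g : act g gamma \in V p.
Proof.
have [b _ ->] := act_gamma g; apply: vring_sign; rewrite big_mkcond.
apply: vring_prod_mu => z _; case: ifP => _; first exact: (div_mu hVp).
by rewrite div1r (mu_inv hVp).
Qed.

(* Some conjugate of [z] is small, so some conjugate of [gamma] does not involve [z]. *)
Lemma vring_gamma_mul z : z \in Gorb x -> exists g, act g gamma * mu (V p) z \in V p.
Proof.
move=> Oz; have [y Oy y1] := exists_small; have [g Dz] := Gorb_trans Oy Oz.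
exists g; have [b _ ->] := act_gamma g; rewrite -mulrA; apply: vring_sign.
have -> : a%:~R * \prod_(z <- Gorb x | 1 <= nrm (act g^-1%g z)) z * mu (V p) z =
  a%:~R * \prod_(w <- Gorb x) (if w == z then mu (V p) z else
             if 1 <= nrm (act g^-1%g w) then w else 1).
  rewrite -mulrA; congr (_ * _); rewrite big_mkcond !(big_rem z Oz) /= eqxx.
  rewrite Dz actK leNgt y1 /= mul1r mulrC -Dz; congr (_ * _).
  apply: eq_big_seq => w; rewrite mem_rem_uniq ?orbit_seq_uniq // inE => /andP[/negPf -> _] //.
apply: vring_prod_mu => w Ow; case: eqP => [->|_].
  by rewrite divff ?(mu_neq0 hVp) // (vring1 hVp).
case: ifP => _; first exact: (div_mu hVp).
by rewrite div1r (mu_inv hVp).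
Qed.

(** Dual to the preceding lemma: some conjugate of [z] is large, so some conjugate of [gamma]
    contains the factor [z], and removing it leaves room for [mu z]. If [z] is integral, [mu z = 1];
    otherwise [z^-1] is integral and there is nothing to gain. *)
Lemma vring_gamma_div z : z \in Gorb x -> exists g, act g gamma / z \in V p.
Proof.
move=> Oz; have [y Oy y1] := exists_large; have [g Dz] := Gorb_trans Oy Oz.
exists g.
have nzz := Gorb_neq0 Oz.
have V1 : act g gamma / z * mu (V p) z \in V p.
  have [b _ ->] := act_gamma g; rewrite -!mulrA; apply: vring_sign; rewrite mulrA.
  have -> : a%:~R * \prod_(z <- Gorb x | 1 <= nrm (act g^-1%g z)) z * (z^-1 * mu (V p) z) =
    a%:~R * \prod_(w <- Gorb x) (if w == z then mu (V p) z else
             if 1 <= nrm (act g^-1%g w) then w else 1).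
    rewrite -mulrA; congr (_ * _); rewrite big_mkcond !(big_rem z Oz) /= eqxx.
    have -> : act g^-1%g z = y by rewrite Dz actK.
    rewrite y1 mulrACA divff // mul1r mulrC; congr (_ * _).
    apply: eq_big_seq => w; rewrite mem_rem_uniq ?orbit_seq_uniq // inE => /andP[/negPf -> _] //.
  apply: vring_prod_mu => w Ow; case: eqP => [->|_].
    by rewrite divff ?(mu_neq0 hVp) // (vring1 hVp).
  case: ifP => _; first exact: (div_mu hVp).
  by rewrite div1r (mu_inv hVp).
move: V1; rewrite /mu; case: ifPn => [_|nVz]; first by rewrite mulr1.
move=> _; apply: (vringM hVp); first exact: vring_act_gamma.
by case: (vring_total hVp z) nVz => [->|].
Qed.

End AtPrime.

End Good.

(** * The norm of [gamma] and archimedean bounds for the blocks *)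

Section Bounds.

Variables (d k : nat) (x : E) (a : int).
Hypotheses (gx : good d k x a) (k_gt0 : (0 < k)%N) (k_lt_d : (k < d)%N).

Lemma nrm_gamma : nrm gamma = a%:~R * mahler (Gorb x).
Proof.
have [_ a_gt0 _ _ [b ->]] := gx.
rewrite !nrmM nrm_sign mul1r nrm_int ger0_norm ?ler0z ?ltW // nrm_prod; congr (_ * _).
rewrite big_mkcond /=; apply: eq_bigr => z _.
by case: leP => // /ltW h; apply/esym/max_idPl.
Qed.

Lemma lead_ge1 : 1 <= a%:~R :> RR.
Proof. by have [_ a_gt0 _ _ _] := gx; rewrite -[1]/(1%:~R) ler_int. Qed.

Lemma nrm_gamma_ge1 : 1 <= nrm gamma.
Proof. by rewrite nrm_gamma mulr_ege1 ?lead_ge1 ?mahler_ge1. Qed.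

Lemma nrm_act_gamma g : nrm (act g gamma) <= nrm gamma.
Proof.
have [b _ ->] := act_gamma gx g.
have a_ge1 := lead_ge1; have a_ge0 : 0 <= a%:~R :> RR := le_trans ler01 a_ge1.
rewrite nrm_gamma !nrmM nrm_sign mul1r nrm_int ger0_norm // ler_wpM2l // nrm_prod.
rewrite big_mkcond /=; apply: ler_prod => z _.
by case: ifP => _; rewrite ?nrm_ge0 ?ler01 /= le_max lexx ?orbT.
Qed.

Lemma coset_norm_int : exists z : int, coset_norm N gamma = z%:~R.
Proof.
apply: fixed_int => [g|p pp]; first exact: coset_norm_fixed.
by apply: (vring_prod (hV pp)) => A _; exact: vring_act_gamma gx _ _ _.
Qed.

(** Every [w] and every [1/w] becomes integral after multiplication by one suitable conjugate of
    [gamma]; the other factors of the norm are integral anyway. So a single integer controls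
    numerators and denominators of all conjugates of [x] at all primes. *)
Lemma norm_gamma_nat (z : int) : coset_norm N gamma = z%:~R ->
  [/\ (0 < `|z|)%N, `|z|%N%:R <= nrm gamma ^+ #|cosets N|,
  forall p w, prime p -> w \in Gorb x -> `|z|%N%:R * w \in V p &
  forall p w, prime p -> w \in Gorb x -> `|z|%N%:R / w \in V p].
Proof.
move=> Dz.
have nzg : gamma != 0 by rewrite -nrm_gt0 (lt_le_trans ltr01) ?nrm_gamma_ge1.
have Vact p g : prime p -> act g gamma \in V p by move=> pp; exact: vring_act_gamma gx _ _ _.
have absz_nat : exists b : bool, coset_norm N gamma = (-1) ^+ b * `|z|%N%:R.
  by exists (z < 0)%R; rewrite Dz {1}(intEsign z) rmorphM rmorphXn rmorphN1.
have aux p y : prime p -> (exists g, act g gamma * y \in V p) -> `|z|%N%:R * y \in V p.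
  move=> pp [g Vgy]; have [b Db] := absz_nat.
  have -> : `|z|%N%:R * y = (-1) ^+ b * (coset_norm N gamma * y).
    by rewrite Db mulrA mulrA -signr_addb addbb mul1r.
  apply: (vring_sign pp); rewrite /coset_norm (bigD1 (N :* g)%g) /=; last first.
    by apply/rcosetsP; exists g.
  rewrite act_repr // mulrAC; apply: (vringM (hV pp)) => //.
  by apply: (vring_prod (hV pp)) => A _; exact: Vact.
split.
- rewrite absz_gt0; apply/eqP => z0; move/eqP: Dz; apply/negP; rewrite z0.
  by apply/prodf_neq0 => A _; rewrite fmorph_eq0.
- have -> : `|z|%N%:R = nrm (coset_norm N gamma).
    by rewrite Dz nrm_int -intr_norm.
  rewrite nrm_prod -prodr_const; apply: ler_prod => A _.
  by rewrite nrm_ge0 nrm_act_gamma.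
- move=> p y pp Oy; apply: aux => //; have [g Vg] := vring_gamma_mul gx k_gt0 pp Oy.
  exists g; have -> : act g gamma * y = act g gamma * mu (V p) y * (y / mu (V p) y).
    by rewrite -mulrA mulrC [mu _ _ * _]mulrC divfK ?(mu_neq0 (hV pp)) // mulrC.
  by apply: (vringM (hV pp)) => //; exact: (div_mu (hV pp)).
- move=> p y pp Oy; by apply: aux => //; exact: (vring_gamma_div gx k_gt0 k_lt_d).
Qed.

(** For the conjugate [F_A] of [F]: its Mahler measure, an element carrying its Gauss norm at the
    chosen place above [p], and its constant term. *)
Definition block_mahler (A : {set gT}) (x : E) := mahler [seq act (repr A) z | z <- Norb x].
Definition block_content (p : nat) (A : {set gT}) (x : E) := \prod_(z <- Norb x) mu (V p) (act (repr A) z).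
Definition block_const (A : {set gT}) (x : E) := act (repr A) (orbpoly x)`_0.

Lemma block_mahler_ge1 A : 1 <= block_mahler A x. Proof. exact: mahler_ge1. Qed.

Lemma block_mahler_prod : nrm gamma = a%:~R * \prod_(A in cosets (S x)) block_mahler A x.
Proof.
rewrite nrm_gamma /mahler big_Gorb; congr (_ * _); apply: eq_bigr => A _.
by rewrite /block_mahler /mahler big_map.
Qed.

Lemma block_mahler_le A : A \in cosets (S x) -> block_mahler A x <= nrm gamma.
Proof.
move=> cA; rewrite block_mahler_prod (bigD1 A) //= mulrCA ler_peMr ?(le_trans ler01) ?block_mahler_ge1 //.
rewrite mulr_ege1 ?lead_ge1 //; elim/big_ind: _ => // [u v|B _]; last exact: block_mahler_ge1.
exact: mulr_ege1.
Qed.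

Lemma nrm_block_const A : nrm (block_const A x) = \prod_(z <- Norb x) nrm (act (repr A) z).
Proof.
rewrite /block_const orbpoly0 nrmM nrm_prod.
have -> : nrm ((-1) ^+ size (Norb x)) = 1 by rewrite -signr_odd nrm_sign.
by rewrite mul1r.
Qed.

Lemma nrm_block_const_le A : A \in cosets (S x) -> nrm (block_const A x) <= nrm gamma.
Proof.
move=> cA; apply: le_trans (block_mahler_le cA); rewrite nrm_block_const /block_mahler /mahler big_map.
by apply: ler_prod => z _; rewrite nrm_ge0 le_max lexx orbT.
Qed.

(** The constant coefficient of the integral minimal polynomial is a nonzero integer, equal up to
    sign to [a] times the product of all block constants. The other blocks contribute at most their
    Mahler measures, and these together with [a] stay below [|gamma|]. *)
Lemma nrm_block_const_ge A : A \in cosets (S x) -> 1 <= nrm (block_const A x) * nrm gamma.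
Proof.
move=> cA.
have prod_ge1 : 1 <= a%:~R * \prod_(z <- Gorb x) nrm z.
  have [[P _ DP] a_gt0 _ _ _] := gx.
  have DP0 : (P`_0)%:~R = (-1) ^+ size (Gorb x) * (a%:~R * \prod_(z <- Gorb x) z) :> E.
    rewrite -[LHS]coef_map DP coefZ mulrCA; congr (_ * _).
    rewrite -horner_coef0 horner_prod; elim: (Gorb x) => [|z r IH].
      by rewrite !big_nil expr0 mulr1.
    by rewrite !big_cons IH !hornerE /= exprS; ring.
  have nzP0 : P`_0 != 0.
    rewrite -(intr_eq0 CC) -(rmorph_int iota) fmorph_eq0 DP0 !mulf_neq0 ?expf_neq0 ?oppr_eq0 ?oner_eq0 ?(lead_neq0 gx) //.
    by rewrite prodf_seq_neq0; apply/allP => z Oz; rewrite (Gorb_neq0 gx).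
  have -> : a%:~R * \prod_(z <- Gorb x) nrm z = nrm (P`_0)%:~R.
    rewrite DP0 !nrmM nrm_prod nrm_int ger0_norm ?ler0z ?ltW //.
    by rewrite -[(-1) ^+ _]signr_odd nrm_sign mul1r.
  by rewrite nrm_int -intr_norm -[1]/(1%:~R) ler_int -gtz0_ge1 normr_gt0.
apply: le_trans prod_ge1 _; rewrite big_Gorb (bigD1 A) //= -nrm_block_const mulrCA.
apply: ler_wpM2l; first exact: nrm_ge0.
have a_ge0 : 0 <= a%:~R :> RR := le_trans ler01 lead_ge1.
rewrite block_mahler_prod [X in _ <= _ * X](bigD1 A) //= ler_wpM2l //.
set X := \prod_(B in _ | _) _; set Y := \prod_(B in _ | _) _.
have XY : X <= Y.
  apply: ler_prod => B _; rewrite /block_mahler /mahler big_map; apply/andP; split.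
    by apply: prodr_ge0 => z _; apply: nrm_ge0.
  by apply: ler_prod => z _; rewrite nrm_ge0 le_max lexx orbT.
apply: le_trans XY _; apply: ler_peMl (block_mahler_ge1 A).
by apply: prodr_ge0 => B _; apply: le_trans ler01 (block_mahler_ge1 B).
Qed.

Lemma block_const_neq0 A : A \in cosets (S x) -> block_const A x != 0.
Proof.
move=> cA; rewrite -nrm_gt0 lt_neqAle nrm_ge0 andbT; apply/eqP => C0.
by have := nrm_block_const_ge cA; rewrite -C0 mul0r ler10.
Qed.

End Bounds.
Lemma repr_Gorb x A z : z \in Norb x -> act (repr A) z \in Gorb x.
Proof. by case/orbit_seqP=> h _ ->; rewrite -actM mem_orbit_seq ?inE. Qed.

(** * Boundedness of the valuations that serve as codes *)

Section PrimeCodes.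

Variables (d k : nat) (x : E) (a : int) (n : nat).
Hypotheses (gx : good d k x a) (k_gt0 : (0 < k)%N) (k_lt_d : (k < d)%N).
Hypothesis n_gt0 : (0 < n)%N.
Hypothesis n_mul : forall p z, prime p -> z \in Gorb x -> n%:R * z \in V p.
Hypothesis n_div : forall p z, prime p -> z \in Gorb x -> n%:R / z \in V p.

Variables (p : nat).
Hypothesis p_pr : prime p.
Let hVp := hV p_pr.

(** The Newton polygon gives a valuation in units of [1/d!]; integrality of [n * z] and [n / z]
    bounds it by that of [n]. For primes not dividing [n] it is therefore 0. *)
Lemma pval_Gorb z : z \in Gorb x ->
  exists2 v : int, (`|v| <= logn p n * d`!)%N & pval p (V p) d`! z v.
Proof.
move=> Oz; have [[P cP DP] _ sz _ _] := gx.
have nzP : P != 0 by apply/eqP => P0; move: cP; rewrite P0 zcontents0.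
have szP : (size P <= d.+1)%N.
  rewrite -(size_map_inj_poly (f := intr : int -> E)) //.
    by rewrite DP (leq_trans (size_scale_leq _ _)) // size_prod_XsubC sz.
  move=> u v /eqP; rewrite -subr_eq0 -rmorphB /= -(fmorph_eq0 iota) rmorph_int intr_eq0.
  by rewrite subr_eq0 => /eqP.
have rPz : root (map_poly intr P) z.
  by rewrite DP rootZ ?(lead_neq0 gx) // root_prod_XsubC.
have nzz := Gorb_neq0 gx k_gt0 k_lt_d Oz.
have [v pv] := pval_exists hVp p_pr nzP szP rPz nzz.
exists v => //; apply: (pval_bound hVp p_pr nzz _ _ pv); apply: (vring_prime_part hVp p_pr n_gt0).
  exact: n_mul.
exact: n_div.
Qed.

Lemma pval_block_content A : exists2 v : int, (`|v| <= size (Norb x) * (logn p n * d`!))%N &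
  pval p (V p) d`! (block_content p A x) v.
Proof.
rewrite /block_content; apply: (pval_prod hVp p_pr) => z Oz; rewrite /mu; case: ifP => _.
  by exists 0; rewrite // (pval1 hVp).
by apply: pval_Gorb; apply: repr_Gorb.
Qed.

Lemma pval_block_const A : exists2 v : int, (`|v| <= size (Norb x) * (logn p n * d`!))%N &
  pval p (V p) d`! (block_const A x) v.
Proof.
have [v hv pv] : exists2 v : int, (`|v| <= size (Norb x) * (logn p n * d`!))%N &
  pval p (V p) d`! (\prod_(z <- Norb x) act (repr A) z) v.
  by apply: (pval_prod hVp p_pr) => z Oz; apply: pval_Gorb; apply: repr_Gorb.
exists v => //; rewrite /block_const orbpoly0 /pval exprMn -mulrA (vunitM hVp) //.
by rewrite (vunitX hVp) // (vunitX hVp) // (vunitN hVp) (vunit1 hVp).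
Qed.

End PrimeCodes.

Lemma cosets_S (H : {group gT}) : (H : {set gT}) \in cosets H.
Proof. by apply/rcosetsP; exists 1%g; rewrite ?inE ?mulg1. Qed.

(** * Elements with equal codes are conjugate over [K] *)

Section SameCode.

Variables (d k : nat) (x y : E) (a b : int).
Hypotheses (gx : good d k x a) (gy : good d k y b).
Hypotheses (k_gt0 : (0 < k)%N) (k_lt_d : (k < d)%N).
Hypothesis eqS : S x = S y.

Let fixx i s (Ss : s \in S x) := orbpoly_fixed i Ss.
Lemma orbpoly_fixed_eq i s : s \in S x -> act s (orbpoly y)`_i = (orbpoly y)`_i.
Proof. rewrite eqS; exact: orbpoly_fixed. Qed.

(* [x] and [y] have the same constant term: the norm of their quotient minus [1] is an
   integer of absolute value less than [1]. *)
Lemma same_const :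
  (forall p A, prime p -> A \in cosets (S x) -> vunit (V p) (block_const A x / block_const A y)) ->
  (forall A, A \in cosets (S x) -> nrm (block_const A x - block_const A y) < nrm (block_const A y)) ->
  (orbpoly x)`_0 = (orbpoly y)`_0.
Proof.
move=> hU hlt.
pose delta := (orbpoly x)`_0 / (orbpoly y)`_0 - 1.
have nzy A : A \in cosets (S x) -> block_const A y != 0.
  by rewrite eqS; exact: (block_const_neq0 gy k_gt0 k_lt_d).
have actd A : act A delta = act A (orbpoly x)`_0 / act A (orbpoly y)`_0 - 1.
  by rewrite rmorphB rmorph1 fmorph_div.
have fixd s : s \in S x -> act s delta = delta.
  by move=> Ss; rewrite actd fixx // orbpoly_fixed_eq.
have small A : A \in cosets (S x) -> nrm (act (repr A) delta) < 1.
  move=> cA; have nz := nzy A cA; rewrite actd -/(block_const A x) -/(block_const A y).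
  have -> : block_const A x / block_const A y - 1 = (block_const A x - block_const A y) / block_const A y.
    by rewrite mulrBl divff.
  by rewrite nrmM nrmV ltr_pdivrMr ?nrm_gt0 // mul1r hlt.
have : coset_norm (S x) delta = 0.
  apply: fixed_small_eq0; first exact: coset_norm_fixed.
    move=> p pp; apply: (vring_prod (hV pp)) => A cA; rewrite actd.
    by apply: (vringB (hV pp)); [case/and3P: (hU p A pp cA) | exact: (vring1 (hV pp))].
  rewrite nrm_prod -big_enum /=.
  apply: (@prod_lt1_seq _ (fun A : {set gT} => nrm (act (repr A) delta)) _ (S x : {set gT})).
  - by move=> A; rewrite mem_enum => cA; rewrite nrm_ge0 ltW ?small.
  - by rewrite mem_enum cosets_S.
  - exact: small (cosets_S _).
move/eqP; rewrite /coset_norm prodf_seq_eq0 => /hasP[A _ /andP[cA]].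
rewrite actd subr_eq0 => /eqP E1.
apply: (fmorph_inj (act (repr A))); rewrite -[LHS](divfK (nzy A cA)) /=.
by rewrite -/(block_const A y) in E1 *; rewrite E1 mul1r.
Qed.

(** Each coefficient of [F_A] is divisible by the content of [F_A], and the two contents agree up to
    units. Since [a] times the product of the contents is a unit, [a] times the norm of the
    difference is an integer; its absolute value is at most [a * prod (block_mahler * t) = |gamma| *
    t^m]. *)
Lemma same_coef t i :
  (forall p A, prime p -> A \in cosets (S x) -> vunit (V p) (block_content p A x / block_content p A y)) ->
  (forall A, A \in cosets (S x) ->
     nrm (act (repr A) ((orbpoly x)`_i - (orbpoly y)`_i)) <= block_mahler A x * t) ->
  nrm gamma * t ^+ #|cosets (S x)| < 1 ->
  (orbpoly x)`_i = (orbpoly y)`_i.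
Proof.
move=> hU hle hlt.
pose delta := (orbpoly x)`_i - (orbpoly y)`_i.
have fixd s : s \in S x -> act s delta = delta.
  by move=> Ss; rewrite rmorphB /= fixx // orbpoly_fixed_eq.
have a_ge1 := lead_ge1 gx; have a_ge0 : 0 <= a%:~R :> RR := le_trans ler01 a_ge1.
have : a%:~R * coset_norm (S x) delta = 0.
  apply: fixed_small_eq0.
  - by move=> g; rewrite rmorphM /= rmorph_int coset_norm_fixed.
  - move=> p pp; have hVp := hV pp.
    have nzCon A z : block_content p A z != 0.
      by rewrite prodf_seq_neq0; apply/allP => w _; rewrite (mu_neq0 hVp).
    have := content_vunit gx pp; rewrite big_Gorb => /and3P[_ Vc _].
    have -> : a%:~R * coset_norm (S x) delta =
      (a%:~R * \prod_(A in cosets (S x)) block_content p A x) *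
      \prod_(A in cosets (S x)) (act (repr A) delta / block_content p A x).
      rewrite -mulrA -big_split /=; congr (_ * _); apply: eq_bigr => A _.
      by rewrite mulrC divfK.
    apply: (vringM hVp) Vc _; apply: (vring_prod hVp) => A cA.
    have coefV z : act (repr A) (orbpoly z)`_i / block_content p A z \in V p.
      have := coef_prod_mu hVp [seq act (repr A) w | w <- Norb z] i.
      by rewrite -act_coef_orbpoly big_map.
    rewrite rmorphB mulrBl; apply: (vringB hVp); first exact: coefV.
    have -> : act (repr A) (orbpoly y)`_i / block_content p A x =
        act (repr A) (orbpoly y)`_i / block_content p A y * (block_content p A x / block_content p A y)^-1.
      by rewrite invf_div mulrA divfK.
    by apply: (vringM hVp); [exact: coefV | case/and3P: (hU p A pp cA)].
  - rewrite nrmM nrm_int ger0_norm // nrm_prod; apply: le_lt_trans hlt.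
    rewrite (block_mahler_prod gx) -mulrA ler_wpM2l // -prodr_const -big_split /=.
    by apply: ler_prod => A cA; rewrite nrm_ge0 hle.
move/eqP; rewrite mulf_eq0 (negPf (lead_neq0 gx)) /= /coset_norm prodf_seq_eq0.
by case/hasP=> A _ /andP[_]; rewrite fmorph_eq0 subr_eq0 => /eqP.
Qed.

Lemma same_block : size (Norb x) = size (Norb y) ->
  (forall i, (i < size (Norb x))%N -> (orbpoly x)`_i = (orbpoly y)`_i) -> y \in Norb x.
Proof.
move=> szE coefE; rewrite -root_prod_XsubC -/(orbpoly x).
have -> : orbpoly x = orbpoly y.
  apply/polyP => i; have [lti|] := ltnP i (size (Norb x)); first exact: coefE.
  rewrite leq_eqVlt => /predU1P[<-|lt].
    have lead z : (orbpoly z)`_(size (Norb z)) = 1.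
      have := monicP (monic_prod_XsubC (Norb z) predT id).
      by rewrite /lead_coef size_prod_XsubC.
    by rewrite lead szE lead.
  by rewrite !nth_default // size_prod_XsubC -?szE.
by rewrite root_prod_XsubC orbit_seq_refl.
Qed.

End SameCode.
(** A group containing [N] is determined by the set of cosets of [N] that it contains. *)
Lemma card_overgroups :
  (#|[set H : {group gT} | N \subset H]| <= 2 ^ #|cosets N|)%N.
Proof.
rewrite -card_powerset.
pose f (H : {group gT}) := [set A in cosets N | A \subset H].
rewrite -(card_in_imset (f := f)); last first.
  have memf (H : {group gT}) g : N \subset H -> (g \in H) = ((N :* g)%g \in f H).
    move=> sNH; rewrite inE; have -> /= : (N :* g)%g \in cosets N by apply/rcosetsP; exists g.
    apply/idP/idP => [Hg|/fintype.subsetP]; last by apply; exact: rcoset_refl.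
    apply/fintype.subsetP => _ /rcosetP[h Nh ->]; rewrite groupM //.
    exact: (fintype.subsetP sNH).
  move=> H H'; rewrite !inE => sH sH' Ef; apply/val_inj/setP => g /=.
  by rewrite !memf // Ef.
apply: subset_leq_card; apply/fintype.subsetP => _ /imsetP[H _ ->].
by rewrite powersetE; apply/fintype.subsetP => A; rewrite inE => /andP[].
Qed.

(** * Encoding the elements by finitely many integers *)

Section Counting.

Variables (c : gT).
Hypothesis act_conj : forall x, iota (act c x) = ((iota x)^*)%C.

(* A complex conjugate pair [z], [z^*] is determined by [ReIm z] and [ReIm z^*]; using one
   real coordinate per coset counts each complex place with its correct dimension. *)
Definition ReIm (z : CC) := complex.Re z + complex.Im z.

Lemma ReImB x y : ReIm (iota (x - y)) = ReIm (iota x) - ReIm (iota y).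
Proof.
rewrite rmorphB /=; case: (iota x) (iota y) => a b [e f]; rewrite /ReIm /=; ring.
Qed.

(** At [z] and at its complex conjugate the coordinates are [Re z + Im z] and [Re z - Im z]; if both
    are at most [t], then so are [|Re z|] and [|Im z|]. *)
Lemma nrm_ReIm x t : `|ReIm (iota x)| <= t -> `|ReIm (iota (act c x))| <= t ->
  nrm x <= 2 * t.
Proof.
rewrite act_conj /ReIm /nrm; move: (absC_le_ReIm (iota x)).
case: (iota x) => a b /= h; rewrite !ler_norml => /andP[h1 h2] /andP[h3 h4].
apply: le_trans h _; have -> : 2 * t = t + t by ring.
by apply: lerD; rewrite ler_norml; apply/andP; split; lra.
Qed.

Lemma nrm_actc x : nrm (act c x) = nrm x.
Proof. by rewrite /nrm act_conj absC_conj. Qed.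

(** Needed to combine the coordinates at [A] and at its complex conjugate coset: the precision there
    is measured against the same Mahler measure. *)
Lemma block_mahler_conj x A : A \in cosets (S x) -> block_mahler (A :* c)%g x = block_mahler A x.
Proof.
case/rcosetsP=> g _ ->; rewrite /block_mahler /mahler !big_map -rcosetM.
have Mrepr h : \prod_(z <- Norb x) Num.max 1 (nrm (act (repr (S x :* h)%g) z)) =
               \prod_(z <- Norb x) Num.max 1 (nrm (act h z)).
  have [s Ss] := repr_rcosetP (S x) h.
  rewrite -[RHS](perm_big _ (Norb_block Ss)) big_map.
  by apply: eq_bigr => z _; rewrite actM.
by rewrite !Mrepr; apply: eq_bigr => z _; rewrite actM nrm_actc.
Qed.

Lemma bucket_exists (y : RR) (L : nat) : 1 <= y -> y < 2 ^+ L ->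
  exists2 v, (v < L)%N & 2 ^+ v <= y < 2 ^+ v.+1.
Proof.
move=> y1; elim: L => [|L IH]; first by rewrite expr0 ltNge y1.
have [/IH[v lt_v hv] _|le_y lt_y] := ltP y (2 ^+ L).
  by exists v; rewrite // ltnW.
by exists L; rewrite ?ltnSn // le_y.
Qed.

Lemma truncn_exists (y : RR) (L : nat) : 0 <= y -> y < L%:R ->
  exists2 v, (v < L)%N & v%:R <= y < v.+1%:R.
Proof.
by move=> y0 ltL; exists (Num.truncn y); [rewrite truncn_lt_nat | exact: truncn_itv].
Qed.

Lemma same_floor (y z : RR) (v : nat) : v%:R <= y < v.+1%:R -> v%:R <= z < v.+1%:R ->
  `|y - z| <= 1.
Proof.
rewrite -natr1 => /andP[h1 h2] /andP[h3 h4]; rewrite ler_norml; apply/andP; split; lra.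
Qed.

Section FinalStage.

Variables (d k l n : nat) (H : RR) (x y : E) (a b : int) (jM jC : {set gT} -> nat).
Hypotheses (gx : good d k x a) (gy : good d k y b).
Hypotheses (k_gt0 : (0 < k)%N) (k_lt_d : (k < d)%N).
Hypothesis eqS : S x = S y.
Hypotheses (szx : size (Norb x) = l) (szy : size (Norb y) = l).
Hypotheses (H_ge1 : 1 <= H) (DH : nrm gamma = H ^+ d).

(** Elements in one cell differ at each block by at most [2 / T = 1 / (2 * H^l)] times the Mahler
    measure. Over [m] blocks this makes the integer at most [H^d / (2 * H^l)^m = 2^-m], which is
    less than 1 because [l * m = d]. *)
Notation T := (4 * H ^+ l).

Lemma final_stage :
  (forall p A, prime p -> A \in cosets (S x) -> vunit (V p) (block_content p A x / block_content p A y)) ->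
  (forall p A, prime p -> A \in cosets (S x) -> vunit (V p) (block_const A x / block_const A y)) ->
  (forall A, A \in cosets (S x) -> 2 ^+ jM A <= block_mahler A x) ->
  (forall A, A \in cosets (S x) -> 2 ^+ jC A <= nrm (block_const A y) * nrm gamma) ->
  (forall A, A \in cosets (S x) ->
     `|complex.Re (iota (block_const A x - block_const A y))| * nrm gamma / 2 ^+ jC A * 8 <= 1) ->
  (forall A, A \in cosets (S x) ->
     `|complex.Im (iota (block_const A x - block_const A y))| * nrm gamma / 2 ^+ jC A * 8 <= 1) ->
  (forall A i, A \in cosets (S x) -> (0 < i < l)%N ->
     `|ReIm (iota (act (repr A) ((orbpoly x)`_i - (orbpoly y)`_i)))| / 2 ^+ jM A * T <= 1) ->
  y \in Norb x.
Proof.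
move=> hB hC hM hJ hRe hIm hcell.
have H_gt0 : 0 < H := lt_le_trans ltr01 H_ge1.
have T_gt0 : 0 < T by rewrite mulr_gt0 ?exprn_gt0 // ltr0n.
have G_gt0 : 0 < nrm gamma := lt_le_trans ltr01 (nrm_gamma_ge1 gx).
have e2_gt0 j : 0 < 2 ^+ j :> RR by rewrite exprn_gt0 // ltr0n.
apply: (same_block (y := y)) => [|i]; first by rewrite szx.
rewrite szx; case: i => [_|i lti].
  (* Both coordinates agree up to one eighth of [2^jC / |gamma|], and that scale is a lower bound
     for the constant term of [y]: the relative error is at most 1/4. *)
  apply: (same_const gy k_gt0 k_lt_d eqS hC) => A cA.
  have hR := hRe A cA; have hI := hIm A cA; have hj := hJ A cA.
  apply: le_lt_trans (absC_le_ReIm _) _.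
  rewrite -(ltr_pM2r G_gt0); apply: lt_le_trans hj; rewrite mulrDl.
  move: hR hI; rewrite -![_ / _ * 8]mulrAC !ler_pdivrMr //.
  set u := _ * nrm gamma; set w := _ * nrm gamma; rewrite !mul1r => hu hw.
  have := e2_gt0 (jC A); rewrite /= -/u -/w; lra.
apply: (same_coef (t := 2 / T) gx eqS hB) => [A cA|].
  have bound B : B \in cosets (S x) ->
    `|ReIm (iota (act (repr B) ((orbpoly x)`_i.+1 - (orbpoly y)`_i.+1)))| <= block_mahler B x / T.
    move=> cB; have := hcell B i.+1 cB lti.
    rewrite mulrAC ler_pdivrMr // mul1r => h; rewrite ler_pdivlMr //.
    exact: le_trans h (hM B cB).
  have -> : block_mahler A x * (2 / T) = 2 * (block_mahler A x / T) by rewrite mulrCA.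
  apply: nrm_ReIm; first exact: bound.
  have fixd s : s \in S x -> act s ((orbpoly x)`_i.+1 - (orbpoly y)`_i.+1) = (orbpoly x)`_i.+1 - (orbpoly y)`_i.+1.
    by move=> Ss; rewrite rmorphB /= orbpoly_fixed // (orbpoly_fixed_eq eqS).
  rewrite -(repr_cosets_mul c fixd cA) -(block_mahler_conj cA).
  by apply: bound; apply: cosets_mul.
have [_ _ szd _ _] := gx.
have m_gt0 : (0 < #|cosets (S x)|)%N by apply/card_gt0P; exists (S x : {set gT}); exact: cosets_S.
rewrite DH -szd size_Gorb szx.
have -> : 2 / T = (2 * H ^+ l)^-1 by field; rewrite expf_neq0 ?lt0r_neq0.
rewrite mulnC exprM -exprMn.
have -> : H ^+ l * (2 * H ^+ l)^-1 = 2^-1 by field; rewrite expf_neq0 ?lt0r_neq0.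
rewrite -(prednK m_gt0); apply: (le_lt_trans (y := 2^-1)); last by lra.
by rewrite exprS ler_piMr ?invr_ge0 // exprn_ile1 ?invr_ge0 //; lra.
Qed.

End FinalStage.
Lemma cell_range (y e : RR) : `|y| < e -> forall T, 0 < T ->
  0 <= (y + e) * T /\ (y + e) * T < 2 * e * T.
Proof.
rewrite ltr_norml => /andP[h1 h2] T T_gt0; split; last by rewrite ltr_pM2r //; lra.
by apply: mulr_ge0 (ltW T_gt0); lra.
Qed.

Lemma shift_int (v : int) (w : nat) : (`|v| <= w)%N ->
  (`|(v + w%:Z)%R| < 2 * w + 1)%N /\ `|(v + w%:Z)%R|%N%:Z - w%:Z = v.
Proof. by move=> h; split; lia. Qed.

Lemma prod_const_seq (I : Type) (r : seq I) (b : nat) :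
  (\prod_(i <- r) b = b ^ size r)%N.
Proof. by rewrite big_const_seq count_predT iter_muln_1. Qed.

Lemma ReIm_bound z : `|ReIm z| <= 2 * absC z.
Proof.
rewrite /ReIm (le_trans (ler_normD _ _)) //.
by have := lerD (absC_Re z) (absC_Im z); rewrite -[2]/(1 + 1 : RR) mulrDl mul1r.
Qed.

(* The factors count the blocks' stabilizers, the valuations of the contents and of the
   constant terms, the dyadic sizes of the Mahler measures and of the constant terms, the
   grid positions of the constant terms, and the cells of the other coefficients; the last
   [l] is the size of an orbit. *)
Definition codes_bound (d l n M L W : nat) : nat :=
  let m := (d %/ l)%N in
  let P := (\prod_(p <- primes n) (2 * (l * (logn p n * d`!)) + 1) ^ m)%N in
  (2 ^ M * (P * (P * (L ^ m * ((2 * L) ^ m * (33 ^ m * (33 ^ m * (W ^ (m * (l - 1)) * l))))))))%N.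

(** Successive pigeonholes [s0], ..., [s7], each making one more family of codes constant. All
    elements of the last sublist lie in one [N]-orbit, which has [l] elements. *)
Lemma counting (d k l n M L W : nat) (H : RR) (z : int) (s : seq E) :
  (0 < k)%N -> (k < d)%N -> 1 <= H -> nrm gamma = H ^+ d ->
  (#|cosets N| <= M)%N -> coset_norm N gamma = z%:~R -> n = `|z|%N ->
  H ^+ d < 2 ^+ L -> 2 ^+ (l + 3) * (4 * H ^+ l) < W%:R ->
  uniq s -> (forall x, x \in s -> (exists a, good d k x a) /\ size (Norb x) = l) ->
  (size s <= codes_bound d l n M L W)%N.
Proof.
move=> k_gt0 k_lt_d H_ge1 DG leM Dz Dn ltL hW Us hs.
have H_gt0 : 0 < H := lt_le_trans ltr01 H_ge1.
have G_gt0 : 0 < nrm gamma by rewrite DG exprn_gt0.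
have e2_gt0 j : 0 < 2 ^+ j :> RR by rewrite exprn_gt0 // ltr0n.
rewrite /codes_bound; set m := (d %/ l)%N; set P := (\prod_(p <- _) _)%N.
pose Lg := enum [set H : {group gT} | N \subset H].
set b := (P * _)%N.
have leL : (size Lg <= 2 ^ M)%N.
  by rewrite -cardE; apply: leq_trans card_overgroups _; rewrite leq_pexp2l.
apply: leq_trans (_ : (size Lg * b <= _)%N); last by rewrite leq_mul.
have := @code_stage E unit [:: tt] (fun _ x v => S x = nth 1%G Lg v) (fun=> size Lg) b s.
rewrite big_seq1; apply=> [_ x _ _|s0 sub0 hS0].
  have Lx : S x \in Lg by rewrite mem_enum inE /= joing_subl.
  by exists (index (S x) Lg); rewrite ?index_mem ?nth_index.
have [v0 hS0'] := hS0 tt (mem_head _ _).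
set S0 := nth 1%G Lg v0 in hS0'.
have {hS0} hs0 x : x \in s0 -> [/\ exists a, good d k x a, size (Norb x) = l & S x = S0].
  by move=> sx; have [gx szx] := hs x (mem_subseq sub0 sx); split=> //; exact: hS0'.
have Us0 := subseq_uniq sub0 Us.
have [s0E|[x0 sx0]] : s0 = [::] \/ exists x0, x0 \in s0.
  by case: (s0) => [|x ?]; [left | right; exists x; rewrite mem_head].
  by rewrite s0E.
have card_m : #|cosets S0| = m.
  have [[a [_ _ szd _ _]] szx <-] := hs0 x0 sx0.
  rewrite /m -szd size_Gorb szx mulnK // -szx lt0n size_eq0.
  by apply: contraTneq (orbit_seq_refl N x0) => ->.
have nP x p w : x \in s0 -> prime p -> w \in Gorb x -> n%:R * w \in V p /\ n%:R / w \in V p.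
  move=> /hs0[[a gx] _ _] pp Ow.
  by have [_ _ h1 h2] := norm_gamma_nat gx k_gt0 k_lt_d Dz; rewrite Dn; split; [exact: h1 | exact: h2].
have n_gt0 : (0 < n)%N.
  by have [[a gx] _ _] := hs0 x0 sx0; have [] := norm_gamma_nat gx k_gt0 k_lt_d Dz; rewrite Dn.
pose w p := (l * (logn p n * d`!))%N.
pose shifted p (v : nat) := v%:Z - (w p)%:Z.
(* A valuation in [[-w, w]] is stored as a natural number below [2 * w + 1]. *)
have shiftP (q : nat -> {set gT} -> E -> E) :
    (forall p A x, prime p -> x \in s0 -> exists2 v : int, (`|v| <= w p)%N & pval p (V p) d`! (q p A x) v) ->
    forall pA x, pA \in [seq (p, A) | p <- primes n, A <- enum (cosets S0)] -> x \in s0 ->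
    exists2 v : nat, (v < 2 * w pA.1 + 1)%N & pval pA.1 (V pA.1) d`! (q pA.1 pA.2 x) (shifted pA.1 v).
  move=> hq pA x /allpairsP[[p A] /= [pn _ ->]] sx /=.
  have pp : prime p by move: pn; rewrite mem_primes => /andP[].
  have [v hv pv] := hq p A x pp sx; have [lt_v Ev] := shift_int hv; exists `|(v + (w p)%:Z)%R|%N => //.
  by rewrite /shifted Ev.
have DP : (\prod_(pA <- [seq (p, A) | p <- primes n, A <- enum (cosets S0)]) (2 * w pA.1 + 1))%N = P.
  rewrite big_allpairs_dep; apply: eq_bigr => p _ /=.
  by rewrite prod_const_seq -cardE card_m.
have hCon p A x : prime p -> x \in s0 -> exists2 v : int, (`|v| <= w p)%N & pval p (V p) d`! (block_content p A x) v.
  move=> pp sx; have [[a gx] szx _] := hs0 x sx.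
  rewrite /w -szx; apply: pval_block_content gx k_gt0 k_lt_d n_gt0 _ _ _ pp _ => q u qq Ou.
    by have [] := nP x q u sx qq Ou.
  by have [] := nP x q u sx qq Ou.
have hCst p A x : prime p -> x \in s0 -> exists2 v : int, (`|v| <= w p)%N & pval p (V p) d`! (block_const A x) v.
  move=> pp sx; have [[a gx] szx _] := hs0 x sx.
  rewrite /w -szx; apply: pval_block_const gx k_gt0 k_lt_d n_gt0 _ _ _ pp _ => q u qq Ou.
    by have [] := nP x q u sx qq Ou.
  by have [] := nP x q u sx qq Ou.
rewrite /b -{1}DP; apply: code_stage (shiftP (fun p A x => block_content p A x) hCon) _ => s1 sub1 hs1.
rewrite -{1}DP; apply: code_stage => [pA x r_pA sx|s2 sub2 hs2].
  exact: (shiftP (fun p A x => block_const A x) hCst) r_pA (mem_subseq sub1 sx).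
have sub02 x : x \in s2 -> x \in s0 by move/(mem_subseq sub2)/(mem_subseq sub1).
have -> : (L ^ m = \prod_(A <- enum (cosets S0)) L)%N by rewrite prod_const_seq -cardE card_m.
apply: (@code_stage _ _ _ (fun A x v => 2 ^+ v <= block_mahler A x < 2 ^+ v.+1)) => [A x|s3 sub3 hs3].
  rewrite mem_enum => cA /sub02 /hs0[[a gx] _ eqS]; apply: bucket_exists (block_mahler_ge1 _ _) _.
  by rewrite (le_lt_trans (block_mahler_le gx _)) ?DG // eqS.
(* The factor [|gamma|] lifts the constant terms to absolute value at least 1, so their dyadic
   exponents are natural; the product is below [|gamma|^2 < 2^(2L)]. *)
have -> : ((2 * L) ^ m = \prod_(A <- enum (cosets S0)) (2 * L))%N by rewrite prod_const_seq -cardE card_m.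
apply: (@code_stage _ _ _ (fun A x v => 2 ^+ v <= nrm (block_const A x) * nrm gamma < 2 ^+ v.+1)) => [A x|s4 sub4 hs4].
  rewrite mem_enum => cA /(mem_subseq sub3)/sub02/hs0[[a gx] _ eqS].
  apply: bucket_exists; first by rewrite (nrm_block_const_ge gx) // eqS.
  rewrite mul2n -addnn exprD.
  have lex : nrm (block_const A x) <= nrm gamma by rewrite (nrm_block_const_le gx) // eqS.
  apply: le_lt_trans (_ : nrm gamma * nrm gamma < _); first by rewrite ler_pM2r.
  by rewrite DG; apply: ltr_pM; rewrite ?exprn_ge0 ?(ltW H_gt0).
have sub04 x : x \in s4 -> x \in s0 by move/(mem_subseq sub4)/(mem_subseq sub3)/sub02.
have /choice[jM hjM] A : exists v, A \in cosets S0 -> forall x, x \in s3 -> 2 ^+ v <= block_mahler A x < 2 ^+ v.+1.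
  have [cA|_] := boolP (A \in cosets S0); last by exists 0%N.
  by have [|v hv] := hs3 A; [rewrite mem_enum | exists v].
have /choice[jC hjC] A : exists v, A \in cosets S0 -> forall x, x \in s4 ->
    2 ^+ v <= nrm (block_const A x) * nrm gamma < 2 ^+ v.+1.
  have [cA|_] := boolP (A \in cosets S0); last by exists 0%N.
  by have [|v hv] := hs4 A; [rewrite mem_enum | exists v].
have -> : (33 ^ m = \prod_(A <- enum (cosets S0)) 33)%N by rewrite prod_const_seq -cardE card_m.
(* The scaled coordinate has absolute value below 2, so after the shift by 2 and multiplication by 8
   it lies in [[0, 32)]. *)
have grid (f : CC -> RR) : (forall u, `|f u| <= absC u) -> forall A x, A \in enum (cosets S0) -> x \in s4 ->
    exists2 v, (v < 33)%N & v%:R <= (f (iota (block_const A x)) * nrm gamma / 2 ^+ jC A + 2) * 8 < v.+1%:R.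
  move=> hf A x; rewrite mem_enum => cA sx; have /andP[_ h] := hjC A cA x sx.
  have {h}: `|f (iota (block_const A x)) * nrm gamma / 2 ^+ jC A| < 2.
    rewrite !normrM (gtr0_norm G_gt0) [`|_^-1|]gtr0_norm ?invr_gt0 // ltr_pdivrMr // -exprS.
    by apply: le_lt_trans h; rewrite ler_pM2r //; exact: hf.
  move/cell_range => /(_ 8 (ltr0n RR 8)) [h1 h2]; apply: truncn_exists => //.
  by apply: lt_trans h2 _; rewrite -!natrM ltr_nat.
apply: code_stage (grid _ absC_Re) _ => s5 sub5 hs5.
pose RelIm A x (v : nat) :=
  v%:R <= (complex.Im (iota (block_const A x)) * nrm gamma / 2 ^+ jC A + 2) * 8 < v.+1%:R.
apply: (code_stage (Rel := RelIm)) => [A x cA /(mem_subseq sub5) sx|s6 sub6 hs6].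
  exact: grid absC_Im A x cA sx.
have sub46 x : x \in s6 -> x \in s4 by move/(mem_subseq sub6)/(mem_subseq sub5).
pose r7 := [seq (i, A) | i <- seq.iota 1 (l - 1)%N, A <- enum (cosets S0)].
have -> : (W ^ (m * (l - 1)) = \prod_(iA <- r7) W)%N.
  by rewrite prod_const_seq size_allpairs size_iota -cardE card_m mulnC.
pose Rel7 (iA : nat * {set gT}) x (v : nat) :=
  v%:R <= (ReIm (iota (act (repr iA.2) (orbpoly x)`_(iA.1))) / 2 ^+ jM iA.2 + 2 ^+ (l + 2)) * (4 * H ^+ l) < v.+1%:R.
apply: (code_stage (Rel := Rel7)) => [iA x|s7 sub7 hs7].
  case/allpairsP=> [[i A] /= [_ cA ->]] sx; rewrite mem_enum in cA.
  have s3x := mem_subseq sub4 (sub46 _ sx).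
  have [[a gx] szx eqS] := hs0 x (sub04 _ (sub46 _ sx)).
  have /andP[hM1 hM2] := hjM A cA x s3x.
  have T_gt0 : 0 < 4 * H ^+ l by rewrite mulr_gt0 ?exprn_gt0 // ltr0n.
  (* One factor 2 comes from [ReIm], one from the dyadic rounding of the Mahler measure, and [2^l]
     from the coefficient bound. The range after shifting is twice this, whence the [2^(l+3)] in the
     condition on [W]. *)
  have h : `|ReIm (iota (act (repr A) (orbpoly x)`_i)) / 2 ^+ jM A| < 2 ^+ (l + 2).
    rewrite normrM [`|_^-1|]gtr0_norm ?invr_gt0 // ltr_pdivrMr //.
    apply: le_lt_trans (ReIm_bound _) _; rewrite -/(nrm _) act_coef_orbpoly.
    have := coef_mahler_bound [seq act (repr A) u | u <- Norb x] i.
    rewrite size_map szx -/(block_mahler A x) => hc.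
    apply: le_lt_trans (_ : 2 * (2 ^+ l * block_mahler A x) < _); first by rewrite ler_pM2l.
    have -> : 2 ^+ (l + 2) * 2 ^+ jM A = 2 * (2 ^+ l * 2 ^+ (jM A).+1) :> RR.
      by rewrite exprD [2 ^+ (jM A).+1]exprS; ring.
    by rewrite !ltr_pM2l.
  have [h1 h2] := cell_range h T_gt0.
  rewrite /Rel7 /=; apply: truncn_exists => //; apply: lt_trans hW.
  by have -> : 2 ^+ (l + 3) = 2 * 2 ^+ (l + 2) :> RR by rewrite -exprS addnS.
have [->//|[x sx]] : s7 = [::] \/ exists x, x \in s7.
  by case: (s7) => [|x ?]; [left | right; exists x; rewrite mem_head].
have sub06 u : u \in s7 -> u \in s0 by move/(mem_subseq sub7)/sub46/sub04.
have [[a gx] szx eqS] := hs0 x (sub06 _ sx).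
have Us7 : uniq s7.
  by do 7!(apply: subseq_uniq; first by eassumption).
rewrite -szx; apply: uniq_leq_size Us7 _ => y sy.
have [[b' gy] szy eqS'] := hs0 y (sub06 _ sy).
have s6x := mem_subseq sub7 sx; have s6y := mem_subseq sub7 sy.
have s4x := sub46 _ s6x; have s4y := sub46 _ s6y.
have s3x := mem_subseq sub4 s4x; have s3y := mem_subseq sub4 s4y.
have s2x := mem_subseq sub3 s3x; have s2y := mem_subseq sub3 s3y.
have s1x := mem_subseq sub2 s2x; have s1y := mem_subseq sub2 s2y.
(* Primes not dividing [n] carry no code: there the bound [w p] is 0, so both valuations vanish. *)
have unitq (q : nat -> {set gT} -> E -> E) p A :
   (forall p A x, prime p -> x \in s0 -> exists2 v : int, (`|v| <= w p)%N & pval p (V p) d`! (q p A x) v) ->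
   (p \in primes n -> exists v, forall u, u \in s2 -> pval p (V p) d`! (q p A u) (shifted p v)) ->
   prime p -> A \in cosets S0 -> vunit (V p) (q p A x / q p A y).
  move=> hq hsame pp cA; have [pn|npn] := boolP (p \in primes n).
    have [v hv] := hsame pn.
    exact: (pval_same (hV pp) (fact_gt0 d) (hv x s2x) (hv y s2y)).
  have w0 : w p = 0%N by rewrite /w lognE -mem_primes (negPf npn) mul0n muln0.
  have [v1] := hq p A x pp (sub02 _ s2x); have [v2] := hq p A y pp (sub02 _ s2y).
  rewrite w0 !leqn0 !absz_eq0 => /eqP -> p2 /eqP -> p1.
  exact: (pval_same (hV pp) (fact_gt0 d) p1 p2).
have eqSxy : S x = S y by rewrite eqS.
have close (f : CC -> RR) A : (forall u v, f (u - v) = f u - f v) ->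
    (exists v : nat, forall u, u \in s6 -> v%:R <= (f (iota (block_const A u)) * nrm gamma / 2 ^+ jC A + 2) * 8 < v.+1%:R) ->
    `|f (iota (block_const A x - block_const A y))| * nrm gamma / 2 ^+ jC A * 8 <= 1.
  move=> hf [v hv]; have := same_floor (hv x s6x) (hv y s6y).
  rewrite rmorphB hf /=; set X := f _; set Y := f _.
  have -> : (X * nrm gamma / 2 ^+ jC A + 2) * 8 - (Y * nrm gamma / 2 ^+ jC A + 2) * 8 =
    (X - Y) * nrm gamma / 2 ^+ jC A * 8 by ring.
  by rewrite !normrM (gtr0_norm G_gt0) [`|_^-1|]gtr0_norm ?invr_gt0 // [`|8|]ger0_norm.
apply: (final_stage (jM := jM) (jC := jC) gx gy k_gt0 k_lt_d eqSxy szx szy H_ge1 DG).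
- move=> p A pp; rewrite eqS => cA; apply: (unitq (fun p A x => block_content p A x)) => // pn.
  have [|v hv] := hs1 (p, A); first by apply/allpairsP; exists (p, A); rewrite mem_enum.
  by exists v => u s2u; apply: hv; exact: mem_subseq sub2 _ s2u.
- move=> p A pp; rewrite eqS => cA; apply: (unitq (fun p A x => block_const A x)) => // pn.
  have [|v hv] := hs2 (p, A); first by apply/allpairsP; exists (p, A); rewrite mem_enum.
  by exists v.
- by move=> A; rewrite eqS => cA; have /andP[] := hjM A cA x s3x.
- by move=> A; rewrite eqS => cA; have /andP[] := hjC A cA y s4y.
- move=> A; rewrite eqS => cA; apply: close => [[? ?] [? ?]//|].
  have [|v hv] := hs5 A; first by rewrite mem_enum.
  by exists v => u s6u; apply: hv; exact: mem_subseq sub6 _ s6u.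
- move=> A; rewrite eqS => cA; apply: close => [[? ?] [? ?]//|].
  by have [|v hv] := hs6 A; [rewrite mem_enum | exists v].
move=> A i; rewrite eqS => cA /andP[i_gt0 lt_il].
have [|v hv] := hs7 (i, A).
  apply/allpairsP; exists (i, A); rewrite mem_enum mem_iota /=; split=> //.
  by rewrite i_gt0 add1n subn1 prednK // (leq_ltn_trans _ lt_il).
have := same_floor (hv x sx) (hv y sy); rewrite /= rmorphB /= ReImB.
set X := ReIm _; set Y := ReIm _; set T := 4 * _.
have -> : (X / 2 ^+ jM A + 2 ^+ (l + 2)) * T - (Y / 2 ^+ jM A + 2 ^+ (l + 2)) * T =
  (X - Y) / 2 ^+ jM A * T by ring.
have T_gt0 : 0 < T by rewrite mulr_gt0 ?exprn_gt0 // ltr0n.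
by rewrite normrM (gtr0_norm T_gt0) normrM [`|_^-1|]gtr0_norm ?invr_gt0.
Qed.

End Counting.
(** * Minimal polynomials, extension degrees and primitivity *)

Lemma fixed_poly_int (P : {poly E}) : (forall g i, act g P`_i = P`_i) ->
  exists (q : {poly int}) (e : int), e != 0 /\ map_poly intr q = e%:~R *: P.
Proof.
move=> fixP.
have /choice[f hf] i : exists q : rat, P`_i = (numq q)%:~R / (denq q)%:~R.
  by apply: fixed_rat => g; exact: fixP.
have [q [e nz_e Dr]] := rat_poly_scale (\poly_(i < size P) f i).
exists q, e; split=> //; apply/polyP=> i; rewrite coefZ coef_map_id0 //.
have [lti|lei] := ltnP i (size P); last first.
  have := congr1 (fun r : {poly rat} => r`_i) Dr.
  rewrite coef_poly ltnNge lei /= coefZ coef_map_id0 // => /esym/eqP.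
  rewrite mulf_eq0 invr_eq0 !intr_eq0 (negPf nz_e) /= => /eqP ->.
  by rewrite nth_default // mulr0.
have := congr1 (fun r : {poly rat} => r`_i) Dr.
rewrite coef_poly lti coefZ coef_map_id0 // -{1}[f i]divq_num_den => Dfi.
have Dz : q`_i * denq (f i) = e * numq (f i).
  apply: (intr_inj (R := rat)); rewrite !rmorphM /=.
  have nzd : (denq (f i))%:~R != 0 :> rat by rewrite intr_eq0 denq_neq0.
  have nze : e%:~R != 0 :> rat by rewrite intr_eq0.
  by apply: (mulfI (invr_neq0 nze)); rewrite mulrA -Dfi mulrA mulVf // mul1r divfK.
have nzint (z : int) : z != 0 -> z%:~R != 0 :> E.
  by move=> nzz; rewrite -(fmorph_eq0 iota) rmorph_int intr_eq0.
rewrite hf; apply: (mulIf (nzint _ (denq_neq0 (f i)))).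
by rewrite -rmorphM Dz rmorphM /= -mulrA divfK // nzint ?denq_neq0.
Qed.

Lemma intC_iota (p : {poly int}) : intC p = map_poly iota (map_poly intr p).
Proof. by rewrite -map_poly_comp; apply: eq_map_poly => z /=; rewrite rmorph_int. Qed.

Lemma root_intC_iota (p : {poly int}) x : root (intC p) (iota x) = root (map_poly intr p) x.
Proof. by rewrite intC_iota fmorph_root. Qed.

Lemma size_intr (p : {poly int}) : size (map_poly intr p : {poly E}) = size p.
Proof.
apply: size_map_inj_poly => // u v /eqP.
by rewrite -subr_eq0 -rmorphB /= -(fmorph_eq0 iota) rmorph_int intr_eq0 subr_eq0 => /eqP.
Qed.

Lemma Gorb_poly_fixed x g i :
  act g (\prod_(z <- Gorb x) ('X - z%:P))`_i = (\prod_(z <- Gorb x) ('X - z%:P))`_i.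
Proof.
rewrite -coef_map rmorph_prod -[RHS](congr1 (fun p : {poly E} => p`_i) (perm_big _ (Gorb_perm x g))) big_map.
by congr (_ : {poly _})`_i; apply: eq_bigr => z _; rewrite rmorphB /= map_polyX map_polyC.
Qed.

(** An integer polynomial vanishing at [x] vanishes on its Galois orbit, and the orbit polynomial is
    rational; minimality forces equal degrees. *)
Lemma Zminpoly_Gorb x p : Zminpoly (iota x) p ->
  size p = (size (Gorb x)).+1 /\
  map_poly intr p = (lead_coef p)%:~R *: \prod_(z <- Gorb x) ('X - z%:P).
Proof.
case=> nzp _ _; rewrite root_intC_iota => px0 min_p.
have all_r : all (root (map_poly intr p : {poly E})) (Gorb x).
  apply/allP => _ /orbit_seqP[g _ ->].
  have <- : map_poly (act g) (map_poly intr p) = map_poly intr p.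
    by rewrite -map_poly_comp; apply: eq_map_poly => z /=; rewrite rmorph_int.
  by rewrite fmorph_root.
have Ur : uniq_roots (Gorb x) by rewrite uniq_rootsE orbit_seq_uniq.
have nzp' : (map_poly intr p : {poly E}) != 0 by rewrite -size_poly_eq0 size_intr size_poly_eq0.
have le1 := max_ring_poly_roots nzp' all_r Ur.
rewrite size_intr in le1.
have [q [e [nze Dq]]] := fixed_poly_int (Gorb_poly_fixed x).
have nze' : e%:~R != 0 :> E by rewrite -(fmorph_eq0 iota) rmorph_int intr_eq0.
have szq : size q = (size (Gorb x)).+1 by rewrite -size_intr Dq size_scale // size_prod_XsubC.
have nzq : q != 0 by rewrite -size_poly_eq0 szq.
have qx0 : root (intC q) (iota x).
  by rewrite root_intC_iota Dq rootZ // root_prod_XsubC (orbit_seq_refl [set: gT]%G).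
have := min_p q nzq qx0; rewrite szq => le2.
have szp : size p = (size (Gorb x)).+1 by apply/eqP; rewrite eqn_leq le2.
split=> //; have szp' : size (map_poly intr p : {poly E}) = (size (Gorb x)).+1 by rewrite size_intr.
rewrite {1}(all_roots_prod_XsubC szp' all_r Ur) lead_coefE szp' /=.
by rewrite coef_map_id0 // lead_coefE szp.
Qed.

Lemma conjugate_Gorb x z : conjugate (iota x) z -> exists2 y, y \in Gorb x & z = iota y.
Proof.
case=> p [/Zminpoly_Gorb[szp Dp]]; rewrite intC_iota Dp map_polyZ rootZ; last first.
  rewrite fmorph_eq0; apply/eqP => l0; move: szp; rewrite -size_intr Dp l0 scale0r size_poly0.
  by [].
rewrite rmorph_prod /= (eq_bigr (fun z => 'X - (iota z)%:P)); last first.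
  by move=> y _; rewrite rmorphB /= map_polyX map_polyC.
by rewrite -(big_map iota predT (fun z => 'X - z%:P)) root_prod_XsubC => /mapP.
Qed.

Lemma Gorb_conjugate x y p : Zminpoly (iota x) p -> y \in Gorb x -> conjugate (iota x) (iota y).
Proof.
move=> Zp Oy; exists p; split=> //; rewrite root_intC_iota.
have [_ ->] := Zminpoly_Gorb Zp; rewrite /root hornerZ mulf_eq0; apply/orP; right.
by rewrite -/(root _ _) root_prod_XsubC.
Qed.

Lemma heightW_pow (p : {poly int}) (s : seq CC) (H : RR) d : (0 < d)%N -> size p = d.+1 -> 0 < lead_coef p ->
  heightW p s = H -> (lead_coef p)%:~R * \prod_(z <- s) Num.max 1 (absC z) = H ^+ d.
Proof.
move=> d_gt0 szp a_gt0 <-; rewrite /heightW szp /=.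
set X := (lead_coef p)%:~R * _.
have X_gt0 : 0 < X.
  rewrite mulr_gt0 ?ltr0z //; elim/big_ind: _ => // [u v|z _]; first exact: mulr_gt0.
  by rewrite lt_max ltr01.
rewrite -Rpower_nat; last exact: Rpower_gt0.
by rewrite [RHS]RpowerA mulVf ?pnatr_eq0 -?lt0n // Rpower1.
Qed.

Lemma norm_real_sign (w : CC) : w = ((complex.Re w)%:C)%C ->
  (-1) ^+ (complex.Re w < 0)%R * w = ((absC w)%:C)%C.
Proof.
move=> Dw; rewrite {2}Dw [in RHS]Dw absC_real /=.
have -> : (-1) ^+ (complex.Re w < 0)%R = (((-1) ^+ (complex.Re w < 0)%R)%:C)%C :> CC.
  by rewrite rmorphXn rmorphN1.
by rewrite -rmorphM /= normrEsign.
Qed.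

Section WithConj.

Variables (c : gT).
Hypothesis act_conj : forall x, iota (act c x) = ((iota x)^*)%C.

(** The height only gives [a * |I| = H^d] for the product [I] of the large conjugates. Complex
    conjugation permutes these, so [I] is real and the sign [b] corrects it; in particular [H^d]
    comes from [E]. *)
Lemma in_A_data d k (H : RR) x : (0 < d)%N -> in_A k d H (iota x) ->
  exists (a : int) (b : bool), [/\ exists2 P : {poly int}, zcontents P = 1 &
        map_poly intr P = a%:~R *: \prod_(z <- Gorb x) ('X - z%:P),
      0 < a, size (Gorb x) = d,
      count (fun z => nrm z < 1) (Gorb x) = k &
      iota ((-1) ^+ b * a%:~R * \prod_(z <- Gorb x | 1 <= nrm z) z) = ((H ^+ d)%:C)%C].
Proof.
move=> d_gt0 [p [s [Zp [Us hs] szp cs hH]]].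
have [szG Dp] := Zminpoly_Gorb Zp.
have [nzp a_gt0 cp _ _] := Zp.
have szd : size (Gorb x) = d by apply: succn_inj; rewrite -szG.
have nza : (lead_coef p)%:~R != 0 :> E by rewrite -(fmorph_eq0 iota) rmorph_int intr_eq0 lead_coef_eq0.
have perm_s : perm_eq s (map iota (Gorb x)).
  apply: uniq_perm => //; first by rewrite map_inj_uniq ?orbit_seq_uniq //; apply: fmorph_inj.
  move=> z; apply/idP/mapP => [/hs pz|[y Oy ->]].
    by apply: conjugate_Gorb; exists p.
  by apply/hs; rewrite root_intC_iota Dp rootZ // root_prod_XsubC.
set I := \prod_(z <- Gorb x | 1 <= nrm z) z.
exists (lead_coef p), (complex.Re (iota I) < 0); split=> //.
- by exists p.
- by rewrite -cs (seq.permP perm_s) count_map.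
have := heightW_pow d_gt0 szp a_gt0 hH; rewrite (perm_big _ perm_s) big_map /= => DH.
have DI : nrm I = \prod_(z <- Gorb x) Num.max 1 (absC (iota z)).
  rewrite nrm_prod big_mkcond /=; apply: eq_bigr => z _; rewrite -/(nrm z).
  by case: leP => // /ltW h; apply/esym/max_idPl.
have fixI : act c I = I.
  rewrite rmorph_prod /= -[RHS](perm_big _ (Gorb_perm x c)) big_map /=.
  by apply: eq_bigl => z; rewrite (nrm_actc act_conj).
rewrite -DH -DI.
have realI : iota I = ((complex.Re (iota I))%:C)%C.
  have := act_conj I; rewrite fixI; case: (iota I) => u v /= [Ev].
  by congr (_ +i* _)%C; lra.
rewrite !rmorphM /= rmorphXn rmorphN1 !rmorph_int -mulrA [in LHS]mulrCA.
by rewrite /nrm -(norm_real_sign realI).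
Qed.

Lemma in_A_good d k (H : RR) x : (0 < d)%N -> iota gamma = ((H ^+ d)%:C)%C ->
  in_A k d H (iota x) -> exists a, good d k x a.
Proof.
move=> d_gt0 Dgamma /(in_A_data d_gt0)[a [b [hP a_gt0 szG cG Dg]]].
exists a; split=> //; exists b.
by apply: (fmorph_inj iota); rewrite Dgamma.
Qed.

End WithConj.
Lemma fix_act_gamma g h : g \in N -> act g (act h gamma) = act h gamma.
Proof.
move=> Ng; rewrite -actM; have -> : (h * g = h * g * h^-1 * h)%g by rewrite mulgKV.
by rewrite actM fix_gamma // -mem_conjN.
Qed.

Lemma normal_closure_subfield (w : CC) : is_subfield (normal_closure w).
Proof.
split=> [F [F1 _ _ _] _ //|u v hu hv F hF hS|u v hu hv F hF hS|u hu F hF hS].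
- by case: (hF) => _ FB _ _; apply: FB; [exact: hu | exact: hv].
- by case: (hF) => _ _ FM _; apply: FM; [exact: hu | exact: hv].
- by case: (hF) => _ _ _ FV; apply: FV; exact: hu.
Qed.

Lemma normal_closure_fixed w : normal_closure (iota gamma) w ->
  exists2 x, (forall g, g \in N -> act g x = x) & w = iota x.
Proof.
move/(_ (fun w => exists2 x, (forall g, g \in N -> act g x = x) & w = iota x)); apply; first split.
- by exists 1; rewrite ?rmorph1 // => g _; rewrite rmorph1.
- move=> _ _ [x fx ->] [y fy ->]; exists (x - y); rewrite ?rmorphB // => g Ng.
  by rewrite rmorphB /= fx ?fy.
- move=> _ _ [x fx ->] [y fy ->]; exists (x * y); rewrite ?rmorphM // => g Ng.
  by rewrite rmorphM /= fx ?fy.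
- move=> _ [x fx ->]; exists x^-1; rewrite ?fmorphV // => g Ng.
  by rewrite fmorphV /= fx.
move=> _ /conjugate_Gorb[_ /orbit_seqP[h _ ->] ->]; exists (act h gamma) => // g Ng.
exact: fix_act_gamma.
Qed.

Hypothesis fixed_closure : forall x, (forall g, g \in N -> act g x = x) ->
  normal_closure (iota gamma) (iota x).

(** [orbpoly x] has coefficients in [K], and a polynomial over [K] that vanishes at [x] vanishes on
    the whole [N]-orbit. *)
Lemma ext_degree_Norb x l : ext_degree (normal_closure (iota gamma)) (iota x) l ->
  size (Norb x) = l.
Proof.
case=> [[q [nzq Kq qx0 szq]] minq]; apply/eqP; rewrite eqn_leq; apply/andP; split; last first.
  rewrite -ltnS -(size_prod_XsubC (Norb x) id) -/(orbpoly x) -(size_map_poly iota).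
  apply: minq.
  - by rewrite map_poly_eq0 monic_neq0 // monic_prod_XsubC.
  - move=> i; rewrite coef_map; apply: fixed_closure => g Ng.
    by apply: orbpoly_fixed; rewrite /= (fintype.subsetP (joing_subl _ _)).
  - by rewrite fmorph_root root_prod_XsubC orbit_seq_refl.
have /choice[f hf] i : exists y, (forall g, g \in N -> act g y = y) /\ q`_i = iota y.
  by have [y fy Dy] := normal_closure_fixed (Kq i); exists y.
pose q0 := \poly_(i < size q) f i.
have Dq : q = map_poly iota q0.
  apply/polyP => i; rewrite coef_map coef_poly; have [lti|lei] := ltnP i (size q).
    by have [_ ->] := hf i.
  by rewrite /= rmorph0 nth_default.
have nzq0 : q0 != 0 by rewrite -(map_poly_eq0 iota) -Dq.
rewrite -ltnS -szq Dq size_map_poly; apply: max_poly_roots nzq0 _ (orbit_seq_uniq _ _).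
apply/allP => _ /orbit_seqP[g Ng ->].
have -> : q0 = map_poly (act g) q0.
  apply/polyP => i; rewrite coef_map coef_poly; case: ifP => _ /=; last by rewrite rmorph0.
  by have [fxi _] := hf i; rewrite fxi.
by rewrite fmorph_root -(fmorph_root iota) -Dq.
Qed.

(* For every integer [n] the element [theta n = sum_i n^i z_i] is sent by [sigma] to one of
   its Galois conjugates; some [g] serves for infinitely many [n], and comparing
   polynomials in [n] gives the claim. *)
Lemma aut_agrees (K : CC -> Prop) sigma x : is_subfield K -> is_aut K sigma ->
  (forall z, z \in Gorb x -> K (iota z)) ->
  exists g, forall z, z \in Gorb x -> sigma (iota z) = iota (act g z).
Proof.
move=> [K1 KB KM KV] [sigK [sD sM s1 _ _]] KG.
have K0 : K 0 by rewrite -(subrr 1); apply: KB.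
have KN u : K u -> K (- u) by move=> Ku; rewrite -sub0r; apply: KB.
have KD u v : K u -> K v -> K (u + v) by move=> Ku Kv; rewrite -[v]opprK; apply/KB/KN.
have Kn (n : nat) : K n%:R by elim: n => // n IH; rewrite -natr1; apply: KD.
have Kz (z : int) : K z%:~R.
  by case: z => n; [exact: (Kn n) | rewrite NegzE mulrNz; apply/KN/(Kn n.+1)].
have KX u n : K u -> K (u ^+ n) by move=> Ku; elim: n => // n IH; rewrite exprS; apply: KM.
have Ksum (I : Type) (r : seq I) (f : I -> CC) : (forall i, K (f i)) -> K (\sum_(i <- r) f i).
  by move=> Kf; elim/big_ind: _ => // u v; exact: KD.
have s0 : sigma 0 = 0.
  by apply: (addrI (sigma 0)); rewrite -sD // !addr0.
have sN u : K u -> sigma (- u) = - sigma u.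
  by move=> Ku; apply/eqP; rewrite -addr_eq0 -sD ?addNr ?s0 //; apply: KN.
have sn (n : nat) : sigma n%:R = n%:R.
  by elim: n => // n IH; rewrite -natr1 sD // IH s1.
have sz (z : int) : sigma z%:~R = z%:~R.
  case: z => n; first exact: (sn n).
  by rewrite NegzE mulrNz sN ?(sn n.+1) //; exact: (Kn n.+1).
have sX u n : K u -> sigma (u ^+ n) = sigma u ^+ n.
  by move=> Ku; elim: n => // n IH; rewrite !exprS sM ?IH //; apply: KX.
have ssum (I : Type) (r : seq I) (f : I -> CC) : (forall i, K (f i)) ->
    sigma (\sum_(i <- r) f i) = \sum_(i <- r) sigma (f i).
  move=> Kf; elim: r => [|i r IH]; first by rewrite !big_nil.
  by rewrite !big_cons sD ?IH //; apply: Ksum.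
have sroot (q : {poly int}) u : K u -> root (intC q) u -> root (intC q) (sigma u).
  move=> Ku /eqP; rewrite horner_poly => h; apply/eqP; rewrite horner_poly.
  rewrite -[RHS]s0 -[in RHS]h ssum => [|i]; last by apply: (KM) => //; exact: KX.
  by apply: eq_bigr => i _; rewrite sM ?sz ?sX //; exact: KX.
pose s := Gorb x.
have Ks i : K (iota s`_i).
  have [lti|lei] := ltnP i (size s); first by apply: KG; apply: mem_nth.
  by rewrite nth_default // rmorph0.
pose theta (n : nat) := \sum_(i < size s) n%:R ^+ i * s`_i.
have Dtheta n : iota (theta n) = \sum_(i < size s) n%:R ^+ i * iota s`_i.
  by rewrite rmorph_sum; apply: eq_bigr => i _; rewrite rmorphM rmorphXn rmorph_nat.
have Kterm n i : K (n%:R ^+ i * iota s`_i) by apply: (KM) => //; apply: KX.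
have Ktheta n : K (iota (theta n)) by rewrite Dtheta; apply: Ksum.
have stheta n : exists g, sigma (iota (theta n)) = iota (act g (theta n)).
  have [q [e [nze Dq]]] := fixed_poly_int (Gorb_poly_fixed (theta n)).
  have rq : root (intC q) (iota (theta n)).
    by rewrite root_intC_iota Dq /root hornerZ mulf_eq0 -/(root _ _) root_prod_XsubC (orbit_seq_refl [set: gT]%G) orbT.
  have := sroot q _ (Ktheta n) rq; rewrite intC_iota Dq map_polyZ rootZ; last first.
    by rewrite rmorph_int intr_eq0.
  rewrite rmorph_prod /= (eq_bigr (fun z => 'X - (iota z)%:P)); last first.
    by move=> y _; rewrite rmorphB /= map_polyX map_polyC.
  rewrite -(big_map iota predT (fun z => 'X - z%:P)) root_prod_XsubC.
  by case/mapP=> _ /orbit_seqP[g _ ->] ->; exists g.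
pose Q g := \poly_(i < size s) (sigma (iota s`_i) - iota (act g s`_i)).
have Qroot n : exists g, root (Q g) n%:R.
  have [g Dg] := stheta n; exists g; rewrite /root horner_poly.
  under eq_bigr => i _ do rewrite mulrBl.
  rewrite sumrB subr_eq0; apply/eqP; transitivity (sigma (iota (theta n))).
    rewrite Dtheta ssum //; apply: eq_bigr => i _.
    by rewrite sM ?sX ?sn 1?mulrC //; apply: KX.
  rewrite Dg rmorph_sum /= rmorph_sum; apply: eq_bigr => i _.
  by rewrite rmorphM /= rmorphXn rmorph_nat rmorphM /= rmorphXn rmorph_nat mulrC.
(* The product vanishes at every natural number, so it is zero, and hence so is one of its factors;
   this singles out the [g] that serves for all conjugates. *)
have : \prod_(g : gT) Q g = 0.
  apply/eqP; apply: contraT => nzQ.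
  have := max_poly_roots (rs := [seq n%:R | n <- seq.iota 0 (size (\prod_(g : gT) Q g))]) nzQ.
  rewrite size_map size_iota ltnn; apply.
    apply/allP => _ /mapP[n _ ->]; have [g rg] := Qroot n.
    by rewrite (bigD1 g) //= rootM rg.
  by rewrite map_inj_uniq ?iota_uniq // => u v /eqP; rewrite eqr_nat => /eqP.
move/eqP/prodf_eq0 => [g _ /eqP Qg0]; exists g => z Oz.
have lti : (index z s < size s)%N by rewrite index_mem.
have := congr1 (fun p : {poly CC} => p`_(index z s)) Qg0.
by rewrite coef_poly lti coef0 nth_index // => /eqP; rewrite subr_eq0 => /eqP.
Qed.

(** The orbit of a normal subgroup is a block, so it is a single point or everything; the latter is
    impossible since its size divides [k < d]. *)
Lemma primitive_Norb d k x a p : (0 < k)%N -> (k < d)%N -> good d k x a -> Zminpoly (iota x) p ->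
  gal_primitive (iota x) -> size (Norb x) = 1%N.
Proof.
move=> k_gt0 k_lt_d gx Zp [_ prim].
pose B w := exists2 y, y \in Norb x & w = iota y.
have subG y : y \in Norb x -> y \in Gorb x.
  by case/orbit_seqP=> g _ ->; rewrite mem_orbit_seq ?inE.
have Bconj w : B w -> Defs.conjugate (iota x) w.
  by case=> y Oy ->; apply: (Gorb_conjugate Zp); exact: subG.
have sfK := normal_closure_subfield (iota x).
have [|B1|Ball] := prim B Bconj.
- move=> sigma sAut; have [|g Dg] := aut_agrees (x := x) sfK sAut.
    move=> z Oz F _; apply; exact: (Gorb_conjugate Zp).
  have [gx_in|gx_out] := boolP (act g x \in Norb x).
    left=> _ [y Oy ->]; exists (act g y); last by apply/Dg/subG.
    exact: (Norb_sub gx_in) (Norb_act g Oy).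
  right=> _ [y Oy ->] [z Oz]; rewrite Dg ?subG // => /fmorph_inj Ez.
  case/negP: gx_out; have /orbit_seqP[h Nh Dy] := Norb_act g Oy.
  have -> : act g x = act h^-1%g z by rewrite -Ez Dy actK.
  by apply: (Norb_sub Oz); rewrite mem_orbit_seq ?groupV.
- apply/eqP; rewrite eqn_leq; apply/andP; split.
    rewrite -[1%N]/(size [:: x]); apply: uniq_leq_size (orbit_seq_uniq _ _) _ => y Oy.
    rewrite inE; apply/eqP/(fmorph_inj iota); apply: B1; first by exists y.
    by exists x => //; exact: orbit_seq_refl.
  by rewrite lt0n size_eq0; apply: contraTneq (orbit_seq_refl N x) => ->.
have le_d : (d <= size (Norb x))%N.
  have [_ _ <- _ _] := gx; apply: uniq_leq_size (orbit_seq_uniq _ _) _ => y Oy.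
  have [z Oz /fmorph_inj ->//] := Ball _ (Gorb_conjugate Zp Oy).
have := dvdn_leq k_gt0 (Norb_dvd_k gx).
by rewrite leqNgt (leq_trans k_lt_d le_d).
Qed.

Lemma Zminpoly_exists x : exists p, Zminpoly (iota x) p.
Proof.
have [q [e [nze Dq]]] := fixed_poly_int (Gorb_poly_fixed x).
have nze' : e%:~R != 0 :> E by rewrite -(fmorph_eq0 iota) rmorph_int intr_eq0.
have szq : size q = (size (Gorb x)).+1 by rewrite -size_intr Dq size_scale // size_prod_XsubC.
have nzq : q != 0 by rewrite -size_poly_eq0 szq.
have nzc : zcontents q != 0 by rewrite zcontents_eq0.
exists (zprimitive q); split.
- by rewrite -size_poly_eq0 size_zprimitive szq.
- by rewrite -sgz_gt0 sgz_lead_primitive nzq.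
- by rewrite zcontents_primitive nzq.
- rewrite root_intC_iota -(rootZ _ _ (a := (zcontents q)%:~R)); last first.
    by rewrite -(fmorph_eq0 iota) rmorph_int intr_eq0.
  rewrite -map_polyZ /= -zpolyEprim Dq rootZ // root_prod_XsubC.
  exact: (orbit_seq_refl [set: gT]%G).
move=> q' nzq'; rewrite root_intC_iota size_zprimitive szq => rq'.
rewrite -(size_intr q'); apply: max_poly_roots (orbit_seq_uniq _ _).
  by rewrite -size_poly_eq0 size_intr size_poly_eq0.
apply/allP => _ /orbit_seqP[g _ ->].
have <- : map_poly (act g) (map_poly intr q') = map_poly intr q'.
  by rewrite -map_poly_comp; apply: eq_map_poly => z /=; rewrite rmorph_int.
by rewrite fmorph_root.
Qed.

End GaloisContext.

(** * The group fixing all conjugates of [gamma] *)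

Section Fixer.

Variables (E : fieldType) (gT : finGroupType) (act : gT -> {rmorphism E -> E}).
Hypothesis act1 : forall x, act 1%g x = x.
Hypothesis actM : forall g h x, act (g * h)%g x = act h (act g x).

(** This is [Gal(E/K)]. Fixing all conjugates, and not [gamma] alone, makes it normal. *)
Definition conj_fixer_set gamma := [set g | [forall h, act g (act h gamma) == act h gamma]].

Lemma conj_fixerP gamma g :
  reflect (forall h, act g (act h gamma) = act h gamma) (g \in conj_fixer_set gamma).
Proof. by rewrite inE; apply: forallPP => h; exact: eqP. Qed.

Lemma conj_fixer_group gamma : group_set (conj_fixer_set gamma).
Proof.
apply/group_setP; split=> [|g h /conj_fixerP hg /conj_fixerP hh]; apply/conj_fixerP => k.
  by rewrite act1.
by rewrite actM hg hh.
Qed.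

Canonical conj_fixer gamma := Group (conj_fixer_group gamma).

Lemma conj_fixer_fix gamma g : g \in conj_fixer gamma -> act g gamma = gamma.
Proof. by move/conj_fixerP/(_ 1%g); rewrite act1. Qed.

Lemma conj_fixer_normal gamma : (conj_fixer gamma <| [set: gT])%g.
Proof.
apply/normalP; split=> [|k _]; first exact: finset.subsetT.
have sub h : (conj_fixer gamma :^ h \subset conj_fixer gamma)%g.
  apply/fintype.subsetP => _ /imsetP[g /conj_fixerP hg ->]; apply/conj_fixerP => i.
  by rewrite conjgE !actM -(actM i h^-1%g) hg -actM mulgKV.
apply/eqP; rewrite finset.eqEsubset sub /= -sub_conjgV; exact: sub.
Qed.

(** Up to a fixed factor [gamma] is a product of conjugates of [x], so a coset is determined by the
    self-map of the orbit of [x] that it induces. *)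
Lemma card_conj_fixer_cosets (x e : E) (P : pred E) gamma :
  (forall g, act g e = e) ->
  gamma = e * \prod_(z <- orbit_seq act [set: gT] x | P z) z ->

  (#|cosets (conj_fixer gamma)| <=
   size (orbit_seq act [set: gT] x) ^ size (orbit_seq act [set: gT] x))%N.
Proof.
move=> fixe Dgamma; set d := size _; pose s := orbit_seq act [set: gT] x; pose N := conj_fixer gamma.
pose f (A : {set gT}) : {ffun seq_sub s -> seq_sub s} :=
  [ffun z : seq_sub s => insubd z (act (repr A) (val z))].
have cardF : #|{ffun seq_sub s -> seq_sub s}| = (d ^ d)%N.
  by rewrite card_ffun card_seq_sub ?orbit_seq_uniq.
rewrite -cardF -(card_in_imset (f := f)); first exact: max_card.
have s_act g z : z \in s -> act g z \in s.
  by case/orbit_seqP=> h _ ->; rewrite -actM mem_orbit_seq ?inE.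
have fval A (z : seq_sub s) : val (f A z) = act (repr A) (val z).
  by rewrite ffunE val_insubd s_act // (valP z).
move=> A B cA cB /ffunP Ef.
have eq_s z : z \in s -> act (repr A) z = act (repr B) z.
  by move=> sz; have := congr1 val (Ef (SeqSub sz)); rewrite !fval.
have [[g _ DA] [h _ DB]] := (rcosetsP cA, rcosetsP cB).
rewrite DA DB in eq_s *; rewrite -[LHS]rcoset_reprK -[RHS]rcoset_reprK.
apply/rcoset_eqP; rewrite mem_rcoset; apply/conj_fixerP => k.
move: (repr _) (repr _) eq_s => u v eq_s; rewrite Dgamma !rmorphM /= !fixe; congr (_ * _); rewrite !rmorph_prod /=.
rewrite [LHS]big_seq_cond [RHS]big_seq_cond; apply: eq_bigr => z /andP[sz _].
rewrite [in LHS]actM eq_s; last exact: s_act.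
by rewrite -actM mulgV act1.
Qed.

End Fixer.
(** * Normal number fields inside the complex numbers *)

(** The last clause says that [z] is a sum of elements of [s]; it shows later that the given
    elements generate the field that [z] generates. *)
Lemma primitive_element_CC (s : seq CC) :
  (forall x, x \in s -> algebraicOver (ratr : rat -> CC) x) ->
  exists z, [/\ algebraicOver (ratr : rat -> CC) z,
    exists ps : seq {poly rat}, s = [seq (map_poly ratr p).[z] | p <- ps] &
    forall A : CC -> Prop, A 0 -> (forall u v, A u -> A v -> A (u + v)) ->
      (forall x, x \in s -> A x) -> A z].
Proof.
elim: s => [_|x s IH hs]; first by exists 0; split=> //; [exact: algebraic0 | exists [::]].
have [|z [alg_z [ps Ds] Az]] := IH; first by move=> y sy; apply: hs; rewrite inE sy orbT.
have alg_x := hs x (mem_head _ _).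
have [rx nz_rx rx0] := alg_x.
have [rz nz_rz rz0] := algebraic_opp alg_z.
have [n [[pz Dpz] [px Dpx]]] := pchar0_PET nz_rz rz0 nz_rx rx0 (@pchar_num _).
set w := x *+ n - - z in Dpz Dpx.
have Dw : w = x *+ n + z by rewrite /w opprK.
exists w; split=> [||A A0 AD As].
- rewrite Dw; apply: algebraic_add alg_z.
  by elim: (n) => [|m IHm]; rewrite ?mulrS //; [exact: algebraic0 | exact: algebraic_add].
- exists (px :: [seq p \Po (- pz) | p <- ps]); rewrite /= Dpx; congr (_ :: _).
  rewrite -map_comp {1}Ds; apply: eq_map => p /=.
  by rewrite map_comp_poly horner_comp rmorphN hornerN Dpz opprK.
rewrite Dw; apply: (AD).
  have Ax : A x by apply: As; rewrite mem_head.
  by elim: (n) => [|m IHm]; rewrite ?mulrS //; apply: AD.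
by apply: Az => // y sy; apply: As; rewrite inE sy orbT.
Qed.

Lemma min_rat_poly (z : CC) : algebraicOver (ratr : rat -> CC) z ->
  exists r : {poly rat}, [/\ r != 0, root (map_poly ratr r) z &
    forall q : {poly rat}, root (map_poly ratr q) z -> q != 0 -> (size r <= size q)%N].
Proof.
case=> r0 nz_r0 r0z.
pose P n := `[< exists r : {poly rat}, [/\ r != 0, root (map_poly ratr r) z & size r = n] >].
have exP : exists n, P n by exists (size r0); apply/asboolP; exists r0.
case: (ex_minnP exP) => n /asboolP [r [nzr rz <-]] min_n; exists r; split=> // q qz nzq.
by apply: min_n; apply/asboolP; exists q.
Qed.

Lemma number_field_CC (s : seq CC) :
  (forall x, x \in s -> algebraicOver (ratr : rat -> CC) x) ->
  exists (Q : fieldExtType rat) (iota : {rmorphism Q -> CC}) (s1 : seq Q) (theta : Q),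
    [/\ map iota s1 = s, <<1 & s1>>%VS = fullv &
        forall x, exists p : {poly rat}, x = (map_poly (in_alg Q) p).[theta]].
Proof.
move=> /primitive_element_CC[z [alg_z [ps Ds] Az]].
have [r [nzr rz0 min_r]] := min_rat_poly alg_z.
have irr_r : irreducible_poly r by apply/(subfx_irreducibleP rz0 nzr).
pose Q := SubFieldExtType rz0 irr_r.
pose io : {rmorphism Q -> CC} := @subfx_inj _ _ (ratr : {rmorphism rat -> CC}) z r.
pose theta : Q := subfx_root (ratr : {rmorphism rat -> CC}) z r.
have io_theta : io theta = z by exact: subfx_inj_root.
have gen x : exists p : {poly rat}, x = (map_poly (in_alg Q) p).[theta].
  by have [p ->] := subfxEroot rz0 nzr x; exists p.
have io_rat q : io (in_alg Q q) = ratr q by exact: (subfx_inj_base rz0 nzr).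
have io_poly (p : {poly rat}) : io (map_poly (in_alg Q) p).[theta] = (map_poly ratr p).[z].
  rewrite -horner_map io_theta -map_poly_comp; congr _.[z].
  by apply: eq_map_poly => q; exact: io_rat.
pose s1 := [seq (map_poly (in_alg Q) p).[theta] | p <- ps].
have Ds1 : map io s1 = s.
  by rewrite Ds -map_comp; apply: eq_map => p /=; exact: io_poly.
exists Q, io, s1, theta; split=> //.
have [y gen_y Dy] : exists2 y, y \in <<1 & s1>>%VS & z = io y.
  apply: (Az (fun u => exists2 y, y \in <<1 & s1>>%VS & u = io y)).
  - by exists 0; rewrite ?mem0v ?rmorph0.
  - by move=> _ _ [u gu ->] [v gv ->]; exists (u + v); rewrite ?memvD ?rmorphD.
  move=> x; rewrite -Ds1 => /mapP[v s1v ->]; exists v => //.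
  exact: seqv_sub_adjoin.
have gen_theta : theta \in <<1 & s1>>%VS.
  by rewrite (_ : theta = y) //; apply: (fmorph_inj io); rewrite io_theta.
apply/vspaceP => x; rewrite memvf; have [p ->] := gen x.
elim/poly_ind: p => [|p b IH]; first by rewrite rmorph0 horner0 mem0v.
rewrite rmorphD rmorphM /= map_polyX map_polyC hornerMXaddC /=.
by apply: memvD; [apply: memvM | apply: memvZ; apply: mem1v].
Qed.

(** All complex roots of a common annihilating polynomial are adjoined, which makes the field a
    splitting field. *)
Lemma normal_number_field (s : seq CC) :
  (forall x, x \in s -> algebraicOver (ratr : rat -> CC) x) ->
  exists (Q : splittingFieldType rat) (iota : {rmorphism Q -> CC}) (theta : Q),
    (forall x, x \in s -> exists y, x = iota y) /\
    (forall x, exists p : {poly rat}, x = (map_poly (in_alg Q) p).[theta]).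
Proof.
move=> alg_s.
have [P nzP Ps] : exists2 P : {poly rat}, P != 0 & forall x, x \in s -> root (map_poly ratr P) x.
  elim: s alg_s => [_|x s IH hs]; first by exists 1; rewrite ?oner_neq0.
  have [|P nzP Ps] := IH; first by move=> y sy; apply: hs; rewrite inE sy orbT.
  have [p nzp px] := hs x (mem_head _ _).
  exists (p * P); first by rewrite mulf_neq0.
  by move=> y; rewrite rmorphM rootM inE => /predU1P[->|/Ps ->]; rewrite ?px ?orbT.
have [rs Drs] := closed_field_poly_normal (map_poly (ratr : rat -> CC) P).
have nzl : lead_coef (map_poly (ratr : rat -> CC) P) != 0.
  by rewrite lead_coef_eq0 map_poly_eq0.
have [|Q [io [s1 [theta [Ds1 gen_s1 gen]]]]] := @number_field_CC rs.
  move=> x rx; exists P => //; rewrite Drs rootZ // root_prod_XsubC //.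
have io_rat q : io (in_alg Q q) = ratr q by rewrite /= alg_num_field fmorph_rat.
have splitQ : splitting_field_axiom Q.
  exists (map_poly (in_alg Q) P).
    apply/polyOverP => i; rewrite coef_map /=; exact: memvZ (mem1v _).
  exists s1 => //.
  have -> : map_poly (in_alg Q) P = (in_alg Q (lead_coef P)) *: \prod_(x <- s1) ('X - x%:P).
    apply: (map_poly_inj io).
    rewrite map_polyZ rmorph_prod -map_poly_comp (eq_map_poly (g := ratr)) //.
    rewrite Drs -Ds1 big_map io_rat lead_coef_map; congr (_ *: _).
    by apply: eq_bigr => x _; rewrite /= map_polyXsubC.
  apply: eqp_scale; rewrite /= scaler_eq0 oner_eq0 orbF lead_coef_eq0 //.
pose QS : splittingFieldType rat := HB.pack Q (FieldExt_isSplittingField.Build rat Q splitQ).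
exists QS, io, theta; split=> // x /Ps.
rewrite Drs rootZ // root_prod_XsubC -Ds1 => /mapP[y _ ->]; exists y => //.
Qed.
Lemma galois_model (s : seq CC) :
  (forall x, x \in s -> algebraicOver (ratr : rat -> CC) x) ->
  exists (E : fieldType) (gT : finGroupType) (act : gT -> {rmorphism E -> E})
    (iota : {rmorphism E -> CC}),
  [/\ forall x, act 1%g x = x,
      forall g h x, act (g * h)%g x = act h (act g x),
      forall x, (forall g, act g x = x) ->
        exists q : rat, x = (numq q)%:~R / (denq q)%:~R,
      exists c, forall x, iota (act c x) = ((iota x)^*)%C
    & forall x, x \in s -> exists y, x = iota y] /\
  forall gamma x, (forall g, (forall h, act g (act h gamma) = act h gamma) -> act g x = x) ->
    normal_closure (iota gamma) (iota x).
Proof.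
move=> alg_s; have [Q [iota [theta [s_iota gen]]]] := normal_number_field alg_s.
pose gT : finGroupType := gal_of {:Q}.
pose act (g : gT) : {rmorphism Q -> Q} := fun_of_lfun (gal_repr g).
have act1 x : act 1%g x = x by exact: gal_id.
have actM g h x : act (g * h)%g x = act h (act g x) by apply: galM; exact: memvf.
have galQ : galois 1 {:Q}.
  rewrite /galois sub1v normalFieldf andbT; apply/separableP => x _.
  by apply: pcharf0_separable => p; rewrite pchar_lalg; exact: (pchar_num rat).
have fixK (K : {subfield Q}) x : (forall g, (forall y, y \in K -> act g y = y) -> act g x = x) -> x \in K.
  move=> hx; have galK : galois K {:Q} by apply: galoisS galQ; rewrite sub1v subvf.
  have /galois_fixedField <- := galK; apply/fixedFieldP => [|g Gg]; first exact: memvf.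
  by apply: hx => y Ky; apply: fixed_gal Gg Ky; exact: subvf.
have rat_form (q : rat) : q%:A = (numq q)%:~R / (denq q)%:~R :> Q.
  by rewrite alg_num_field.
have fixed_rat x : (forall g, act g x = x) -> exists q : rat, x = (numq q)%:~R / (denq q)%:~R.
  move=> hx; have /vlineP[q ->] : x \in 1%VS by apply: (fixK 1%AS) => g _.
  by exists q.
(* The complex conjugate of [iota theta] is a root of the same minimal polynomial, so by normality
   it is the image of some [b]; the automorphism sending [theta] to [b] realizes complex conjugation
   on all polynomials in [theta]. *)
have [c hc] : exists c, forall x, iota (act c x) = ((iota x)^*)%C.
  have normal1 : normalField 1 {:Q} by exact: normalFieldf.
  have rat_conj (q : {poly rat}) (z : CC) : ((map_poly ratr q).[z]^*)%C = (map_poly ratr q).[(z^*)%C].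
    rewrite -horner_map -map_poly_comp; congr _.[_].
    by apply: eq_map_poly => a /=; rewrite fmorph_rat.
  have io_poly (q : {poly rat}) y : iota (map_poly (in_alg Q) q).[y] = (map_poly ratr q).[iota y].
    rewrite -horner_map -map_poly_comp; congr _.[_].
    by apply: eq_map_poly => a /=; rewrite alg_num_field fmorph_rat.
  have [m Dm] : exists m : {poly rat}, minPoly 1 theta = map_poly (in_alg Q) m.
    have /polyOver1P[m ->] := minPolyOver 1%AS theta; by exists m.
  have [rs _ Drs] := normalFieldP normal1 theta (memvf _).
  have : root (map_poly iota (minPoly 1 theta)) ((iota theta)^*)%C.
    have -> : map_poly iota (minPoly 1 theta) = map_poly ratr m.
      by rewrite Dm -map_poly_comp; apply: eq_map_poly => a /=; rewrite alg_num_field fmorph_rat.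
    rewrite /root -rat_conj -io_poly -Dm.
    by have /eqP -> := root_minPoly 1 theta; rewrite rmorph0 conjc0.
  rewrite Drs rmorph_prod /= (eq_bigr (fun z => 'X - (iota z)%:P)); last first.
    by move=> y _; rewrite rmorphB /= map_polyX map_polyC.
  rewrite -(big_map iota predT (fun z => 'X - z%:P)) root_prod_XsubC => /mapP[b rb Db].
  have rootb : root (minPoly 1 theta) b by rewrite Drs root_prod_XsubC.
  have [g _ Dg] := normalField_root_minPoly (sub1v _) normal1 (memvf theta) rootb.
  exists g => x; have [q ->] := gen x.
  have -> : act g (map_poly (in_alg Q) q).[theta] = (map_poly (in_alg Q) q).[b].
    rewrite -horner_map -map_poly_comp -[X in _ = _.[X]]Dg; congr _.[_].
    by apply: eq_map_poly => a /=; rewrite linearZ /= rmorph1.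
  by rewrite !io_poly rat_conj Db.
exists (Q : fieldType), gT, act, iota; split; first by split=> //; exists c.
move=> gamma x hx.
pose gs := [seq act g gamma | g <- enum gT].
have gsP h : act h gamma \in gs by apply/mapP; exists h; rewrite ?mem_enum.
have xK : x \in <<1 & gs>>%AS.
  by apply: fixK => g hg; apply: hx => h; apply: hg; apply: seqv_sub_adjoin.
have [p Zp] := Zminpoly_exists iota act1 actM fixed_rat gamma.
have [F1 FB FM FV] := normal_closure_subfield (iota gamma).
set F := normal_closure _ in F1 FB FM FV *.
have gsF y : y \in gs -> F (iota y).
  case/mapP=> g _ -> L _; apply; apply: (Gorb_conjugate act1 actM fixed_rat Zp).
  by apply: mem_orbit_seq; rewrite inE.
have F0 : F 0 by rewrite -(subrr 1); apply: FB.
have FD u v : F u -> F v -> F (u + v).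
  by move=> Fu Fv; rewrite -[v]opprK; apply: (FB) => //; rewrite -sub0r; apply: (FB).
have Fn n : F n%:R by elim: n => // n IH; rewrite -natr1; apply: FD.
have Fz (z : int) : F z%:~R.
  case: z => n; first exact: (Fn n).
  by rewrite NegzE mulrNz -sub0r; apply: FB => //; exact: (Fn n.+1).
elim/last_ind: gs x xK gsF {hx gsP} => [|gs y IH] x.
  (* Without generators only the rationals remain; in the other case the element is a polynomial in
     the last generator over the field of the earlier ones. *)
  rewrite /= adjoin_nil subfield_closed => /vlineP[q ->] _.
  by rewrite rat_form fmorph_div !rmorph_int; apply: FM => //; apply: FV.
rewrite /= adjoin_rcons => /Fadjoin_polyP[r /polyOverP rK ->] gsF.
rewrite horner_coef rmorph_sum; elim/big_ind: _ => // i _; rewrite rmorphM rmorphXn.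
apply: (FM); first by apply: IH (rK i) _ => z gz; apply: gsF; rewrite mem_rcons inE gz orbT.
have Fy : F (iota y) by apply: gsF; rewrite mem_rcons mem_head.
by elim: (nat_of_ord i) => // n IHn; rewrite exprS; apply: FM.
Qed.
(** * Counting *)

Lemma in_A_algebraicOver d k (H : RR) z : in_A k d H z -> algebraicOver (ratr : rat -> CC) z.
Proof.
case=> p [_ [[nzp _ _ rz _] _ _ _ _]]; exists (map_poly intr p).
  by rewrite -size_poly_eq0 (size_map_inj_poly (intr_inj (R := rat))) // size_poly_eq0.
rewrite -map_poly_comp; have -> : map_poly ((ratr : rat -> CC) \o intr) p = intC p.
  by apply: eq_map_poly => n /=; rewrite rmorph_int.
exact: rz.
Qed.

Lemma valuation_family (E : fieldType) (iota : {rmorphism E -> CC}) :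
  exists V : nat -> {pred E}, forall p, prime p -> valuation_ring p (V p).
Proof.
suff /choice[V hV] : forall p, exists V : {pred E}, prime p -> valuation_ring p V by exists V.
move=> p.
have [p_pr|_] := boolP (prime p); last by exists (fun=> true).
have nzp : p%:R != 0 :> E by rewrite -(fmorph_eq0 iota) rmorph_nat pnatr_eq0 -lt0n prime_gt0.
have [|V hV] := @valuation_ring_exists E p nzp; last by exists V.
move=> z; apply/eqP => Dz.
have : (z * p%:Z)%:~R = 1 :> CC.
  by rewrite -(rmorph_int iota) rmorphM /= Dz mulVf // rmorph1.
move/eqP; rewrite -[1]/(1%:~R) eqr_int => /eqP zp1.
have := prime_gt1 p_pr; have := congr1 absz zp1; rewrite abszM /=.
by move/eqP; rewrite muln_eq1 => /andP[_ /eqP ->].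
Qed.

(** The field [E] depends on the list [s], so the conclusion is stated without it: only orbit
    lengths, the integer [n] and the index bound [d^d] survive. Some element of [s] is needed to
    realize [H^d] inside [E]. *)
Lemma in_A_structure d k (H : RR) (s : seq CC) :
  (0 < k)%N -> (k < d)%N -> 1 <= H -> s != [::] -> (forall z, z \in s -> in_A k d H z) ->
  exists (lsz : CC -> nat) (n : nat),
  [/\ (0 < n)%N, n%:R <= (H ^+ d) ^+ (d ^ d) &
      forall z, z \in s -> [/\ (lsz z %| gcdn k d)%N,
        forall l, ext_degree (normal_closure ((H ^+ d)%:C)%C) z l -> lsz z = l &
        gal_primitive z -> lsz z = 1%N]] /\
  forall l L W (s' : seq CC), H ^+ d < 2 ^+ L -> 2 ^+ (l + 3) * (4 * H ^+ l) < W%:R ->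
    uniq s' -> {subset s' <= s} -> (forall z, z \in s' -> lsz z = l) ->
    (size s' <= codes_bound d l n (d ^ d) L W)%N.
Proof.
move=> k_gt0 k_lt_d H1 s_neq0 sA.
have d_gt0 : (0 < d)%N by apply: leq_trans k_lt_d.
have [E [gT [act [iota [[act1 actM fixed_rat [c act_conj] s_iota] closure]]]]] :=
  galois_model (fun z sz => in_A_algebraicOver (sA z sz)).
have [V hV] := valuation_family iota.
have /choice[f hf] z : exists x, z \in s -> z = iota x.
  have [sz|_] := boolP (z \in s); last by exists 0.
  by have [x Dx] := s_iota z sz; exists x.
have [z0 sz0] : exists z0, z0 \in s by case: (s) s_neq0 => [|z0 ?] // _; exists z0; exact: mem_head.
have A_f z : z \in s -> in_A k d H (iota (f z)) by move=> sz; rewrite -hf //; exact: sA.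
have [gamma Dgamma] : exists gamma, iota gamma = ((H ^+ d)%:C)%C.
  have [a [b [_ _ _ _ Dg]]] := in_A_data act1 actM fixed_rat act_conj d_gt0 (A_f z0 sz0).
  by eexists; exact: Dg.
have goodA z : z \in s -> exists a, good act iota gamma d k (f z) a.
  by move=> sz; apply: (in_A_good act1 actM fixed_rat act_conj d_gt0 Dgamma); exact: A_f.
pose N := conj_fixer act1 actM gamma.
have normN : (N <| [set: gT])%g by exact: conj_fixer_normal.
have fixN g : g \in N -> act g gamma = gamma by exact: conj_fixer_fix.
have closN x : (forall g, g \in N -> act g x = x) -> normal_closure (iota gamma) (iota x).
  by move=> hx; apply: closure => g hg; apply: hx; apply/conj_fixerP.
have nrmG : nrm iota gamma = H ^+ d.
  by rewrite /nrm Dgamma absC_real ger0_norm // exprn_ge0 // (le_trans ler01).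
have [a0 g0] := goodA z0 sz0.
have cardN : (#|cosets N| <= d ^ d)%N.
  have [_ _ szd _ [b Dg]] := g0; rewrite -{1 2}szd.
  apply: (card_conj_fixer_cosets act1 actM _ Dg) => g.
  by rewrite rmorphM rmorphXn rmorphN1 rmorph_int.
have [w Dw] := coset_norm_int act1 actM fixed_rat hV fixN g0.
have [n_gt0 n_le _ _] := norm_gamma_nat act1 actM hV fixN g0 k_gt0 k_lt_d Dw.
exists (fun z => size (orbit_seq act N (f z))), `|w|%N; split; first split=> //.
- apply: le_trans n_le _; rewrite nrmG; apply: ler_weXn2l => //.
  by rewrite exprn_ege1.
- move=> z sz; have [a gz] := goodA z sz; have [p [_ [Zp _ _ _ _]]] := A_f z sz; split.
  + rewrite dvdn_gcd (Norb_dvd_k act1 actM normN fixN gz).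
    exact: (Norb_dvd_d act1 actM normN gz).
  + move=> l; rewrite -Dgamma {1}(hf z sz).
    exact: (ext_degree_Norb act1 actM fixed_rat normN fixN closN).
  rewrite {1}(hf z sz).
  exact: (primitive_Norb act1 actM fixed_rat normN fixN k_gt0 k_lt_d gz Zp).
move=> l L W s' hL hW Us' sub hl; rewrite -(size_map f).
apply: (counting act1 actM fixed_rat hV normN fixN act_conj k_gt0 k_lt_d H1 nrmG cardN Dw erefl hL hW).
  rewrite map_inj_in_uniq // => u v su sv Ef.
  by rewrite (hf u (sub _ su)) (hf v (sub _ sv)) Ef.
move=> _ /mapP[z sz ->]; split; first exact: goodA (sub _ sz).
exact: hl.
Qed.
Lemma two_power_above (y : RR) : 1 <= y -> exists L : nat, y < 2 ^+ L /\ 2 ^+ L <= 2 * y.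
Proof.
move=> y1.
have lt_N : y < 2 ^+ (Num.truncn y).+1.
  apply: lt_le_trans (truncnS_gt y) _; rewrite -natrX ler_nat; exact: ltnW (ltn_expl _ _).
have [v _ /andP[h1 h2]] := bucket_exists y1 lt_N.
by exists v.+1; split=> //; rewrite exprS ler_pM2l.
Qed.

Lemma codes_bound_le (d M : nat) (eps : RR) : (0 < d)%N -> 0 < eps ->
  exists2 C : RR, 0 < C & forall (H : RR) (n l : nat), 1 <= H -> (0 < n)%N ->
    n%:R <= (H ^+ d) ^+ M -> (l %| d)%N -> (0 < l)%N ->
    exists L W, [/\ H ^+ d < 2 ^+ L, 2 ^+ (l + 3) * (4 * H ^+ l) < W%:R &
      (codes_bound d l n M L W)%:R <= C * rpow H ((d * (l - 1))%N%:R + eps)].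
Proof.
move=> d_gt0 eps_gt0.
(* Four factors grow more slowly than any power of [H]: the two products over primes and the two
   powers of [L] and [2 * L]. Each may cost [H^e]. *)
pose e := eps / 4; have e_gt0 : 0 < e by rewrite divr_gt0.
(* [n] can reach [H^(d*M)]; the successor allows [M = 0]. *)
pose eta1 := e / (d * M).+1%:R; have eta1_gt0 : 0 < eta1 by rewrite divr_gt0 ?ltr0n.
pose eta2 := e / d%:R; have eta2_gt0 : 0 < eta2 by rewrite divr_gt0 ?ltr0n.
have [K1 K1_ge1 hK1] := divisor_bound (2 * (d * d`!)) d eta1_gt0.
have [K2 K2_ge1 hK2] := polynomial_le_exponential 2 d eta2_gt0.
have K1_gt0 : 0 < K1 := lt_le_trans ltr01 K1_ge1.
have K2_gt0 : 0 < K2 := lt_le_trans ltr01 K2_ge1.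
pose K3 := K2 * rpow 2 eta2.
have K3_gt0 : 0 < K3 by rewrite mulr_gt0 ?Rpower_gt0.
(* [W] is at most [2^(d+6) * H^l], and its exponent [m * (l - 1)] at most [d * d]. *)
pose Y0 : RR := (2 ^+ (d + 6)) ^+ (d * d).
have Y0_gt0 : 0 < Y0 by rewrite !exprn_gt0 // ltr0n.
pose C := 2 ^+ M * K1 ^+ 2 * K3 ^+ 2 * (33 ^+ d) ^+ 2 * Y0 * d%:R.
exists C; first by rewrite !mulr_gt0 ?exprn_gt0 ?exprn_gt0 ?ltr0n ?Rpower_gt0.
move=> H n l H1 n_gt0 n_le l_dvd l_gt0.
have H_gt0 : 0 < H := lt_le_trans ltr01 H1.
have Hd1 : 1 <= H ^+ d by rewrite exprn_ege1.
have [L [ltL leL]] := two_power_above Hd1.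
pose y := 2 ^+ (l + 3) * (4 * H ^+ l); pose W := (Num.truncn y).+1.
exists L, W; split=> //; first exact: truncnS_gt.
have le_ld : (l <= d)%N by apply: dvdn_leq.
set m := (d %/ l)%N; have le_md : (m <= d)%N by apply: leq_div.
have Dd : (m * l = d)%N by apply: divnK.
pose h := rpow H e; have h_gt0 : 0 < h by apply: Rpower_gt0.
have aux (x : nat) (z : RR) : (x.+1 ^ d)%N%:R <= z -> (x.+1 ^ m)%N%:R <= z.
  by apply: le_trans; rewrite ler_nat leq_pexp2l.
have P_le : (\prod_(p <- primes n) (2 * (l * (logn p n * d`!)) + 1) ^ m)%N%:R <= K1 * h.
  apply: le_trans (_ : K1 * rpow n%:R eta1 <= _); last first.
    rewrite ler_pM2l //; apply: le_trans (_ : rpow ((H ^+ d) ^+ M) eta1 <= _).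
      by apply: ler_Rpowerl => //; rewrite ?ltr0n // ltW.
    rewrite -exprM -Rpower_nat // RpowerA; apply: ler_Rpower => //.
    rewrite /eta1 mulrCA ler_piMr ?(ltW e_gt0) // ler_pdivrMr ?ltr0n // mul1r ler_nat.
    exact: leqnSn.
  apply: le_trans (hK1 n n_gt0); rewrite ler_nat; apply: leq_prod => p _.
  apply: leq_trans (_ : (2 * (d * d`!) * logn p n + 1) ^ m <= _)%N.
    have [->|m_gt0] := posnP m; first by rewrite !expn0.
    rewrite leq_exp2r // leq_add2r -!mulnA leq_mul2l /= [(d`! * _)%N]mulnC.
    by rewrite leq_mul2r le_ld orbT.
  by rewrite leq_pexp2l // addn1.
have L_le : ((2 * L + 1) ^ d)%N%:R <= K3 * h.
  apply: le_trans (hK2 L) _; rewrite /K3 -mulrA ler_pM2l //.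
  have -> : rpow 2 (eta2 * L%:R) = rpow (2 ^+ L) eta2.
    by rewrite -Rpower_nat ?ltr0n // RpowerA mulrC.
  apply: le_trans (_ : rpow (2 * H ^+ d) eta2 <= _).
    by apply: ler_Rpowerl; rewrite ?exprn_gt0 ?ltr0n // ltW.
  rewrite RpowerMl ?ltr0n ?exprn_gt0 // ler_pM2l ?Rpower_gt0 //.
  rewrite -Rpower_nat // RpowerA /eta2 mulrCA mulfV ?pnatr_eq0 -?lt0n // mulr1.
  exact: lexx.
have L1_le : (L ^ m)%N%:R <= K3 * h.
  apply: le_trans L_le; rewrite ler_nat; apply: leq_trans (_ : (2 * L + 1) ^ m <= _)%N.
    have [->|m_gt0] := posnP m; first by rewrite !expn0.
    by rewrite leq_exp2r // mul2n -addnn -addnA leq_addr.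
  by rewrite leq_pexp2l // addn1.
have L2_le : ((2 * L) ^ m)%N%:R <= K3 * h.
  apply: le_trans L_le; rewrite ler_nat; apply: leq_trans (_ : (2 * L + 1) ^ m <= _)%N.
    have [->|m_gt0] := posnP m; first by rewrite !expn0.
    by rewrite leq_exp2r // leq_addr.
  by rewrite leq_pexp2l // addn1.
have W_le : W%:R <= 2 ^+ (d + 6) * H ^+ l.
  have y_ge0 : 0 <= y by rewrite !mulr_ge0 ?exprn_ge0 ?ler0n // ltW.
  rewrite /W -natr1; apply: le_trans (_ : y + 1 <= _).
    by rewrite lerD2r truncn_le.
  have Hl1 : 1 <= H ^+ l by rewrite exprn_ege1.
  have -> : y = 2 ^+ (l + 5) * H ^+ l by rewrite /y (_ : (l + 5 = l + 3 + 2)%N) ?exprD; [ring | rewrite -addnA].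
  apply: le_trans (_ : 2 ^+ (l + 5) * H ^+ l + 2 ^+ (l + 5) * H ^+ l <= _).
    by rewrite lerD2l mulr_ege1 // exprn_ege1 // ler1n.
  have -> : 2 ^+ (l + 5) * H ^+ l + 2 ^+ (l + 5) * H ^+ l = 2 ^+ (l + 6) * H ^+ l.
    by rewrite (_ : (l + 6 = (l + 5).+1)%N) ?exprS; [ring | rewrite addnS].
  rewrite ler_pM2r ?exprn_gt0 //; apply: ler_weXn2l; first by rewrite ler1n.
  by rewrite leq_add2r.
have Wm_le : (W ^ (m * (l - 1)))%N%:R <= Y0 * H ^+ (d * (l - 1)).
  rewrite natrX; apply: le_trans (_ : (2 ^+ (d + 6) * H ^+ l) ^+ (m * (l - 1)) <= _).
    by apply: lerXn2r; rewrite ?nnegrE ?ler0n // mulr_ge0 ?exprn_ge0 ?ler0n // ltW.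
  rewrite exprMn -[(H ^+ l) ^+ _]exprM mulnA [(l * m)%N]mulnC Dd ler_pM2r ?exprn_gt0 //.
  apply: ler_weXn2l; first by rewrite exprn_ege1 // ler1n.
  by apply: leq_mul => //; apply: leq_trans (leq_subr _ _) _.
have c_le : (33 ^ m)%N%:R <= 33 ^+ d :> RR by rewrite -natrX ler_nat leq_pexp2l.
have -> : C * rpow H ((d * (l - 1))%N%:R + eps) =
  2 ^+ M * (K1 * h * (K1 * h * (K3 * h * (K3 * h * (33 ^+ d * (33 ^+ d * (Y0 * H ^+ (d * (l - 1)) * d%:R))))))).
  have -> : rpow H ((d * (l - 1))%N%:R + eps) = H ^+ (d * (l - 1)) * h ^+ 4.
    rewrite RpowerD Rpower_nat // -[h ^+ 4]Rpower_nat // RpowerA; congr (_ * Rpower _ _).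
    by rewrite /e divfK // pnatr_eq0.
  rewrite /C; ring.
have nat_pM (u v : nat) (z t : RR) : u%:R <= z -> v%:R <= t -> (u * v)%N%:R <= z * t.
  by move=> uz vt; rewrite natrM; apply: ler_pM; rewrite ?ler0n.
rewrite /codes_bound -/m; apply: (nat_pM); first by rewrite natrX.
by do 7!(apply: (nat_pM) => //); rewrite ler_nat.
Qed.
Lemma counting_bounds (d k : nat) (eps : RR) : (0 < k)%N -> (k < d)%N -> 0 < eps ->
  exists2 C : RR, 0 < C & forall H : RR, 1 <= H ->
  [/\ forall l : nat, (l %| gcdn k d)%N ->
        card_le (fun alpha => in_A k d H alpha /\
                   ext_degree (normal_closure ((H ^+ d)%:C)%C) alpha l)
          (C * rpow H ((d * (l - 1))%N%:R + eps))%R,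
      card_le (in_A k d H) (C * rpow H ((d * (gcdn k d - 1))%N%:R + eps))%R
    & card_le (fun alpha => in_A k d H alpha /\ gal_primitive alpha)
        (C * rpow H eps)%R].
Proof.
move=> k_gt0 k_lt_d eps_gt0; have d_gt0 : (0 < d)%N by apply: leq_trans k_lt_d.
have [C C_gt0 hC] := codes_bound_le (d ^ d) d_gt0 eps_gt0.
set g := gcdn k d; have g_gt0 : (0 < g)%N by rewrite gcdn_gt0 k_gt0.
(* The factor serves (ii), where the elements are sorted by orbit length, a number between 0 and
   [g]. *)
exists (g.+1%:R * C); first by rewrite mulr_gt0 ?ltr0n.
move=> H H1.
have C_le (x : RR) : 0 <= x -> C * x <= g.+1%:R * C * x.
  by move=> x0; rewrite -mulrA ler_peMl ?mulr_ge0 ?(ltW C_gt0) // ler1n.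
have rp_ge0 a : 0 <= rpow H a by apply: ltW; exact: Rpower_gt0.
have bound l (s s' : seq CC) (lsz : CC -> nat) n : (l %| g)%N ->
    (0 < n)%N -> n%:R <= (H ^+ d) ^+ (d ^ d) ->
    (forall l L W (s' : seq CC), H ^+ d < 2 ^+ L -> 2 ^+ (l + 3) * (4 * H ^+ l) < W%:R ->
      uniq s' -> {subset s' <= s} -> (forall z, z \in s' -> lsz z = l) ->
      (size s' <= codes_bound d l n (d ^ d) L W)%N) ->
    uniq s' -> {subset s' <= s} -> (forall z, z \in s' -> lsz z = l) ->
    (size s')%:R <= C * rpow H ((d * (l - 1))%N%:R + eps).
  move=> l_g n_gt0 n_le hs Us' sub hl.
  have l_d : (l %| d)%N := dvdn_trans l_g (dvdn_gcdr _ _).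
  have [L [W [hL hW hb]]] := hC H n l H1 n_gt0 n_le l_d (dvdn_gt0 g_gt0 l_g).
  by apply: le_trans hb; rewrite ler_nat; exact: hs hL hW Us' sub hl.
have nil_le (x : RR) : 0 <= x -> (size ([::] : seq CC))%:R <= g.+1%:R * C * x.
  by move=> x0; rewrite !mulr_ge0 ?ler0n ?(ltW C_gt0).
split.
- move=> l l_g s Us sP.
  have [->|s0] := eqVneq s [::]; first exact: nil_le.
  have [|lsz [n [[n_gt0 n_le hz] hs]]] := in_A_structure k_gt0 k_lt_d H1 s0.
    by move=> z /sP[].
  apply: le_trans (C_le _ (rp_ge0 _)); apply: (bound l s s lsz n) => // z sz.
  by have [_ + _] := hz z sz; apply; case: (sP z sz).
- move=> s Us sP.
  have [->|s0] := eqVneq s [::]; first exact: nil_le.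
  have [lsz [n [[n_gt0 n_le hz] hs]]] := in_A_structure k_gt0 k_lt_d H1 s0 sP.
  set X := rpow H _.
  have CX_ge0 : 0 <= C * X by apply: mulr_ge0; [exact: ltW | exact: rp_ge0].
  rewrite -mulrA; apply: le_trans (_ : (g.+1 * Num.truncn (C * X))%N%:R <= _); last first.
    by rewrite natrM ler_wpM2l ?ler0n // truncn_le.
  rewrite ler_nat.
  have := @code_stage _ unit [:: tt] (fun _ z v => lsz z = v) (fun=> g.+1) (Num.truncn (C * X)) s.
  rewrite big_seq1; apply=> [_ z _ sz|s' sub hl].
    exists (lsz z) => //; have [l_g _ _] := hz z sz; rewrite ltnS; exact: dvdn_leq.
  rewrite truncn_ge_nat //; have [->|] := eqVneq s' [::]; first by [].
  case: s' sub hl => // z0 s' sub hl _.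
  have [l hl'] := hl tt (mem_head _ _).
  have [l_g _ _] := hz z0 (mem_subseq sub (mem_head _ _)).
  rewrite hl' ?mem_head // in l_g.
  apply: le_trans (bound l s (z0 :: s') lsz n l_g n_gt0 n_le hs _ _ hl') _.
  + exact: subseq_uniq sub Us.
  + exact: mem_subseq.
  rewrite ler_pM2l // /X; apply: ler_Rpower => //; rewrite lerD2r ler_nat leq_mul2l.
  by rewrite leq_sub2r ?orbT // dvdn_leq.
move=> s Us sP.
have [->|s0] := eqVneq s [::]; first exact: nil_le.
have [|lsz [n [[n_gt0 n_le hz] hs]]] := in_A_structure k_gt0 k_lt_d H1 s0.
  by move=> z /sP[].
apply: le_trans (C_le _ (rp_ge0 _)).
have -> : rpow H eps = rpow H ((d * (1 - 1))%N%:R + eps) by rewrite subnn muln0 add0r.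
apply: (bound 1%N s s lsz n) => // z sz.
by have [_ _] := hz z sz; apply; case: (sP z sz).
Qed.

(** A duplicate-free list of maximal length inside [P] exhausts [P]. *)
Lemma card_le_enum (P : CC -> Prop) (b : RR) : card_le P b ->
  exists s : seq CC, uniq s /\ forall z, z \in s <-> P z.
Proof.
move=> hb.
pose Q n := `[< exists s : seq CC, [/\ uniq s, forall z, z \in s -> P z & size s = n] >].
have exQ : exists n, Q n by exists 0%N; apply/asboolP; exists [::].
have maxQ n : Q n -> (n <= Num.truncn b)%N.
  move=> /asboolP[s [Us sP <-]]; rewrite truncn_ge_nat; first exact: hb.
  by apply: le_trans (hb s Us sP); rewrite ler0n.
case: (ex_maxnP exQ maxQ) => n /asboolP[s [Us sP Dn]] max_n.
exists s; split=> // z; split=> [/sP //|Pz]; apply: contraT => nsz.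
have : Q n.+1.
  apply/asboolP; exists (z :: s); split; rewrite /= ?nsz ?Dn // => y.
  by rewrite inE => /predU1P[->|/sP].
by move/max_n; rewrite ltnn.
Qed.

Lemma ltr_ln (x y : RR) : 0 < x -> x < y -> ln x < ln y.
Proof. by move=> /RltP x0 /RltP xy; apply/RltP; apply: ln_increasing. Qed.

Lemma ln_ge0 (x : RR) : 1 <= x -> 0 <= ln x.
Proof.
rewrite le_eqVlt => /predU1P[<-|x1]; first by rewrite ln_1.
by rewrite -[0]ln_1 ltW // ltr_ln.
Qed.

Lemma gcd1_limit (d k : nat) : (0 < k)%N -> (k < d)%N -> gcdn k d = 1%N -> a_lim_zero k d.
Proof.
move=> k_gt0 k_lt_d g1 e e_gt0.
pose e4 := e / 4; have e4_gt0 : 0 < e4 by rewrite divr_gt0.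
have [C C_gt0 hC] := counting_bounds k_gt0 k_lt_d e4_gt0.
(* Beyond [C^(4/e)] the constant is absorbed by [H^(e/4)], so the cardinality is at most
   [H^(e/2) < H^e]; the 2 ensures [ln H > 0]. *)
exists (Num.max 2 (rpow C e4^-1)) => H [z0 Az0]; rewrite ge_max => /andP[H2 HC].
have H_gt1 : 1 < H by apply: lt_le_trans H2; rewrite ltr1n.
have H_gt0 := lt_trans ltr01 H_gt1.
have [_ hcard _] := hC H (ltW H_gt1).
have [s [Us sP]] := card_le_enum hcard.
exists s; split=> //.
have s_gt0 : (0 < size s)%N by move/sP: Az0; case: (s).
have lnH : 0 < ln H by rewrite -[0]ln_1 ltr_ln.
have le_s : (size s)%:R < rpow H e.
  apply: le_lt_trans (hcard s Us (fun z => (sP z).1)) _; rewrite g1 subnn muln0 add0r.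
  have CH : C <= rpow H e4.
    have -> : C = rpow (rpow C e4^-1) e4.
      by rewrite RpowerA mulVf ?lt0r_neq0 // Rpower1.
    by apply: ler_Rpowerl => //; [exact: ltW | exact: Rpower_gt0].
  have De : e = e4 + e4 + (e4 + e4) by rewrite /e4; lra.
  have h1 : 1 < rpow H (e4 + e4) by rewrite Rpower_base_gt1 // addr_gt0.
  rewrite De RpowerD; apply: le_lt_trans (_ : rpow H (e4 + e4) < _).
    by rewrite RpowerD ler_pM2r ?Rpower_gt0.
  by rewrite ltr_pMr // Rpower_gt0.
have lns := ln_ge0 (_ : 1 <= (size s)%:R).
rewrite ger0_norm; last by rewrite divr_ge0 ?(ltW lnH) // lns ?ler1n.
rewrite ltr_pdivrMr //.
have -> : e * ln H = ln (rpow H e) by rewrite /Rpower ln_exp.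
by apply: ltr_ln => //; rewrite ltr0n.
Qed.

Theorem theorem5p2 (d k : nat) :
  (1 <= k)%N -> (k <= d.-1)%N ->
  (forall eps : RR, 0 < eps ->
   exists Cst : RR, forall H : RR, algebraic (H%:C)%C -> 1 <= H ->
     [/\ (forall l : nat, (l %| gcdn k d)%N ->
            card_le (fun alpha => in_A k d H alpha /\
                                  ext_degree (normal_closure ((H ^+ d)%:C)%C) alpha l)
                    (Cst * Rpower H ((d * (l - 1))%N%:R + eps))),
         card_le (in_A k d H) (Cst * Rpower H ((d * (gcdn k d - 1))%N%:R + eps))
       & card_le (fun alpha => in_A k d H alpha /\ gal_primitive alpha)
                 (Cst * Rpower H eps)])
  /\ (gcdn k d = 1%N -> a_lim_zero k d).
Proof.
move=> k_gt0 k_le; have k_lt_d : (k < d)%N by case: d k_le k_gt0 => // /[!leqn0] /eqP ->.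
split=> [eps eps_gt0|]; last exact: gcd1_limit.
have [C _ hC] := counting_bounds k_gt0 k_lt_d eps_gt0.
by exists C => H _ H1; exact: hC.
Qed.
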